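(* Let $M$ be an irreducible quasi-finite highest weight $\widehat{\mathcal D}$-module with highest weight $\xi$. Then $M$ is unitarizable (with respect to the $\ast$-structure $\omega$) if and only if there exists $k\in\frac12\mathbb Z_+$ such that $\xi=\Lambda^{\widehat{\mathcal D}}(\lambda)$ for some partition $\lambda$ of length $2k$ with $\lambda'_1+\lambda'_2\le2k$. In other words, $M$ is unitarizable if and only if $$\xi=\sum_{j\in\frac12\mathbb N,\ j\le r}\xi_j\omega_j+k\Lambda_0$$ for some $k\in\frac12\mathbb Z_+$, $r\in\mathbb N$ and $\xi_j\in\mathbb Z$ satisfying (with $\xi_j:=0$ for $j>r$): (i) $\xi_{\frac12}>\xi_{\frac32}>\cdots>\xi_{r-\frac12}\ge0$, $\ \xi_1>\xi_2>\cdots>\xi_r\ge0$, and $\xi_{r-\frac12}=0$ if and only if $r=1$ and $\xi_{\frac12}=\xi_1=0$; (ii) $\xi_1+\xi_2+l_{1,2}(\xi_{\frac12})+\min\{\xi_{\frac32},1\}\le2k$, where $l_{1,2}:\mathbb Z_+\to\mathbb Z_+$ is given by $l_{1,2}(0)=0$, $l_{1,2}(1)=1$, and $l_{1,2}(x)=2$ for $x\ge2$.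
   Context: All vector spaces are over $\mathbb C$; $\mathbb N=\{1,2,\dots\}$, $\mathbb Z_+=\{0,1,2,\dots\}$, $\mathbb Z^*=\mathbb Z\setminus\{0\}$. Let $\mathrm{gl}_{\infty|\infty}$ be the space of complex matrices $(a_{ij})_{i,j\in\frac12\mathbb Z}$ with $a_{ij}=0$ for $|i-j|\gg0$; $e_{pq}$ denotes the matrix unit. It is $\frac12\mathbb Z$-graded: the degree-$k$ component consists of all $\sum_{j\in\frac12\mathbb Z}a_je_{j-k,j}$. Elements of integer degree are even, elements of degree in $\frac12+\mathbb Z$ are odd, and $[A,B]=AB-(-1)^{|A||B|}BA$. Let $J=\sum_{r\le0}e_{rr}$, $\mathrm{Str}(D)=\sum_{r}(-1)^{2r}d_{rr}$, $\alpha(A,B)=\mathrm{Str}([J,A]B)$. Then $\widehat{\mathrm{gl}}_{\infty|\infty}=\mathrm{gl}_{\infty|\infty}\oplus\mathbb CC$ is the central extension with $C$ even, central, of degree $0$, and the bracket of $A,B\in\mathrm{gl}_{\infty|\infty}$ equal to $[A,B]+\alpha(A,B)C$. Let $\mathcal A\subset \mathrm{gl}_{\infty|\infty}$ be the matrices with $a_{ij}=0$ if $i=0$ or $j=0$; it acts on the superspace $V$ with even basis $e_j$ ($j\in\mathbb Z^*$) and odd basis $e_r$ ($r\in\frac12+\mathbb Z$). Let $(\cdot|\cdot)$ be the bilinear form on $V$ with $(e_i|e_j)=\delta_{i,-j}$ ($i,j\in\mathbb Z^*$), $(e_r|e_s)=\mathrm{sgn}(r)\delta_{r,-s}$ ($r,s\in\frac12+\mathbb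 Z$), $(e_i|e_r)=(e_r|e_i)=0$. Let $\mathcal D\subset\mathcal A$ be the graded subalgebra spanned by the $A\in\mathcal A$ of parity $\epsilon\in\{0,1\}$ satisfying $(Av|w)=-(-1)^{\epsilon|v|}(v|Aw)$ for all homogeneous $v$ and all $w$ in $V$, and let $\widehat{\mathcal D}=\mathcal D\oplus\mathbb CC\subset\widehat{\mathrm{gl}}_{\infty|\infty}$ with the induced grading. Put $\tilde e_{rr}=e_{rr}-e_{-r,-r}$ for $r\in\frac12\mathbb N$; $\widehat{\mathcal D}_0=\{\sum_{r\in\frac12\mathbb N}a_r\tilde e_{rr}+cC\}$, and $\omega_s$ ($s\in\frac12\mathbb N$), $\Lambda_0\in(\widehat{\mathcal D}_0)^*$ are defined by $\omega_s(\sum a_r\tilde e_{rr}+cC)=a_s$, $\Lambda_0(\sum a_r\tilde e_{rr}+cC)=c$. For a $\frac12\mathbb Z$-graded Lie superalgebra $\mathfrak g$ with $\mathfrak g_0$ abelian, put $\mathfrak g_\pm=\bigoplus_{r>0}\mathfrak g_{\pm r}$. A highest weight module with highest weight $\xi\in\mathfrak g_0^*$ is a module $M$ containing $v_\xi\neq0$ with $hv_\xi=\xi(h)v_\xi$ for $h\in\mathfrak g_0$, $\mathfrak g_+v_\xi=0$, $\mathcal U(\mathfrak g_-)v_\xi=M$; it is graded by giving $v_\xi$ degree $0$, and is quasi-finite if all homogeneous components are finite dimensional. $\ast$-structure: $\omega$ is the restriction to $\widehat{\mathcal D}$ of the anti-linear map of $\widehat{\mathrm{gl}}_{\infty|\infty}$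 with $\omega(C)=C$, $\omega(\sum_pa_pe_{p-k,p})=\sum_p(-1)^{[p]+[p-k]}\overline{a_p}\,e_{p,p-k}$, where $[r]=1$ if $r\in\frac12+\mathbb Z$ and $r<0$, and $[r]=0$ otherwise; it preserves $\widehat{\mathcal D}$ and satisfies $\omega([x,y])=[\omega(y),\omega(x)]$. A module $M$ is unitarizable if it admits a positive definite Hermitian form with $\langle xv|v'\rangle=\langle v|\omega(x)v'\rangle$ for all $x$ and all $v,v'\in M$. A partition of length $n$ is a non-increasing sequence $\lambda=(\lambda_1,\dots,\lambda_n)$ of non-negative integers (zeros allowed); $\lambda'_j=\#\{i:\lambda_i\ge j\}$; $\mathrm{rank}(\lambda)$ is the largest $i$ with $\lambda_i\ge i$. For $\lambda\ne0$ of rank $r$ put $\xi_i=\lambda_{i+\frac12}-i+\frac12$ ($i=\frac12,\frac32,\dots,r-\frac12$), $\xi_j=\lambda'_j-j$ ($j=1,\dots,r$); for $\lambda=0$ put $r=1$, $\xi_{\frac12}=\xi_1=0$. For $\lambda$ of length $2k$, $\Lambda^{\widehat{\mathcal D}}(\lambda):=\sum_{j\in\frac12\mathbb N,\,j\le r}\xi_j\omega_j+k\Lambda_0$. *)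

(* Defs.v *)
From HB Require Import structures.
From mathcomp Require Import all_boot all_order all_algebra.
From mathcomp Require Import sesquilinear zify ring.
From mathcomp Require Import boolp classical_sets functions cardinality fsbigop.
From mathcomp Require Import reals complex.

Set Implicit Arguments.
Unset Strict Implicit.
Unset Printing Implicit Defensive.

Import Order.TTheory GRing.Theory Num.Theory.
Local Open Scope classical_set_scope.
Local Open Scope ring_scope.

(* A half-integer r is encoded throughout by the integer 2r : an index or a
   degree p : int stands for p/2.  In particular p/2 lies in 1/2 + Z iff p is
   odd. *)
Definition hodd (p : int) : bool := odd `|p|%N.

Definition lspan (K : pzRingType) (V : lmodType K) (S : set V) : set V :=
  [set w | exists n (c : 'I_n -> K) (f : 'I_n -> V),
     (forall i, S (f i)) /\ w = \sum_(i < n) c i *: f i].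

Lemma lspan_submod (K : pzRingType) (V : lmodType K) (S : set V) :
  lspan S 0 /\
  forall a u w, lspan S u -> lspan S w -> lspan S (a *: u + w).
Proof.
split.
  exists 0%N, (fun=> 0), (fun=> 0); split; first by case.
  by rewrite big_ord0.
move=> a _ _ [n [c [f [Sf ->]]]] [m [d [g [Sg ->]]]].
exists (n + m)%N,
  (fun i : 'I_(n + m) => match fintype.split i with inl j => a * c j | inr j => d j end),
  (fun i : 'I_(n + m) => match fintype.split i with inl j => f j | inr j => g j end);
  split.
  by move=> i; case: fintype.split.
rewrite big_split_ord /= scaler_sumr; congr (_ + _); apply: eq_bigr => i _.
  by rewrite (unsplitK (inl i)) scalerA.
by rewrite (unsplitK (inr i)).
Qed.

Lemma lspan_le (K : pzRingType) (V : lmodType K) (S P : set V) :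
  P 0 -> (forall a u w, P u -> P w -> P (a *: u + w)) -> S `<=` P ->
  lspan S `<=` P.
Proof.
move=> P0 PD SP _ [n [c [f [Sf ->]]]].
by apply: (big_ind P) => [//|u w Pu Pw|i _];
  [rewrite -[u]scale1r | rewrite -[_ *: _]addr0]; apply: PD => //; apply: SP.
Qed.

Lemma sub_lspan (K : pzRingType) (V : lmodType K) (S : set V) : S `<=` lspan S.
Proof.
move=> w Sw; exists 1%N, (fun=> 1), (fun=> w); split=> //.
by rewrite big_ord1 scale1r.
Qed.

Section FiniteSums.
Variable C : numClosedFieldType.
Implicit Types F G : int -> C.

Lemma fsum_restr (S : set int) F : (forall k, ~ S k -> F k = 0) ->
  \sum_(k \in [set: int]) F k = \sum_(k \in S) F k.
Proof. by move=> FS; apply/esym/fsbig_widen => // k [_ /FS]. Qed.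

Lemma fsum1 (j : int) F : (forall k, k != j -> F k = 0) ->
  \sum_(k \in [set: int]) F k = F j.
Proof.
move=> Fj; rewrite (@fsum_restr [set j]) ?fsbig_set1// => k /eqP kj.
exact: Fj.
Qed.

Lemma fsum_linear (S : set int) (a : C) F G : finite_set S ->
  (forall k, ~ S k -> F k = 0) -> (forall k, ~ S k -> G k = 0) ->
  \sum_(k \in [set: int]) (a * F k + G k) =
  a * (\sum_(k \in [set: int]) F k) + \sum_(k \in [set: int]) G k.
Proof.
move=> finS FS GS; rewrite mulr_fsumr !(@fsum_restr S) //.
- by rewrite fsbig_split.
- by move=> k /FS ->; rewrite mulr0.
- by move=> k Sk; rewrite FS ?GS// mulr0 addr0.
Qed.

Lemma fsumN F : \sum_(k \in [set: int]) F k = \sum_(k \in [set: int]) F (- k).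
Proof.
by apply: reindex_fsbigT; exists (fun k : int => - k) => k; rewrite opprK.
Qed.

End FiniteSums.

Lemma finite_ball (i : int) (N : nat) :
  finite_set [set k : int | (`|i - k|%N <= N)%N].
Proof.
apply: (@sub_finite_set _ _ ((fun m : nat => i - N%:Z + m%:Z) @` `I_(N.*2.+1))).
  move=> k /= hk; exists `|(k - (i - N%:Z))%R|%N; rewrite /=; lia.
exact/finite_image/finite_II.
Qed.

Section Gl.
Variable C : numClosedFieldType.

Definition banded : {pred int -> int -> C^o} := fun A =>
  `[< exists N : nat, forall i j : int, (N < `|i - j|)%N -> A i j = 0 >].

Lemma banded_submod : submod_closed banded.
Proof.
split; first by apply/asboolP; exists 0%N.
move=> a A B /asboolP[N hA] /asboolP[K hB]; apply/asboolP.
exists (maxn N K) => i j; rewrite gtn_max => /andP[h1 h2] /=.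
by rewrite [LHS](_ : _ = a * A i j + B i j) // hA ?hB ?mulr0 ?addr0.
Qed.

HB.instance Definition _ :=
  GRing.isSubmodClosed.Build C (int -> int -> C^o) banded banded_submod.

Record gl := Gl { glval :> int -> int -> C^o; glvalP : banded glval }.
HB.instance Definition _ := [isSub for glval].
HB.instance Definition _ := [Choice of gl by <:].
HB.instance Definition _ := [SubChoice_isSubLmodule of gl by <:].

Implicit Types A B : gl.

Lemma glP A B : (forall i j, A i j = B i j) -> A = B.
Proof. by move=> AB; apply/val_inj/funext => i; apply/funext => j; apply: AB. Qed.

Lemma glDE A B i j : (A + B) i j = A i j + B i j. Proof. by []. Qed.
Lemma glZE (a : C) A i j : (a *: A) i j = a * A i j. Proof. by []. Qed.
Lemma gl0E i j : (0 : gl) i j = 0. Proof. by []. Qed.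
Lemma glNE A i j : (- A) i j = - A i j. Proof. by []. Qed.

Lemma row_finite A i : exists2 S : set int, finite_set S &
  forall k, ~ S k -> A i k = 0.
Proof.
have /asboolP[N hN] := glvalP A; exists [set k : int | (`|i - k|%N <= N)%N]; first exact: finite_ball.
by move=> k /negP; rewrite -ltnNge => /hN.
Qed.

Lemma banded_mul A B :
  banded (fun i j => \sum_(k \in [set: int]) A i k * B k j).
Proof.
have /asboolP[N hA] := glvalP A; have /asboolP[K hB] := glvalP B.
apply/asboolP; exists (N + K)%N => i j hij; apply: fsbig1 => k _.
have [hik|hik] := ltnP N `|i - k|%N; first by rewrite hA ?mul0r.
by rewrite hB ?mulr0//; lia.
Qed.
Definition glmul A B : gl := Gl (banded_mul A B).

Definition glparity (e : bool) A : Prop :=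
  forall i j, A i j != 0 -> hodd (i - j) = e.

Lemma banded_part (e : bool) A :
  banded (fun i j => if hodd (i - j) == e then A i j else 0).
Proof.
have /asboolP[N hA] := glvalP A; apply/asboolP; exists N => i j /hA ->.
by case: ifP.
Qed.
Definition glpart (e : bool) A : gl := Gl (banded_part e A).

(* The superbracket, extended bilinearly from homogeneous A, B. *)
Definition glbracket A B : gl :=
  \sum_(e : bool) \sum_(f : bool)
    (glmul (glpart e A) (glpart f B)
       - (-1 : C) ^+ (e && f) *: glmul (glpart f B) (glpart e A)).

Definition gldegree (k : int) A : Prop :=
  forall i j, A i j != 0 -> i = j - k.

Lemma banded_J :
  banded (fun i j => if (i == j) && (i <= 0) then 1 else 0).
Proof.
apply/asboolP; exists 0%N => i j hij.
by have /negPf-> : i != j by lia.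
Qed.
Definition glJ : gl := Gl banded_J.

Definition Str A : C := \sum_(r \in [set: int]) (-1) ^+ hodd r * A r r.

(* For all A, B the matrix [J, A]B has finitely many nonzero diagonal entries,
   so the sum in Str ranges over a finite set. *)
Definition cocycle A B : C := Str (glmul (glbracket glJ A) B).

(* (A, c) stands for A + c C *)
Definition glhat : Type := (gl * C^o)%type.
HB.instance Definition _ := GRing.Lmodule.on glhat.

Definition glhat_bracket (x y : glhat) : glhat :=
  (glbracket x.1 y.1, cocycle x.1 y.1).

Definition nsign (r : int) : bool := hodd r && (r < 0).

Lemma banded_omega A :
  banded (fun i j => (-1) ^+ (nsign i + nsign j) * (A j i)^*).
Proof.
have /asboolP[N hA] := glvalP A; apply/asboolP; exists N => i j hij.
by rewrite hA ?conjC0 ?mulr0//; lia.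
Qed.
Definition gl_omega A : gl := Gl (banded_omega A).

Definition glhat_omega (x : glhat) : glhat := (gl_omega x.1, (x.2 : C)^*).

Definition inA A : Prop := forall i, A i 0 = 0 /\ A 0 i = 0.

(* V consists of the finitely supported v : int -> C (coordinates in the basis
   (e_i)) with v 0 = 0. *)
Definition inV (v : int -> C) : Prop := finite_set [set i | v i != 0] /\ v 0 = 0.
Definition vparity (d : bool) (v : int -> C) : Prop :=
  forall i, v i != 0 -> hodd i = d.

Definition glact A (v : int -> C) : int -> C :=
  fun i => \sum_(j \in [set: int]) A i j * v j.

Definition vsgn (i : int) : C := if hodd i then (sgz i)%:~R else 1.
(* (e_i | e_j) = vsgn i if j = - i, and 0 otherwise *)
Definition vform (v w : int -> C) : C :=
  \sum_(i \in [set: int]) v i * w (- i) * vsgn i.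

Definition skew (e : bool) A : Prop :=
  forall (d : bool) (v w : int -> C), inV v -> inV w -> vparity d v ->
    vform (glact A v) w = - ((-1) ^+ (e && d) * vform v (glact A w)).

Definition Dgen (A : gl) : Prop :=
  exists e, [/\ inA A, glparity e A & skew e A].

Definition inD : set gl := lspan [set A | Dgen A].

Definition inDhat : {pred glhat} := fun x => `[< inD x.1 >].

Lemma inDhat_submod : submod_closed inDhat.
Proof.
have [D0 DD] := lspan_submod [set A | Dgen A].
split; first exact/asboolP.
by move=> a x y /asboolP hx /asboolP hy; apply/asboolP; apply: DD.
Qed.

HB.instance Definition _ :=
  GRing.isSubmodClosed.Build C glhat inDhat inDhat_submod.

Record Dhat := MkDhat { Dhatval :> glhat; DhatvalP : inDhat Dhatval }.
HB.instance Definition _ := [isSub for Dhatval].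
HB.instance Definition _ := [Choice of Dhat by <:].
HB.instance Definition _ := [SubChoice_isSubLmodule of Dhat by <:].

(* skew on the pairs (e_j, e_{-i}); by skewP it is equivalent to skew, and is
   used below to show that D is closed under the bracket and under omega. *)
Definition skew_entries (e : bool) A : Prop := forall i j,
  A i j * vsgn i = - ((-1) ^+ (e && hodd j) * (vsgn j * A (- j) (- i))).

Let delta (j : int) : int -> C := fun i => (i == j)%:R.

Lemma delta_inV j : j != 0 -> inV (delta j).
Proof.
move=> j0; split; last by rewrite /delta eq_sym (negPf j0).
apply: (@sub_finite_set _ _ [set j]); last exact: finite_set1.
by move=> i /=; rewrite /delta; case: (i =P j) => // _; rewrite eqxx.
Qed.

Lemma delta_parity j : vparity (hodd j) (delta j).
Proof. by move=> i; rewrite /delta; case: (i =P j) => [->//|_]; rewrite eqxx. Qed.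

Lemma glact_delta A j i : glact A (delta j) i = A i j.
Proof.
rewrite /glact (fsum1 (j := j)) /delta ?eqxx ?mulr1// => k /negPf ->.
by rewrite mulr0.
Qed.

Lemma skewP e A : inA A -> skew e A <-> skew_entries e A.
Proof.
move=> hA; split=> [sA i j|sA d v w [finv v0] [finw w0] vd].
  have [->|i0] := eqVneq i 0.
    by rewrite oppr0 (hA _).2 (hA _).1 !(mul0r, mulr0, oppr0).
  have [->|j0] := eqVneq j 0.
    by rewrite oppr0 (hA _).2 (hA _).1 !(mul0r, mulr0, oppr0).
  have Ni0 : - i != 0 by rewrite oppr_eq0.
  have := sA _ _ _ (delta_inV j0) (delta_inV Ni0) (@delta_parity j).
  rewrite /vform (fsum1 (j := i)); last first.
    by move=> k /negPf ki; rewrite /delta eqr_opp ki mulr0 mul0r.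
  rewrite (fsum1 (j := j)); last first.
    by move=> k /negPf ki; rewrite /delta ki !mul0r.
  by rewrite !glact_delta /delta !eqxx mulr1 mul1r [vsgn j * _]mulrC.
pose S := [set j | v j != 0]; pose T := -%R @` [set j | w j != 0].
have finT : finite_set T by exact: finite_image.
have vS j : ~ S j -> v j = 0 by move/negP; rewrite negbK => /eqP.
have wT i : ~ T i -> w (- i) = 0.
  move=> Ti; apply/eqP/negPn/negP => wi; apply: Ti; exists (- i) => //.
  by rewrite opprK.
rewrite /vform (@fsum_restr _ T); last by move=> k /wT ->; rewrite mulr0 mul0r.
rewrite (@fsum_restr _ S (fun i => v i * _ * _)); last first.
  by move=> k /vS ->; rewrite !mul0r.
transitivity (\sum_(i \in T) \sum_(j \in S)
    (A i j * v j * (w (- i) * vsgn i))).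
  apply: eq_fsbigr => i _; rewrite -mulrA mulr_fsuml (@fsum_restr _ S) //.
  by move=> k /vS ->; rewrite mulr0 mul0r.
rewrite exchange_fsbig // -mulNr mulr_fsumr; apply: eq_fsbigr => j /set_mem Sj.
rewrite /glact fsumN (@fsum_restr _ T); last by move=> k /wT ->; rewrite mulr0.
rewrite mulr_fsumr mulr_fsuml mulr_fsumr; apply: eq_fsbigr => i _.
have := sA i j; rewrite (vd j Sj) => h.
transitivity (A i j * vsgn i * (v j * w (- i))); first by ring.
by rewrite h; ring.
Qed.

Lemma vsgn2 i : i != 0 -> vsgn i * vsgn i = 1.
Proof.
rewrite /vsgn; case: hodd; rewrite ?mulr1// => i0.
by case: (ltgtP i 0) i0 => // h _; rewrite ?(gtr0_sgz h) ?(ltr0_sgz h) ?mulrNN mulr1.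
Qed.

Lemma hoddN i : hodd (- i) = hodd i. Proof. by rewrite /hodd abszN. Qed.
Lemma hoddB i j : hodd (i - j) = hodd i (+) hodd j.
Proof. rewrite /hodd; lia. Qed.

Lemma Dgen_omega A : Dgen A -> Dgen (gl_omega A).
Proof.
move=> [e [hA pA sA]]; exists e.
have hA' : inA (gl_omega A).
  by move=> i; rewrite /= (hA i).1 (hA i).2 !conjC0 !mulr0.
split=> //.
  move=> i j /= h; have /pA : A j i != 0.
    by apply: contraNneq h => ->; rewrite conjC0 mulr0.
  by rewrite !hoddB addbC.
apply/skewP => // i j.
have [->|i0] := eqVneq i 0.
  by rewrite oppr0 (hA' _).2 (hA' _).1 !(mul0r, mulr0, oppr0).
have [->|j0] := eqVneq j 0.
  by rewrite oppr0 (hA' _).2 (hA' _).1 !(mul0r, mulr0, oppr0).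
have /(skewP e hA)/(_ j i) sji := sA.
have cs k : (vsgn k)^* = vsgn k.
  by rewrite /vsgn; case: hodd; rewrite ?rmorph1 ?rmorph_int.
have sji' : (A j i)^* =
    - ((-1) ^+ (e && hodd i) * (vsgn i * vsgn j * (A (- i) (- j))^*)).
  transitivity ((A j i * vsgn j)^* * vsgn j).
    by rewrite rmorphM /= cs -mulrA vsgn2 // mulr1.
  by rewrite sji rmorphN !rmorphM rmorphXn rmorphN1 /= cs; ring.
have [z|nz] := eqVneq (A (- i) (- j)) 0.
  by rewrite /= sji' z conjC0 !(mulr0, oppr0) mul0r.
have := pA _ _ nz; rewrite hoddB !hoddN => he.
have nsN k : k != 0 -> nsign (- k) = hodd k (+) nsign k.
  by rewrite /nsign hoddN => k0; case: hodd => //=; lia.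
rewrite /= sji' !nsN //.
transitivity (- ((-1) ^+ (nsign i + nsign j) * (-1) ^+ (e && hodd i)
   * (vsgn i * vsgn i) * vsgn j * (A (- i) (- j))^*)); first by ring.
rewrite vsgn2 // mulr1 -he.
case: (hodd i); case: (hodd j); case: (nsign i); case: (nsign j);
  rewrite /= ?(expr0, expr1, expr2, addn0, add0n); ring.
Qed.

Lemma glpart_id e A : glparity e A -> glpart e A = A.
Proof.
move=> pA; apply: glP => i j /=; case: ifP => // /eqP h.
by apply/esym/eqP; apply: contra_notT h => /pA.
Qed.

Lemma glpart_0 e f A : glparity e A -> f != e -> glpart f A = 0.
Proof.
move=> pA fe; apply: glP => i j; rewrite gl0E /=; case: ifP => // /eqP h.
apply/eqP; apply: contraNT fe => /pA; rewrite h => ->; exact: eqxx.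
Qed.

Lemma glmul_linearl B a A A' : glmul (a *: A + A') B = a *: glmul A B + glmul A' B.
Proof.
apply: glP => i j; rewrite glDE glZE /=.
have [S finS AS] := row_finite A i; have [S' finS' AS'] := row_finite A' i.
rewrite -(@fsum_linear _ (S `|` S')).
- apply: eq_fsbigr => k _; rewrite -[LHS]/((a * A i k + A' i k) * B k j).
  by rewrite mulrDl mulrA.
- by rewrite finite_setU.
- by move=> k /not_orP[/AS -> _]; rewrite mul0r.
- by move=> k /not_orP[_ /AS' ->]; rewrite mul0r.
Qed.

Lemma glmul_linearr B a A A' : glmul B (a *: A + A') = a *: glmul B A + glmul B A'.
Proof.
apply: glP => i j; rewrite glDE glZE /=; have [S finS BS] := row_finite B i.
rewrite -(@fsum_linear _ S) //.
- apply: eq_fsbigr => k _; rewrite -[LHS]/(B i k * (a * A k j + A' k j)).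
  by rewrite mulrDr mulrCA.
- by move=> k /BS ->; rewrite mul0r.
- by move=> k /BS ->; rewrite mul0r.
Qed.

Lemma glmul0l B : glmul 0 B = 0.
Proof. by apply: glP => i j; apply: fsbig1 => k _; rewrite gl0E mul0r. Qed.
Lemma glmul0r B : glmul B 0 = 0.
Proof. by apply: glP => i j; apply: fsbig1 => k _; rewrite gl0E mulr0. Qed.

Lemma glpart_linear e a A B : glpart e (a *: A + B) = a *: glpart e A + glpart e B.
Proof.
by apply: glP => i j; rewrite glDE glZE /=; case: ifP; rewrite // mulr0 addr0.
Qed.

Lemma glbracket_linearl B a A A' :
  glbracket (a *: A + A') B = a *: glbracket A B + glbracket A' B.
Proof.
rewrite /glbracket scaler_sumr -big_split; apply: eq_bigr => e _ /=.
rewrite scaler_sumr -big_split; apply: eq_bigr => f _ /=.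
rewrite glpart_linear glmul_linearl glmul_linearr.
by rewrite scalerDr opprD scalerBr addrACA !scalerA (mulrC _ a).
Qed.

Lemma glbracket_linearr B a A A' :
  glbracket B (a *: A + A') = a *: glbracket B A + glbracket B A'.
Proof.
rewrite /glbracket scaler_sumr -big_split; apply: eq_bigr => e _ /=.
rewrite scaler_sumr -big_split; apply: eq_bigr => f _ /=.
rewrite glpart_linear glmul_linearl glmul_linearr.
by rewrite scalerDr opprD scalerBr addrACA !scalerA (mulrC _ a).
Qed.

Lemma glbracket_homog e f A B : glparity e A -> glparity f B ->
  glbracket A B = glmul A B - (-1) ^+ (e && f) *: glmul B A.
Proof.
move=> pA pB; rewrite /glbracket (bigD1 e) //= (bigD1 f) //=.
rewrite !glpart_id // [X in _ + X + _]big1 => [|f' ff']; last first.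
  by rewrite (glpart_0 pB ff') glmul0l glmul0r scaler0 subr0.
rewrite [X in _ + X]big1 ?addr0 // => e' ee'; apply: big1 => f' _.
by rewrite (glpart_0 pA ee') glmul0l glmul0r scaler0 subr0.
Qed.

Lemma glmul_inA A B : inA A -> inA B -> inA (glmul A B).
Proof.
move=> hA hB i; split; apply: fsbig1 => k _.
  by rewrite (hB _).1 mulr0.
by rewrite (hA _).2 mul0r.
Qed.

Lemma glmul_parity e f A B : glparity e A -> glparity f B ->
  glparity (e (+) f) (glmul A B).
Proof.
move=> pA pB i j nz; apply/eqP; apply: contraNT nz => h.
apply/eqP/fsbig1 => k _; apply/eqP; apply: contraNT h.
rewrite mulf_eq0 negb_or => /andP[/pA <- /pB <-]; rewrite !hoddB.
by case: (hodd i); case: (hodd j); case: (hodd k).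
Qed.

Lemma glmul_skew e f A B : glparity e A -> glparity f B ->
  skew_entries e A -> skew_entries f B ->
  forall i j, glmul A B i j * vsgn i =
    (-1) ^+ (e && f) * ((-1) ^+ ((e (+) f) && hodd j) *
      (vsgn j * glmul B A (- j) (- i))).
Proof.
move=> pA pB sA sB i j; rewrite /= mulr_fsuml [X in _ = _ * (_ * (_ * X))]fsumN.
rewrite !mulr_fsumr; apply: eq_fsbigr => k _.
rewrite mulrAC sA.
transitivity (- ((-1) ^+ (e && hodd k) * (A (- k) (- i)) * (B k j * vsgn k))).
  by ring.
rewrite sB; have [->|nz] := eqVneq (B (- j) (- k)) 0; first by ring.
have := pB _ _ nz; rewrite hoddB !hoddN => <-.
case: e {pA sA}; case: (hodd k); case: (hodd j);
  rewrite /= ?(expr0, expr1); ring.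
Qed.

Lemma Dgen_bracket A B : Dgen A -> Dgen B -> Dgen (glbracket A B).
Proof.
move=> [e [hA pA sA]] [f [hB pB sB]]; exists (e (+) f).
rewrite (glbracket_homog pA pB).
have hAB : inA (glmul A B - (-1) ^+ (e && f) *: glmul B A).
  have hl := glmul_inA hA hB; have hr := glmul_inA hB hA.
  by move=> i; rewrite !glDE !glNE !glZE !(hl i).1 !(hl i).2 !(hr i).1 !(hr i).2
       mulr0 subr0.
have pAB := glmul_parity pA pB; have pBA := glmul_parity pB pA.
split=> //.
  move=> i j; rewrite glDE glNE glZE => nz.
  have [z|/pAB //] := eqVneq (glmul A B i j) 0.
  rewrite addbC; apply: pBA; apply: contraNneq nz => ->.
  by rewrite z mulr0 subr0.
apply/skewP => // i j.
move/(skewP e hA): sA => sA; move/(skewP f hB): sB => sB.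
have h1 := glmul_skew pA pB sA sB i j; have h2 := glmul_skew pB pA sB sA i j.
rewrite !glDE !glNE !glZE mulrBl h1 -mulrA h2 (andbC f e) (addbC f e).
case: (e && f); rewrite ?(expr0, expr1); ring.
Qed.

End Gl.

Section Dhat.
Variable C : numClosedFieldType.
Implicit Types x y : Dhat C.

Lemma inDhat_bracket x y : inDhat (glhat_bracket x y).
Proof.
have /asboolP hx := DhatvalP x; have /asboolP hy := DhatvalP y.
have [D0 DD] := lspan_submod [set A : gl C | Dgen A].
apply/asboolP; rewrite /glhat_bracket /=.
move: (x : glhat C).1 hx; apply: (lspan_le (P := fun A => inD (glbracket A _))).
- have := glbracket_linearl (y : glhat C).1 (-1) 0 0.
  by rewrite scaler0 add0r scaleN1r addNr => ->.
- by move=> a A A' hA hA' /=; rewrite glbracket_linearl; apply: DD.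
move=> A gA; move: (y : glhat C).1 hy.
apply: (lspan_le (P := fun B => inD (glbracket A B))).
- have := glbracket_linearr A (-1) 0 0.
  by rewrite scaler0 add0r scaleN1r addNr => ->.
- by move=> a B B' hB hB' /=; rewrite glbracket_linearr; apply: DD.
by move=> B gB; apply/sub_lspan/Dgen_bracket.
Qed.
Definition Dbracket x y : Dhat C := MkDhat (inDhat_bracket x y).

Lemma inDhat_omega x : inDhat (glhat_omega x).
Proof.
have /asboolP hx := DhatvalP x.
have [D0 DD] := lspan_submod [set A : gl C | Dgen A].
apply/asboolP; rewrite /glhat_omega /=.
move: (x : glhat C).1 hx; apply: (lspan_le (P := fun A => inD (gl_omega A))).
- rewrite (_ : gl_omega 0 = 0) //; apply: glP => i j.
  by rewrite /= conjC0 mulr0.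
- move=> a A A' hA hA'.
  rewrite (_ : gl_omega _ = a^* *: gl_omega A + gl_omega A'); first exact: DD.
  apply: glP => i j; rewrite glDE glZE /=.
  rewrite -[LHS]/(_ * (a * A j i + A' j i)^*) rmorphD rmorphM; ring.
by move=> A gA; apply/sub_lspan/Dgen_omega.
Qed.
Definition Domega x : Dhat C := MkDhat (inDhat_omega x).

Definition Dparity (e : bool) x : Prop :=
  glparity e (x : glhat C).1 /\ (e -> (x : glhat C).2 = 0).

Definition Ddegree (k : int) x : Prop :=
  gldegree k (x : glhat C).1 /\ (k <> 0 -> (x : glhat C).2 = 0).

Definition inDhat0 : {pred Dhat C} := fun x => `[< Ddegree 0 x >].

Lemma inDhat0_submod : submod_closed inDhat0.
Proof.
split; first by apply/asboolP; split=> // i j; rewrite gl0E eqxx.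
move=> a x y /asboolP[dx _] /asboolP[dy _]; apply/asboolP; split=> // i j.
have -> : (a *: x + y : glhat C).1 i j =
    a * (x : glhat C).1 i j + (y : glhat C).1 i j by [].
move=> nz; have [z|/dx //] := eqVneq ((x : glhat C).1 i j) 0.
by apply: dy; apply: contraNneq nz => ->; rewrite z mulr0 addr0.
Qed.

HB.instance Definition _ :=
  GRing.isSubmodClosed.Build C (Dhat C) inDhat0 inDhat0_submod.

Record Dhat0 := MkDhat0 { Dhat0val :> Dhat C; Dhat0valP : inDhat0 Dhat0val }.
HB.instance Definition _ := [isSub for Dhat0val].
HB.instance Definition _ := [Choice of Dhat0 by <:].
HB.instance Definition _ := [SubChoice_isSubLmodule of Dhat0 by <:].

(* The coefficient of \tilde e_{rr} (r > 0) in an element of D_0 is its (r, r)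
   entry; s : nat stands for the half-integer s/2. *)
Definition omegaw (s : nat) (h : Dhat0) : C := (h : glhat C).1 s%:Z s%:Z.
Definition Lambda0 (h : Dhat0) : C := (h : glhat C).2.

(* sum_{j in N/2, 0 < j <= r} xi_j omega_j + (n/2) Lambda_0, where the argument
   x of type nat -> int is m |-> xi_{m/2}. *)
Definition weight (n r : nat) (x : nat -> int) (h : Dhat0) : C :=
  \sum_(1 <= m < r.*2.+1) (x m)%:~R * omegaw m h + n%:R / 2 * Lambda0 h.

Section Modules.
Variables (M : lmodType C) (act : Dhat C -> M -> M).

Definition is_module : Prop :=
  [/\ forall v, linear (act^~ v),
      forall x, linear (act x) &
      forall (e f : bool) x y v, Dparity e x -> Dparity f y ->
        act (Dbracket x y) v =
          act x (act y v) - (-1 : C) ^+ (e && f) *: act y (act x v)].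

Definition irreducible : Prop :=
  (exists v : M, v != 0) /\
  forall N : set M, N 0 ->
    (forall a u w, N u -> N w -> N (a *: u + w)) ->
    (forall x u, N u -> N (act x u)) ->
    N = [set 0] \/ N = [set: M].

(* lowering v d w : w = x_1 ... x_m v with x_i in g_{d_i}, all d_i < 0, and
   d = d_1 + ... + d_m; these w span U(g_-)_d v. *)
Inductive lowering (v : M) : int -> M -> Prop :=
| lowering_nil : lowering v 0 v
| lowering_cons k d x w : k < 0 -> Ddegree k x -> lowering v d w ->
    lowering v (k + d) (act x w).

(* No Z/2 or Z/2-valued degree is built into modules: D_0 contains
   - sum_r r \tilde e_{rr}, whose adjoint action on degree k is multiplication
   by k, so for a highest weight vector v the spaces hw_component v d are
   distinct eigenspaces of one operator, every submodule is graded, and the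
   parity is the one of the degree. *)
Definition hw_component (v : M) (d : int) : set M := lspan (lowering v d).

Definition highest_weight (xi : {scalar Dhat0}) (v : M) : Prop :=
  [/\ v != 0,
      forall h : Dhat0, act h v = xi h *: v,
      forall k x, 0 < k -> Ddegree k x -> act x v = 0 &
      lspan [set w | exists d, lowering v d w] = [set: M]].

Definition finite_dim (S : set M) : Prop :=
  exists n (f : 'I_n -> M), S `<=` lspan (range f).

Definition quasi_finite (v : M) : Prop :=
  forall d, finite_dim (hw_component v d).

Definition unitarizable : Prop :=
  exists f : {dot M for Num.conj},
    forall x v w, f (act x v) w = f v (act (Domega x) w).

End Modules.
End Dhat.

Section Partitions.
Variables (n : nat) (l : n.-tuple nat).

Definition is_partition : bool := sorted geq l.

(* lambda_i for i >= 1, with lambda_i = 0 for i > n *)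
Definition part (i : nat) : nat := nth 0%N l i.-1.
Definition conjpart (j : nat) : nat := count (fun a => j <= a)%N l.
Definition rank_part : nat := (\max_(i < n.+1 | (0 < i) && (i <= part i)) i)%N.
Definition zero_part : bool := all (pred1 0%N) l.

Definition xi_r : nat := if zero_part then 1%N else rank_part.
(* m |-> xi_{m/2} for 1 <= m <= 2r; m./2 is the integer part of m/2. *)
Definition xi_part (m : nat) : int :=
  if zero_part then 0
  else if odd m then (part m.+1./2)%:Z - (m./2)%:Z
  else (conjpart m./2)%:Z - (m./2)%:Z.

(* Lambda^D(lambda), for lambda of length n = 2k *)
Definition LambdaD (C : numClosedFieldType) : Dhat0 C -> C :=
  weight n xi_r xi_part.

End Partitions.

Definition l12 (a : nat) : nat :=
  match a with 0%N => 0%N | 1%N => 1%N | _ => 2%N end.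

(* x is m |-> xi_{m/2}. *)
Definition chain_cond (r : nat) (x : nat -> int) : Prop :=
  [/\ forall i, (1 <= i < r)%N -> x i.*2.+1 < x i.*2.-1,
      0 <= x r.*2.-1,
      forall i, (1 <= i < r)%N -> x i.*2.+2 < x i.*2,
      0 <= x r.*2 &
      x r.*2.-1 = 0 <-> [/\ r = 1%N, x 1%N = 0 & x 2%N = 0]].

(* n = 2k.  Under chain_cond, with x m = 0 for m > 2r, all xi_j are nonnegative,
   so `|x 1| is xi_{1/2} as an element of Z_+. *)
Definition level_cond (n : nat) (x : nat -> int) : Prop :=
  x 2%N + x 4%N + (l12 `|x 1%N|%N)%:Z + Num.min (x 3%N) 1 <= n%:Z.

(* Main.v *)
(* Unitarity forces the weight conditions.  Quasi-finiteness makes the vectors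
   sum_j j^i f_j v linearly dependent, where f_j = E_{j+1,j} are the lowering
   operators of degree -1/2; hence some sum_j p(j) f_j kills v for a polynomial
   p <> 0, and bracketing with raising operators shows that the weight has finite
   support.  The su(2)-triples inside D then give integrality of the weights
   xi_j and of the level.  If xi_j = xi_{j+1}, then E_{j+1,j} v has norm zero, and
   applying a simple raising operator to it gives xi_j = xi_{j+1/2} = 0: this is
   the strictness in (i).  Condition (ii) is the nonnegativity of the norm of
   A* u, where A* creates a pair of fermions and u is obtained from v by at most
   three odd lowering operators.

   Conversely D acts on the Fock space of n = 2k copies of a boson for every
   half-odd index and a fermion for every integer index, by the quadratic
   operators 1/2 sum_a A_{pq} (+-) phi^a_p phi^{a'}_{-q}, where a |-> a' = n + 1 - a
   is the pairing of the copies.  For finite matrices the cocycle is the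
   coboundary of Str(JA), which is the constant that normal ordering subtracts.
   The monomial prod_j prod_{a <= lambda'_j} psi^a_j is killed by the pair
   annihilators because lambda'_1 + lambda'_2 <= n.  It is a highest weight vector
   when all fermions precede all bosons; the odd reflections by E_{i-1/2,j}, for
   the boxes (i,j) of lambda with j >= i, turn it into one for D.  Finally M is
   identified with the submodule generated by that vector via the submodule of
   M x Fock generated by the pair of highest weight vectors. *)

From HB Require Import structures.
From mathcomp Require Import all_boot all_order all_algebra.
From mathcomp Require Import sesquilinear zify ring.
From mathcomp Require Import boolp classical_sets functions cardinality fsbigop.
From mathcomp Require Import reals complex.
Require Import Defs.

Set Implicit Arguments.
Unset Strict Implicit.
Unset Printing Implicit Defensive.

Import Order.TTheory GRing.Theory Num.Theory.
Local Open Scope classical_set_scope.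
Local Open Scope ring_scope.

(** * Elements and brackets of the algebra *)

(** The obstacle is that the algebra contains infinite banded matrices. For necessity this matters
    only in bounding the support of the weight: the weight is a linear functional on infinite
    diagonals, so it has to be killed on every diagonal supported far out and not just on matrix
    units. The rest of that direction concerns the operators E_{pq} of the units e_{pq} minus a
    signed e_{-q,-p}, whose relations are of gl type for p, q > 0. On the Fock side the quadratic
    sum is cut off at |p|, |q| <= N, where the bracket relation is an exact identity between finite
    matrices, without central term. Subtracting n/2 Str(JA), cut off at N as well, leaves a normally
    ordered sum; on a fixed vector it is constant for large N, because far entries are off the band
    or kill the vector. The cut-off commutator differs from the true one only in rows near N, where
    the vector is killed too. The subtracted scalar is thus the only source of the central term, and
    the central element acts by n/2 = k. *)

Section Symmetrization.
Variable C : numClosedFieldType.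
Implicit Types (A B X Y : gl C) (x y : Dhat C) (p q r s i j k : int).

(** The sign of the super-transpose with respect to the form on V: D is cut out by A_{ij} = - sg
    A_{-j,-i}. It results from multiplying [skew_entries] by [vsgn i], with the parity of [A] read
    off from i and j. *)
Definition sg i j : C :=
  (-1) ^+ ((hodd i (+) hodd j) && hodd j) * vsgn C i * vsgn C j.

Lemma vsgnN i : i != 0 -> vsgn C (- i) = (-1) ^+ hodd i * vsgn C i.
Proof.
rewrite /vsgn hoddN => i0; case: (hodd i); rewrite ?mulr1 ?expr0 //.
by rewrite sgzN mulrNz expr1 mulN1r.
Qed.

Lemma banded_dsym X :
  banded (fun i j => if (i == 0) || (j == 0) then 0
                     else X i j - sg i j * X (- j) (- i)).
Proof.
have /asboolP[N hX] := glvalP X; apply/asboolP; exists N => i j hij.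
by case: ifP => // _; rewrite !hX ?mulr0 ?subr0//; lia.
Qed.
(** [X] minus its super-transpose, with row and column 0 erased. On D this is multiplication by 2,
    not the identity. *)
Definition dsym X : gl C := Gl (banded_dsym X).

Lemma dsymE X i j : i != 0 -> j != 0 ->
  dsym X i j = X i j - sg i j * X (- j) (- i).
Proof. by rewrite /= => /negPf-> /negPf->. Qed.

Lemma dsym_inA X : inA (dsym X).
Proof. by move=> i; rewrite /= eqxx orbT. Qed.

Lemma gl_ext0 A B : inA A -> inA B ->
  (forall i j, i != 0 -> j != 0 -> A i j = B i j) -> A = B.
Proof.
move=> hA hB h; apply: glP => i j.
have [->|i0] := eqVneq i 0; first by rewrite (hA _).2 (hB _).2.
have [->|j0] := eqVneq j 0; first by rewrite (hA _).1 (hB _).1.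
exact: h.
Qed.

Lemma inA_linear a A B : inA A -> inA B -> inA (a *: A + B).
Proof.
by move=> hA hB i; rewrite !glDE !glZE !(hA i).1 !(hA i).2 !(hB i).1 !(hB i).2
  mulr0 addr0.
Qed.

Lemma dsym_linear : linear dsym.
Proof.
move=> a X Y; apply: gl_ext0; [|apply: inA_linear|move=> i j i0 j0]; try exact: dsym_inA.
by rewrite glDE glZE !dsymE // !glDE !glZE; ring.
Qed.

Lemma dsym0 : dsym 0 = 0.
Proof. by have := dsym_linear (-1) 0 0; rewrite scaler0 add0r scaleN1r addNr. Qed.

Lemma dsymZ a X : dsym (a *: X) = a *: dsym X.
Proof. by have := dsym_linear a X 0; rewrite dsym0 !addr0. Qed.

Lemma glsum_part X : X = glpart false X + glpart true X.
Proof. by apply: glP => i j; rewrite glDE /=; case: hodd; rewrite /= ?addr0 ?add0r. Qed.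

Lemma glpart_parity e X : glparity e (glpart e X).
Proof. by move=> i j /=; case: (hodd (i - j) =P e) => //; rewrite eqxx. Qed.

Lemma dsym_parity e X : glparity e X -> glparity e (dsym X).
Proof.
move=> pX i j /=; case: ifP => [|_]; rewrite ?eqxx // => nz.
have [z|/pX//] := eqVneq (X i j) 0.
have /pX : X (- j) (- i) != 0.
  by apply: contraNneq nz => ->; rewrite z mulr0 subr0.
by rewrite !hoddB !hoddN addbC.
Qed.

(** The super-transpose is an involution away from index 0; this is what makes [dsym X] skew. *)
Lemma sg_sg i j : i != 0 -> j != 0 -> sg i j * sg (- j) (- i) = 1.
Proof.
move=> i0 j0; rewrite /sg !hoddN !vsgnN //.
transitivity ((-1) ^+ ((hodd i (+) hodd j) && hodd j) *
  (-1) ^+ ((hodd j (+) hodd i) && hodd i) * ((-1) ^+ hodd i * (-1)^+ hodd j)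
  * (vsgn C i * vsgn C i) * (vsgn C j * vsgn C j)); first by ring.
rewrite !vsgn2 // !mulr1.
by case: (hodd i); case: (hodd j); rewrite /= ?(expr0, expr1); ring.
Qed.

(* [skew_entries] with the parity sign absorbed in [sg] *)
Lemma skew_sg e A : inA A -> glparity e A ->
  skew_entries e A <->
  (forall i j, i != 0 -> j != 0 -> A i j = - (sg i j * A (- j) (- i))).
Proof.
move=> hA pA.
have key i j : i != 0 -> j != 0 -> sg i j * A (- j) (- i) * vsgn C i =
    (-1) ^+ (e && hodd j) * (vsgn C j * A (- j) (- i)).
  move=> i0 j0; have [->|/pA] := eqVneq (A (- j) (- i)) 0; first by ring.
  rewrite hoddB !hoddN => <-; rewrite /sg (addbC (hodd j)).
  transitivity ((-1) ^+ ((hodd i (+) hodd j) && hodd j) *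
    (vsgn C i * vsgn C i) * vsgn C j * A (- j) (- i)); first by ring.
  by rewrite vsgn2 // mulr1 mulrA.
split=> h i j => [i0 j0|].
  apply: (mulIf (x := vsgn C i)).
    by apply: contraNneq (oner_neq0 C) => z; rewrite -(@vsgn2 C i) // z mulr0.
  by rewrite h mulNr key.
have [->|i0] := eqVneq i 0.
  by rewrite oppr0 (hA _).2 (hA _).1 !(mul0r, mulr0, oppr0).
have [->|j0] := eqVneq j 0.
  by rewrite oppr0 (hA _).2 (hA _).1 !(mul0r, mulr0, oppr0).
by rewrite h // mulNr key.
Qed.

Lemma inD_intro e A : inA A -> glparity e A ->
  (forall i j, i != 0 -> j != 0 -> A i j = - (sg i j * A (- j) (- i))) -> inD A.
Proof.
move=> hA pA sA; apply: sub_lspan; exists e; split=> //.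
by apply: (skewP e hA).2; apply: (skew_sg hA pA).2.
Qed.

Lemma dsym_skew X i j : i != 0 -> j != 0 ->
  dsym X i j = - (sg i j * dsym X (- j) (- i)).
Proof.
move=> i0 j0; rewrite !dsymE ?oppr_eq0 // !opprK mulrBr mulrA sg_sg //; ring.
Qed.

Lemma dsym_inD X : inD (dsym X).
Proof.
rewrite (glsum_part X) -[glpart false X]scale1r dsym_linear.
apply: (lspan_submod _).2; apply: inD_intro (@dsym_inA _) _ (@dsym_skew _);
  exact/dsym_parity/glpart_parity.
Qed.

Lemma inD_inA A : inD A -> inA A.
Proof.
apply: lspan_le => [i|a B B' hB hB' i|B [e []//]]; first by rewrite !gl0E.
by rewrite !glDE !glZE !(hB i).1 !(hB i).2 !(hB' i).1 !(hB' i).2 mulr0 addr0.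
Qed.

Lemma inD_sg A i j : inD A -> i != 0 -> j != 0 ->
  A i j = - (sg i j * A (- j) (- i)).
Proof.
move=> DA i0 j0; move: A DA.
apply: (lspan_le (P := fun A : gl C => A i j = - (sg i j * A (- j) (- i)))).
- by rewrite !gl0E mulr0 oppr0.
- by move=> a B B' hB hB'; rewrite !glDE !glZE hB hB'; ring.
by move=> B [e [hB pB sB]]; apply: (skew_sg hB pB).1 => //; apply: (skewP e hB).1.
Qed.

Lemma dsym_inDhat X (c : C) : inDhat ((dsym X, c) : glhat C).
Proof. exact/asboolP/dsym_inD. Qed.
Definition dd X : Dhat C := MkDhat (dsym_inDhat X 0).

Lemma cc_inDhat : inDhat ((0, 1) : glhat C).
Proof. by apply/asboolP; have [] := lspan_submod [set A : gl C | Dgen A]. Qed.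
Definition cc : Dhat C := MkDhat cc_inDhat.

Lemma DhatP x y : (x : glhat C).1 = (y : glhat C).1 ->
  (x : glhat C).2 = (y : glhat C).2 -> x = y.
Proof. by move=> h1 h2; apply: val_inj => /=; case: (x : glhat C) (y : glhat C) h1 h2 => [a b] [a' b'] /= -> ->. Qed.

Lemma dd_linear : linear dd.
Proof.
move=> a X Y; apply: DhatP => /=; first exact: dsym_linear.
by rewrite -[RHS]/(a * 0 + 0 : C) mulr0 addr0.
Qed.

Lemma dd_parity e X : glparity e X -> Dparity e (dd X).
Proof. by move=> pX; split=> //=; apply: dsym_parity. Qed.

Lemma cc_parity : Dparity false cc.
Proof. by split=> // i j; rewrite gl0E eqxx. Qed.

Lemma dd_degree k X : gldegree k X -> Ddegree k (dd X).
Proof.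
move=> dX; split=> //= i j /=; case: ifP => [|_]; rewrite ?eqxx // => nz.
have [z|/dX//] := eqVneq (X i j) 0.
have /dX : X (- j) (- i) != 0.
  by apply: contraNneq nz => ->; rewrite z mulr0 subr0.
lia.
Qed.

Lemma Ddegree_parity k x : Ddegree k x -> Dparity (hodd k) x.
Proof.
move=> [dx cx]; split=> [i j /dx ->|hk].
  by rewrite !hoddB; case: (hodd j); case: (hodd k).
by apply: cx => k0; rewrite k0 in hk.
Qed.

Lemma glmulE A B i j : glmul A B i j = \sum_(k \in [set: int]) A i k * B k j.
Proof. by []. Qed.

(** The super-transpose reverses products up to sign and sends [A] to - A, so it commutes with ad A.
    Brackets in D can therefore be computed with one unsymmetrized factor. *)
Lemma inD_bracket_dsym e f A X : inD A -> glparity e A -> inA X ->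
  glparity f X -> glbracket A (dsym X) = dsym (glbracket A X).
Proof.
move=> DA pA hX pX; have hA := inD_inA DA.
have pX' := dsym_parity pX.
rewrite (glbracket_homog pA pX) (glbracket_homog pA pX').
have hAX := glmul_inA hA hX; have hXA := glmul_inA hX hA.
have hAX' := glmul_inA hA (@dsym_inA X); have hXA' := glmul_inA (@dsym_inA X) hA.
apply: glP => i j; rewrite !glDE !glNE !glZE.
have [->|i0] := eqVneq i 0.
  by rewrite (hAX' _).2 (hXA' _).2 [RHS]/= mulr0 subr0.
have [->|j0] := eqVneq j 0.
  by rewrite (hAX' _).1 (hXA' _).1 [RHS]/= orbT mulr0 subr0.
rewrite dsymE // !glDE !glNE !glZE.
pose tau i j := sg i j * X (- j) (- i).
have sgk i' j' k e' f' : k != 0 -> hodd i' (+) hodd k = e' -> hodd k (+) hodd j' = f' ->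
    sg i' k * sg k j' = (-1) ^+ (e' && f') * sg i' j'.
  move=> k0 <- <-; rewrite /sg.
  transitivity ((-1) ^+ ((hodd i' (+) hodd k) && hodd k) *
    (-1) ^+ ((hodd k (+) hodd j') && hodd j') * vsgn C i' * vsgn C j'
    * (vsgn C k * vsgn C k)); first by ring.
  rewrite vsgn2 // mulr1.
  by case: (hodd i'); case: (hodd j'); case: (hodd k);
    rewrite /= ?(expr0, expr1); ring.
have dsymX a b : a != 0 -> b != 0 -> dsym X a b = X a b - tau a b by exact: dsymE.
have [SA finSA AS] := row_finite A i.
have [SX finSX XS] := row_finite X i.
(* The row support of the super-transpose of [X] is contained in the supports of [X] and [dsym X]
   taken together. *)
have [SX' finSX' XS'] := row_finite (dsym X) i.
have h1 : glmul A (dsym X) i j = glmul A X i j +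
    (-1) ^+ (e && f) * (sg i j * glmul X A (- j) (- i)).
  rewrite !glmulE [X in _ + _ * (_ * X)]fsumN !mulr_fsumr.
  rewrite -[X in _ = X + _]mul1r.
  rewrite -(@fsum_linear _ SA) //.
  - apply: eq_fsbigr => k _; rewrite mul1r.
    have [->|k0] := eqVneq k 0; first by rewrite oppr0 (hA _).1 (hA _).2 !(mul0r,mulr0) add0r.
    rewrite dsymX // mulrBr; congr (_ + _).
    have [z|nz] := eqVneq (X (- j) (- k)) 0; first by rewrite /tau z !(mulr0, mul0r) oppr0.
    rewrite (inD_sg DA) // /tau.
    have [z|nz'] := eqVneq (A (- k) (- i)) 0; first by rewrite z !(mulr0, oppr0, mul0r).
    have he := pA _ _ nz'; have hf := pX _ _ nz; rewrite !hoddB !hoddN in he hf.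
    rewrite addbC in he; rewrite addbC in hf.
    transitivity (sg i k * sg k j * A (- k) (- i) * X (- j) (- k)); first by ring.
    by rewrite (sgk _ _ _ _ _ k0 he hf); ring.
  - by move=> k /AS ->; rewrite mul0r.
  - move=> k /AS z; have [->|k0] := eqVneq k 0; first by rewrite oppr0 (hX _).1 mul0r !mulr0.
    have : sg i k * A (- k) (- i) = 0.
      by apply/eqP; rewrite -oppr_eq0 -(inD_sg DA) // z.
    move/eqP; rewrite mulf_eq0 => /orP[/eqP z2|/eqP ->]; last by rewrite ?(mul0r, mulr0).
    by have := sg_sg i0 k0; rewrite z2 mul0r => /esym/eqP; rewrite (negPf (oner_neq0 C)).
have h2 : glmul (dsym X) A i j = glmul X A i j +
    (-1) ^+ (e && f) * (sg i j * glmul A X (- j) (- i)).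
  rewrite !glmulE [X in _ + _ * (_ * X)]fsumN !mulr_fsumr.
  rewrite -[X in _ = X + _]mul1r.
  rewrite -(@fsum_linear _ (SX `|` SX')) //.
  - apply: eq_fsbigr => k _; rewrite mul1r.
    have [->|k0] := eqVneq k 0; first by rewrite oppr0 (hA _).1 (hA _).2 !(mul0r,mulr0) add0r.
    rewrite dsymX // mulrBl; congr (_ + _).
    have [z|nz] := eqVneq (X (- k) (- i)) 0; first by rewrite /tau z !(mulr0, mul0r) oppr0.
    rewrite (inD_sg DA k0 j0) // /tau.
    have [z|nz'] := eqVneq (A (- j) (- k)) 0; first by rewrite z !(mulr0, oppr0, mul0r).
    have he := pA _ _ nz'; have hf := pX _ _ nz; rewrite !hoddB !hoddN in he hf.
    rewrite addbC in he; rewrite addbC in hf.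
    transitivity (sg i k * sg k j * A (- j) (- k) * X (- k) (- i)); first by ring.
    by rewrite (sgk _ _ _ _ _ k0 hf he) andbC; ring.
  - by rewrite finite_setU.
  - by move=> k /not_orP[/XS -> _]; rewrite mul0r.
  - move=> k /not_orP[z1 z2].
    have [->|k0] := eqVneq k 0; first by rewrite oppr0 (hX _).2 !mulr0.
    have := XS' k z2; rewrite dsymE // XS // sub0r => /eqP.
    rewrite oppr_eq0 mulf_eq0 => /orP[/eqP z3|/eqP ->]; last by rewrite ?(mul0r, mulr0).
    by have := sg_sg i0 k0; rewrite z3 mul0r => /esym/eqP; rewrite (negPf (oner_neq0 C)).
rewrite h1 h2; case: (e && f); rewrite ?(expr0, expr1); ring.
Qed.

(** J is even and diagonal, so [J, A] multiplies A_{rq} by a difference of two indicators; only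
    entries joining an index <= 0 to an index > 0 survive. *)
Lemma cocycleE A B : cocycle A B =
  \sum_(r \in [set: int]) (-1) ^+ hodd r *
    \sum_(q \in [set: int]) ((r <= 0)%R%:R - (q <= 0)%R%:R) * A r q * B q r.
Proof.
apply: eq_fsbigr => r _; congr (_ * _); apply: eq_fsbigr => q _; congr (_ * _).
have pJ : glparity false (glJ C).
  by move=> i j /=; case: (i =P j) => [->|_]; rewrite ?subrr ?eqxx.
have JA e X : glparity e X ->
    glbracket (glJ C) X r q = ((r <= 0)%R%:R - (q <= 0)%R%:R) * X r q.
  move=> pX; rewrite (glbracket_homog pJ pX) expr0 scale1r glDE glNE /=.
  rewrite (fsum1 (j := r)); last first.
    by move=> k kr; rewrite eq_sym (negPf kr) mul0r.
  rewrite (fsum1 (j := q)); last by move=> k kr; rewrite (negPf kr) mulr0.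
  rewrite !eqxx /=; case: (r <= 0); case: (q <= 0) => /=; ring.
rewrite {1}(glsum_part A) -[glpart false A]scale1r glbracket_linearr.
rewrite glDE glZE !(JA _ _ (@glpart_parity _ A)).
by rewrite mul1r -mulrDr -glDE -glsum_part.
Qed.

Lemma cocycle_diag A B :
  (forall r q, (r <= 0) != (q <= 0) -> A r q * B q r = 0) -> cocycle A B = 0.
Proof.
move=> h; rewrite cocycleE; apply: fsbig1 => r _.
rewrite fsbig1 ?mulr0 // => q _.
have := h r q; case: (r <= 0); case: (q <= 0) => /= h';
  by rewrite ?subrr ?mul0r // -mulrA h' ?mulr0.
Qed.

Lemma Dbracket_dd e f X Y : inA Y -> glparity e X -> glparity f Y ->
  Dbracket (dd X) (dd Y) =
  dd (glbracket (dsym X) Y) + (cocycle (dsym X) (dsym Y) : C) *: cc.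
Proof.
move=> hY pX pY; apply: DhatP.
  rewrite [LHS]/= (inD_bracket_dsym (dsym_inD X) (dsym_parity pX) hY pY).
  by apply: glP => i j; rewrite [RHS]glDE glZE gl0E mulr0 addr0.
by rewrite -[RHS]/(0 + cocycle _ _ * 1) mulr1 add0r.
Qed.

Lemma gl_omega_dsym X : gl_omega (dsym X) = dsym (gl_omega X).
Proof.
apply: glP => i j.
have [->|i0] := eqVneq i 0; first by rewrite /= orbT conjC0 mulr0.
have [->|j0] := eqVneq j 0; first by rewrite /= orbT conjC0 mulr0.
rewrite dsymE // /= (negPf i0) (negPf j0) /= rmorphB rmorphM mulrBr; congr (_ - _).
have cs k : (vsgn C k)^* = vsgn C k.
  by rewrite /vsgn; case: hodd; rewrite ?rmorph1 ?rmorph_int.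
rewrite /sg !rmorphM rmorphXn rmorphN1 /= !cs.
have nsN k : k != 0 -> nsign (- k) = hodd k (+) nsign k.
  by rewrite /nsign hoddN => k0; case: hodd => //=; lia.
rewrite !nsN //.
by case: (hodd i); case: (hodd j); case: (nsign i); case: (nsign j);
  rewrite /= ?(expr0, expr1, expr2, addn0, add0n); ring.
Qed.

Lemma Domega_dd X : Domega (dd X) = dd (gl_omega X).
Proof.
by apply: DhatP; rewrite /= ?gl_omega_dsym //; apply: conjC0.
Qed.

End Symmetrization.

(** * Matrix units, their brackets and their cocycles *)

Section Units.
Variable C : numClosedFieldType.
Implicit Types (A B X Y : gl C) (x y : Dhat C) (p q r s i j k : int).

Lemma banded_unit p q :
  banded (fun i j => ((i == p) && (j == q))%:R : C^o).
Proof.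
apply/asboolP; exists `|p - q|%N => i j hij; apply/eqP.
by rewrite pnatr_eq0 eqb0; apply/negP => /andP[/eqP ip /eqP jq]; rewrite ip jq ltnn in hij.
Qed.
Definition eu p q : gl C := Gl (banded_unit p q).

Lemma eu_parity p q : glparity (hodd p (+) hodd q) (eu p q).
Proof.
move=> i j /=; rewrite pnatr_eq0 eqb0 negbK => /andP[/eqP-> /eqP->].
exact: hoddB.
Qed.

Lemma eu_degree p q : gldegree (q - p) (eu p q).
Proof. move=> i j /=; rewrite pnatr_eq0 eqb0 negbK => /andP[/eqP-> /eqP->]; lia. Qed.

Lemma eu_inA p q : p != 0 -> q != 0 -> inA (eu p q).
Proof. by move=> /negPf p0 /negPf q0 i; rewrite /= ![0 == _]eq_sym p0 q0 andbF. Qed.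

Lemma glmul_eu p q r s : glmul (eu p q) (eu r s) = (q == r)%:R *: eu p s.
Proof.
apply: glP => i j; rewrite glZE /= (fsum1 (j := q)).
  by rewrite eqxx andbT; case: (i == p); case: (q == r); case: (j == s);
    rewrite ?(mulr0, mul0r, mul1r).
by move=> k /negPf kq; rewrite kq andbF mul0r.
Qed.

Definition esgn p q r s : C :=
  (-1) ^+ ((hodd p (+) hodd q) && (hodd r (+) hodd s)).

Lemma glbracket_eu p q r s : glbracket (eu p q) (eu r s) =
  (q == r)%:R *: eu p s -
  (esgn p q r s * (s == p)%:R) *: eu r q.
Proof. by rewrite (glbracket_homog (@eu_parity _ _) (@eu_parity _ _)) !glmul_eu scalerA. Qed.

Lemma dsym_eu p q : p != 0 -> q != 0 ->
  dsym (eu p q) = (- sg C (- q) (- p)) *: eu (- q) (- p) + eu p q.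
Proof.
move=> p0 q0; apply: gl_ext0; first exact: dsym_inA.
  by apply: inA_linear; apply: eu_inA; rewrite ?oppr_eq0.
move=> i j i0 j0; rewrite dsymE // glDE glZE /= addrC !eqr_oppLR; congr (_ + _).
rewrite mulNr andbC; congr (- _).
by case: (i =P - q) => [->|_]; case: (j =P - p) => [->|_]; rewrite /= ?mulr0.
Qed.

Lemma glbracket_dsym_eu p q r s : p != 0 -> q != 0 ->
  glbracket (dsym (eu p q)) (eu r s) =
  (- sg C (- q) (- p)) *: ((- p == r)%:R *: eu (- q) s
     - (esgn p q r s * (s == - q)%:R) *: eu r (- p))
  + ((q == r)%:R *: eu p s - (esgn p q r s * (s == p)%:R) *: eu r q).
Proof.
move=> p0 q0; rewrite dsym_eu // glbracket_linearl !glbracket_eu.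
by rewrite /esgn !hoddN (addbC (hodd q)).
Qed.

Lemma gl_omega_eu p q :
  gl_omega (eu p q) = (-1) ^+ (nsign p + nsign q) *: eu q p.
Proof.
apply: glP => i j; rewrite glZE /= andbC.
case: (i =P q) => [->|_]; case: (j =P p) => [->|_] /=; rewrite ?conjC0 ?mulr0 //.
by rewrite conjC1 addnC.
Qed.

(** Both entries of the antisymmetrized unit join indices of equal sign, so the gl relations among
    positive indices carry no central term. *)
Lemma cocycle_pos A r s : 0 < r -> 0 < s -> cocycle A (dsym (eu r s)) = 0.
Proof.
move=> r0 s0; apply: cocycle_diag => i j ij; rewrite dsym_eu ?gt_eqF //.
rewrite glDE glZE /=.
have -> : (j == - s) && (i == - r) = false by apply/negP => /andP[/eqP ? /eqP ?]; lia.
have -> : (j == r) && (i == s) = false by apply/negP => /andP[/eqP ? /eqP ?]; lia.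
by rewrite mulr0 addr0 mulr0.
Qed.

Lemma sg_even p q : ~~ hodd p -> ~~ hodd q -> sg C p q = 1.
Proof. by rewrite /sg /vsgn => /negPf-> /negPf->; rewrite expr0 !mulr1. Qed.

(** Each of the two entries of the antisymmetrized unit contributes 1. This 2 is the origin of 2k in
    the level condition. *)
Lemma cocycle_even p q : 0 < p -> 0 < q -> p != q -> ~~ hodd p -> ~~ hodd q ->
  cocycle (dsym (eu (- p) q)) (dsym (eu q (- p))) = 2.
Proof.
move=> p0 q0 pq hp hq.
have pq1 : (- p == - q) = false by rewrite eqr_opp (negPf pq).
have pq2 : (- q == - p) = false by rewrite eq_sym.
rewrite cocycleE (@fsum_restr _ ([set - p] `|` [set - q])).
  rewrite fsbigU0 ?finite_set1 //; last first.
    by move=> k [/= -> /oppr_inj pq0]; rewrite pq0 eqxx in pq.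
  rewrite !fsbig_set1 (fsum1 (j := q)); last first.
    move=> k kq; rewrite dsym_eu ?oppr_eq0 ?gt_eqF // glDE glZE /= !opprK.
    by rewrite ?pq1 ?pq2 (negPf kq) andbF mulr0 addr0 mulr0 mul0r.
  rewrite (fsum1 (j := p)); last first.
    move=> k kq; rewrite dsym_eu ?oppr_eq0 ?gt_eqF // glDE glZE /= !opprK.
    by rewrite ?pq1 ?pq2 (negPf kq) andbF mulr0 addr0 mulr0 mul0r.
  rewrite !dsym_eu ?oppr_eq0 ?gt_eqF // !glDE !glZE /= !opprK !hoddN (negPf hp) (negPf hq).
  rewrite !sg_even ?hoddN // pq1 pq2 !eqxx (eq_sym q p) (negPf pq) /=.
  rewrite !oppr_le0 !(ltW p0) !(ltW q0) !(leNgt _ 0) p0 q0 /= expr0; ring.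
move=> k /not_orP[/eqP/negPf k1 /eqP/negPf k2]; rewrite fsbig1 ?mulr0 // => i _.
rewrite dsym_eu ?oppr_eq0 ?gt_eqF // glDE glZE /= !opprK.
by rewrite k1 k2 mulr0 addr0 mulr0 mul0r.
Qed.

End Units.

(** * Commutation relations in an arbitrary module *)

Section ModuleRelations.
Variables (C : numClosedFieldType) (M : lmodType C) (act : Dhat C -> M -> M).
Hypothesis Hact : is_module act.
Implicit Types (X Y : gl C) (x y : Dhat C) (p q r s : int) (u w : M).

Lemma actDl a x y u : act (a *: x + y) u = a *: act x u + act y u.
Proof. by case: Hact => h _ _; apply: h. Qed.
Lemma actDr a x u w : act x (a *: u + w) = a *: act x u + act x w.
Proof. by case: Hact => _ h _; apply: h. Qed.
Lemma act0l u : act 0 u = 0.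
Proof. by have := actDl (-1) 0 0 u; rewrite scaler0 add0r scaleN1r addNr. Qed.
Lemma act0r x : act x 0 = 0.
Proof. by have := actDr (-1) x 0 0; rewrite scaler0 add0r scaleN1r addNr. Qed.
Lemma actZl a x u : act (a *: x) u = a *: act x u.
Proof. by have := actDl a x 0 u; rewrite addr0 act0l addr0. Qed.
Lemma actZr a x u : act x (a *: u) = a *: act x u.
Proof. by have := actDr a x u 0; rewrite addr0 act0r addr0. Qed.
Lemma actAl x y u : act (x + y) u = act x u + act y u.
Proof. by have := actDl 1 x y u; rewrite !scale1r. Qed.
Lemma actAr x u w : act x (u + w) = act x u + act x w.
Proof. by have := actDr 1 x u w; rewrite !scale1r. Qed.
Lemma actBr x u w : act x (u - w) = act x u - act x w.
Proof. by rewrite -(scaleN1r w) actAr actZr scaleN1r. Qed.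

Lemma actddD a X Y u : act (dd (a *: X + Y)) u = a *: act (dd X) u + act (dd Y) u.
Proof. by rewrite dd_linear actDl. Qed.
Lemma dd0 : dd (0 : gl C) = 0.
Proof. by have := @dd_linear C (-1) 0 0; rewrite scaler0 add0r scaleN1r addNr. Qed.
Lemma actddZ a X u : act (dd (a *: X)) u = a *: act (dd X) u.
Proof. by have := actddD a X 0 u; rewrite addr0 dd0 act0l addr0. Qed.
Lemma actddA X Y u : act (dd (X + Y)) u = act (dd X) u + act (dd Y) u.
Proof. by have := actddD 1 X Y u; rewrite !scale1r. Qed.
Lemma actddB X Y u : act (dd (X - Y)) u = act (dd X) u - act (dd Y) u.
Proof. by rewrite -(scaleN1r Y) actddA actddZ scaleN1r. Qed.

Lemma act_bracket e f x y u : Dparity e x -> Dparity f y ->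
  act x (act y u) = act (Dbracket x y) u + (-1) ^+ (e && f) *: act y (act x u).
Proof. by case: Hact => _ _ h px py; rewrite (h e f) // subrK. Qed.

Definition Eop p q : M -> M := act (dd (eu C p q)).

Lemma Eop0 p q : Eop p q 0 = 0. Proof. exact: act0r. Qed.
Lemma EopZ p q a u : Eop p q (a *: u) = a *: Eop p q u. Proof. exact: actZr. Qed.

Lemma EopB p q u w : Eop p q (u - w) = Eop p q u - Eop p q w.
Proof. exact: actBr. Qed.

Lemma Eop_rel p q r s u : p != 0 -> q != 0 -> r != 0 -> s != 0 ->
  Eop p q (Eop r s u) = esgn C p q r s *: Eop r s (Eop p q u)
   + (- sg C (- q) (- p)) *: ((- p == r)%:R *: Eop (- q) s u
       - (esgn C p q r s * (s == - q)%:R) *: Eop r (- p) u)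
   + ((q == r)%:R *: Eop p s u - (esgn C p q r s * (s == p)%:R) *: Eop r q u)
   + (cocycle (dsym (eu C p q)) (dsym (eu C r s)) : C) *: act (cc C) u.
Proof.
move=> p0 q0 r0 s0; rewrite {1}/Eop.
rewrite (act_bracket u (dd_parity (@eu_parity C p q)) (dd_parity (@eu_parity C r s))).
rewrite (Dbracket_dd (eu_inA C r0 s0) (@eu_parity C p q) (@eu_parity C r s)).
rewrite actAl actZl glbracket_dsym_eu // actddA actddZ !actddB !actddZ.
by rewrite addrC !addrA.
Qed.

Lemma Eop_comm p q r s u : 0 < p -> 0 < q -> 0 < r -> 0 < s ->
  Eop p q (Eop r s u) = esgn C p q r s *: Eop r s (Eop p q u)
   + ((q == r)%:R *: Eop p s u - (esgn C p q r s * (s == p)%:R) *: Eop r q u).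
Proof.
move=> p0 q0 r0 s0; rewrite Eop_rel; [|lia..]; rewrite cocycle_pos // scale0r addr0.
have -> : (- p == r) = false by lia.
have -> : (s == - q) = false by lia.
by rewrite mulr0 !scale0r subr0 scaler0 addr0.
Qed.

(** For p, q > 0 the operator E_{-p,q} annihilates a pair. Its brackets with the gl part are pair
    annihilators again, so being killed by all of them is preserved by the gl part. *)
Lemma Aop_comm p q r s u : 0 < p -> 0 < q -> 0 < r -> 0 < s ->
  Eop (- p) q (Eop r s u) = esgn C p q r s *: Eop r s (Eop (- p) q u)
   + (- sg C (- q) p * (p == r)%:R) *: Eop (- q) s u + (q == r)%:R *: Eop (- p) s u.
Proof.
move=> p0 q0 r0 s0; rewrite Eop_rel; [|lia..]; rewrite cocycle_pos // scale0r addr0.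
have -> : (s == - p) = false by lia.
have -> : (s == - q) = false by lia.
by rewrite !opprK /esgn hoddN !mulr0 !scale0r !subr0 scalerA.
Qed.

(** Annihilator and creator of a pair at two distinct integers form an su(2)-triple with 2C - E_{pp}
    - E_{qq}: this is how the level meets positivity. *)
Lemma AAop_comm p q u : 0 < p -> 0 < q -> p != q -> ~~ hodd p -> ~~ hodd q ->
  Eop (- p) q (Eop q (- p) u) = Eop q (- p) (Eop (- p) q u)
    + (2 : C) *: act (cc C) u - Eop p p u - Eop q q u.
Proof.
move=> p0 q0 pq hp hq; rewrite Eop_rel; [|lia..]; rewrite cocycle_even //.
rewrite !opprK eqr_opp (negPf pq) !eqxx /esgn !hoddN (negPf hp) (negPf hq) /= expr0.
rewrite !mulr0 !scale0r subr0 scaler0 addr0 mulr1 !scale1r.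
suff -> : Eop (- p) (- p) u = - Eop p p u by rewrite -!addrA; congr (_ + _); rewrite addrA addrC.
rewrite -scaleN1r -actddZ /Eop; congr (act _ u); apply: DhatP => //=.
rewrite dsymZ !dsym_eu ?oppr_eq0 ?gt_eqF // !opprK.
rewrite !sg_even ?hoddN //; apply: glP => i j; rewrite !glDE !glZE !glDE !glZE.
ring.
Qed.

End ModuleRelations.

(** * Necessity *)

Section UnitaryModule.
Variables (C : numClosedFieldType) (M : lmodType C) (act : Dhat C -> M -> M).
Hypothesis Hact : is_module act.
Variable f : {dot M for Num.conj}.
Hypothesis Hf : forall x v w, f (act x v) w = f v (act (Domega x) w).
Implicit Types (p q r s : int) (u w : M).
Local Notation E := (Eop act).

Lemma dotZr a u w : f u (a *: w) = a^* * f u w.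
Proof. exact: linearZr_LR. Qed.

Lemma dot_ge0 u : 0 <= f u u.
Proof.
have [->|u0] := eqVneq u 0; first by rewrite linear0l.
by rewrite ltW // neq0_dnorm_gt0.
Qed.

Lemma dot_eq0 u : f u u = 0 -> u = 0.
Proof. by move=> h; apply/eqP/negPn/negP => /(@neq0_dnorm_gt0 _ _ _ f); rewrite h ltxx. Qed.

Lemma dot_scale_ge0 (m : C) u w : u != 0 -> f w w = f u (m *: u) -> 0 <= m.
Proof.
move=> u0 h; have := dot_ge0 w; rewrite h dotZr pmulr_lge0 ?neq0_dnorm_gt0 //.
by rewrite conjC_ge0.
Qed.

End UnitaryModule.

Section UnitaryOps.
Variables (C : numClosedFieldType) (M : lmodType C) (act : Dhat C -> M -> M).
Hypothesis Hact : is_module act.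
Variable f : {dot M for Num.conj}.
Hypothesis Hf : forall x v w, f (act x v) w = f v (act (Domega x) w).
Implicit Types (p q r s : int) (u w : M).
Local Notation E := (Eop act).

Lemma Eop_adj p q u w : nsign p = nsign q -> f (E p q u) w = f u (E q p w).
Proof.
move=> pq; rewrite Hf Domega_dd gl_omega_eu pq addnn -signr_odd odd_double.
by rewrite expr0 scale1r.
Qed.

Lemma nsign_pos p : 0 < p -> nsign p = false.
Proof. by move=> p0; rewrite /nsign ltNge (ltW p0) andbF. Qed.

Lemma nsign_even p : ~~ hodd p -> nsign p = false.
Proof. by rewrite /nsign => /negPf->. Qed.

Lemma act_cc x e u : Dparity e x -> act (cc C) (act x u) = act x (act (cc C) u).
Proof.
move=> px; rewrite (act_bracket Hact u (cc_parity C) px) expr0 scale1r.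
rewrite (_ : Dbracket _ _ = 0) ?act0l ?add0r //; apply: DhatP => /=.
  have := glbracket_linearl (x : glhat C).1 (-1) 0 0.
  by rewrite scaler0 add0r scaleN1r addNr.
by apply: cocycle_diag => r q _; rewrite gl0E mul0r.
Qed.

Lemma Eop_cc p q u k : act (cc C) u = k *: u ->
  act (cc C) (E p q u) = k *: E p q u.
Proof.
move=> h; rewrite (act_cc _ (dd_parity (@eu_parity C p q))) h.
exact: EopZ.
Qed.

Lemma Eop_kill p q r s u : 0 < p -> 0 < q -> 0 < r -> 0 < s -> E p q u = 0 ->
  (q = r -> E p s u = 0) -> (s = p -> E r q u = 0) -> E p q (E r s u) = 0.
Proof.
move=> p0 q0 r0 s0 h h1 h2; rewrite Eop_comm // h Eop0 // scaler0 add0r.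
case: eqP => [/h1->|_]; case: eqP => [/h2->|_];
  by rewrite ?mulr0 ?scaler0 ?scale0r ?scaler0 subrr.
Qed.

Lemma Eop_diag_comm r p q u : 0 < r -> 0 < p -> 0 < q ->
  E r r (E p q u) = E p q (E r r u) + ((r == p)%:R - (r == q)%:R) *: E p q u.
Proof.
move=> r0 p0 q0; rewrite Eop_comm // /esgn addbb /= expr0 scale1r mul1r.
have -> : (r == p)%:R *: E r q u = (r == p)%:R *: E p q u.
  by case: eqP => [->|_]; rewrite ?scale0r.
have -> : (q == r)%:R *: E p r u = (r == q)%:R *: E p q u.
  by rewrite eq_sym; case: eqP => [->|_]; rewrite ?scale0r.
by rewrite scalerBl.
Qed.

Lemma Eop_diag r p q u (c : C) : 0 < r -> 0 < p -> 0 < q ->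
  E r r u = c *: u -> E r r (E p q u) = (c + (r == p)%:R - (r == q)%:R) *: E p q u.
Proof. by move=> r0 p0 q0 h; rewrite Eop_diag_comm // h EopZ // -scalerDl addrA. Qed.

Lemma Eop_lower p q u (a b : C) : 0 < p -> 0 < q -> E p q u = 0 ->
  E p p u = a *: u -> E q q u = b *: u ->
  E p q (E q p u) = (a - esgn C p q q p * b) *: u.
Proof.
move=> p0 q0 h ha hb; rewrite Eop_comm // h Eop0 // scaler0 add0r !eqxx mulr1.
by rewrite scale1r ha hb scalerA scalerBl.
Qed.

(** For opposite parities E_{pq} E_{qp} + E_{qp} E_{pq} = E_{pp} + E_{qq}, so the squared norm of
    [E q p u] is, up to conjugation, a + b times that of [u]. *)
Lemma lower_odd p q u (a b : C) : 0 < p -> 0 < q -> hodd p != hodd q ->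
  E p q u = 0 -> E p p u = a *: u -> E q q u = b *: u -> u != 0 ->
  (E q p u = 0 <-> a + b = 0).
Proof.
move=> p0 q0 pq h ha hb u0.
have h1 : f (E q p u) (E q p u) = f u ((a + b) *: u).
  rewrite Eop_adj ?nsign_pos // (Eop_lower p0 q0 h ha hb) /esgn.
  by case: (hodd p) pq; case: (hodd q) => //= _; rewrite expr1 mulN1r opprK.
split=> [z|z]; last by apply: (dot_eq0 (f := f)); rewrite h1 z scale0r linear0r.
move: h1; rewrite z linear0r dotZr => /esym/eqP; rewrite mulf_eq0.
rewrite (gt_eqF (neq0_dnorm_gt0 _ u0)) orbF => /eqP h2.
by rewrite -[a + b]conjCK h2 conjC0.
Qed.

(** The commutator replaces the anticommutator, and the norm is governed by a - b. *)
Lemma lower_even p q u (a b : C) : 0 < p -> 0 < q -> hodd p = hodd q ->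
  E p q u = 0 -> E p p u = a *: u -> E q q u = b *: u -> a = b -> E q p u = 0.
Proof.
move=> p0 q0 pq h ha hb ab; apply: (dot_eq0 (f := f)).
rewrite Eop_adj ?nsign_pos // (Eop_lower p0 q0 h ha hb) /esgn pq addbb /= expr0.
by rewrite mul1r ab subrr scale0r linear0r.
Qed.

(** Here e g^{k+1} u = (k+1)(m-k) g^k u. If m is not a natural number, no g^k u vanishes, and
    positivity of all their norms gives k <= m for every k, against the archimedean assumption. *)
Lemma su2_nat (e g h : M -> M) (m : C) u :
  (forall m' : C, 0 <= m' -> exists k : nat, ~ k%:R <= m') ->
  (forall x w, f (g x) w = f x (e w)) ->
  (forall a x, g (a *: x) = a *: g x) -> g 0 = 0 ->
  (forall x, e (g x) = g (e x) + h x) ->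
  (forall x, h (g x) = g (h x) - 2 *: g x) ->
  e u = 0 -> h u = m *: u -> u != 0 -> exists n, m = n%:R.
Proof.
move=> arch adj gZ g0 eg hg eu0 hu u0; pose w k := iter k g u.
have wS k : w k.+1 = g (w k) by [].
have hw k : h (w k) = (m - 2 * k%:R) *: w k.
  elim: k => [|k IH]; first by rewrite mulr0 subr0.
  rewrite wS hg IH gZ -scalerBl -natr1; congr (_ *: _); ring.
have ew k : e (w k.+1) = (k.+1%:R * (m - k%:R)) *: w k.
  elim: k => [|k IH]; first by rewrite wS eg eu0 g0 add0r hu subr0 mul1r.
  rewrite wS eg IH gZ hw -wS -scalerDl.
  congr (_ *: _); rewrite -!natr1; ring.
have nw k : f (w k.+1) (w k.+1) = f (w k) ((k.+1%:R * (m - k%:R)) *: w k).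
  by rewrite {1}wS adj ew.
apply: contrapT => nm.
have wn0 k : w k != 0.
  elim: k => // k IH; apply/eqP => z; move: (nw k); rewrite z linear0l dotZr.
  move/esym/eqP; rewrite mulf_eq0 (gt_eqF (neq0_dnorm_gt0 _ IH)) orbF conjC_eq0.
  rewrite mulf_eq0 pnatr_eq0 /= subr_eq0 => /eqP mk; apply: nm; by exists k.
have mge k : k%:R <= m.
  have := dot_scale_ge0 (wn0 k) (nw k).
  by rewrite pmulr_rge0 ?ltr0n // subr_ge0.
by have [k] := arch m (mge 0%N); apply.
Qed.

End UnitaryOps.

(** * Integrality and inequalities at a unitary highest weight vector *)

Section HighestWeightBounds.
Variables (C : numClosedFieldType) (M : lmodType C) (act : Dhat C -> M -> M).
Hypothesis Hact : is_module act.
Variable f : {dot M for Num.conj}.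
Hypothesis Hf : forall x v w, f (act x v) w = f v (act (Domega x) w).
Hypothesis arch : forall m : C, 0 <= m -> exists k : nat, ~ k%:R <= m.
Variables (v : M) (wt : int -> C) (lev : C).
Implicit Types (p q r s : int) (u w : M).
Local Notation E := (Eop act).
Hypothesis v0 : v != 0.
Hypothesis wtE : forall p, 0 < p -> E p p v = wt p *: v.
Hypothesis upE : forall p q, 0 < p -> p < q -> E p q v = 0.
Hypothesis upA : forall p q, 0 < p -> 0 < q -> E (- p) q v = 0.
Hypothesis levE : act (cc C) v = lev *: v.
Hypothesis tail : exists N : nat, forall p, N%:Z <= p -> wt p = 0.

Lemma wt_diff_nat p q : 0 < p -> p < q -> hodd p = hodd q ->
  exists n : nat, wt p - wt q = n%:R.
Proof.
move=> p0 pq hpq; have q0 : 0 < q by lia.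
have eqp : (q == p) = false by lia.
have epq : (p == q) = false by lia.
apply: (su2_nat (f := f) (e := E p q) (g := E q p)
   (h := fun x => E p p x - E q q x) (u := v)) => //.
- by move=> x w; rewrite (Eop_adj Hf) // !nsign_pos.
- by move=> a x; rewrite EopZ.
- by rewrite Eop0.
- move=> x; rewrite Eop_comm // /esgn hpq addbb /= expr0 !eqxx mulr1 !scale1r.
  by [].
- move=> x; rewrite !Eop_diag_comm // !eqxx eqp epq EopB //.
  by rewrite subr0 sub0r scaleN1r scale1r scaler_nat mulr2n opprD addrACA -opprD.
- exact: upE.
- by rewrite !wtE // scalerBl.
Qed.

Lemma wt_nat p : 0 < p -> exists n : nat, wt p = n%:R.
Proof.
move=> p0; have [N hN] := tail.
(* An index of the same parity as p beyond the support of the weight turns the difference into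
   [wt p] itself. *)
have [||n hn] := @wt_diff_nat p (p + (N.*2)%:Z + 2) p0; first lia.
  by rewrite /hodd; lia.
by exists n; rewrite -hn (hN (p + _ + _)) ?subr0 //; lia.
Qed.

Lemma wt_ge0 p : 0 < p -> 0 <= wt p.
Proof. by move=> /wt_nat[n ->]; rewrite ler0n. Qed.

(** Uses the triple of [AAop_comm]. The pair creator adds 1 to the weights at p and at q, so the
    third element drops by 2. *)
Lemma level_diff_nat p q : 0 < p -> 0 < q -> p != q -> ~~ hodd p -> ~~ hodd q ->
  exists n : nat, 2 * lev - wt p - wt q = n%:R.
Proof.
move=> p0 q0 pq hp hq.
have [hpf hqf] := (negPf hp, negPf hq).
apply: (su2_nat (f := f) (e := E (- p) q) (g := E q (- p))
   (h := fun x => (2 : C) *: act (cc C) x - E p p x - E q q x) (u := v)) => //.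
- by move=> x w; rewrite (Eop_adj Hf) // !nsign_even ?hoddN.
- by move=> a x; rewrite EopZ.
- by rewrite Eop0.
- by move=> x; rewrite AAop_comm // !addrA.
- move=> x.
  have D r : r \in [:: p; q] -> E r r (E q (- p) x) = E q (- p) (E r r x) + E q (- p) x.
    rewrite !inE => hr; have [r0 hr0] : 0 < r /\ ~~ hodd r by case/orP: hr => /eqP->.
    rewrite (Eop_rel Hact); [|lia..].
    rewrite cocycle_diag; last first.
      move=> a b ab; rewrite dsym_eu; [|lia..]; rewrite glDE glZE /=.
      have -> : (a == - r) && (b == - r) = false by lia.
      have -> : (a == r) && (b == r) = false by lia.
      by rewrite mulr0 addr0 mul0r.
    rewrite scale0r addr0 /esgn !addbb /= expr0 ?opprK !mul1r eqr_opp scale1r.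
    rewrite sg_even ?hoddN //.
    have -> : (- r == q) = false by lia.
    have -> : (- p == r) = false by lia.
    rewrite !scale0r sub0r subr0 scaleN1r opprK.
    by case/orP: hr => /eqP->; rewrite eqxx ?(eq_sym q) (negPf pq) !scale1r !scale0r ?addr0 ?add0r.
  rewrite !D ?inE ?eqxx ?orbT // (act_cc Hact _ (dd_parity (@eu_parity C q (- p)))).
  rewrite -/(Eop act _ _ _) !EopB // EopZ // !opprD !addrA.
  by rewrite [2 *: E q (- p) x]scaler_nat mulr2n opprD addrA; congr (_ - _); rewrite addrAC.
- exact: upA.
- by rewrite levE !wtE // !scalerBl scalerA.
Qed.

Lemma wt_chain p : 0 < p -> wt p = wt (p + 2) -> wt p = 0 /\ wt (p + 1) = 0.
Proof.
move=> p0 hw.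
have h2 : E (p + 2) p v = 0.
  apply: (lower_even Hact Hf (a := wt p) (b := wt (p + 2)));
    rewrite ?wtE ?upE //; try lia.
  by rewrite /hodd; lia.
have h1 : E (p + 1) p v = 0.
  have := Eop_comm Hact (p := p + 1) (q := p + 2) (r := p + 2) (s := p) v.
  rewrite h2 Eop0 // upE ?Eop0 //; [|lia..].
  rewrite scaler0 add0r eqxx (_ : (p == p + 1) = false) ?mulr0 ?scale0r ?subr0 ?scale1r; [|lia].
  by move=> h; rewrite -h //; lia.
have hs : wt p + wt (p + 1) = 0.
  apply: (lower_odd Hact Hf (p := p) (q := p + 1) (u := v) _ _ _ _ _ _ _).1 h1 => //.
  - lia.
  - by rewrite /hodd; lia.
  - by apply: upE; lia.
  - exact: wtE.
  - by apply: wtE; lia.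
have [a ha] := wt_nat p0; have [|b hb] := @wt_nat (p + 1); first lia.
move: hs; rewrite ha hb -natrD => /eqP; rewrite pnatr_eq0 addn_eq0 => /andP[/eqP-> /eqP->].
by [].
Qed.

(** Weights of one parity are nonincreasing and nonnegative, so [wt (p + 2)] vanishes too and the
    equality case applies. The support of the weight is thereby an initial segment, which is what
    makes r well defined. *)
Lemma wt_zero_succ p : 0 < p -> wt p = 0 -> wt (p + 1) = 0.
Proof.
move=> p0 h; have [||n hn] := @wt_diff_nat p (p + 2) p0; first lia.
  by rewrite /hodd; lia.
rewrite h sub0r in hn; have [|m hm] := @wt_nat (p + 2); first lia.
suff h2 : wt (p + 2) = 0 by apply: (wt_chain p0 _).2; rewrite h h2.
move: hn; rewrite hm => /eqP; rewrite -subr_eq0 -opprD oppr_eq0 -natrD pnatr_eq0 addn_eq0.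
by case/andP => /eqP->.
Qed.

Definition Akill u := forall p q, 0 < p -> 0 < q -> E (- p) q u = 0.

Lemma Akill_Eop r s u : 0 < r -> 0 < s -> Akill u -> Akill (E r s u).
Proof.
move=> r0 s0 hu p q p0 q0.
by rewrite Aop_comm // !hu // Eop0 // !scaler0 !addr0.
Qed.

(** [E 4 (- 2)] creates a pair at the integers 1 and 2. On a vector killed by the pair annihilators,
    its squared norm is given by 2C - E_{22} - E_{44} in the doubled indices. *)
Lemma level_bound u (a b : C) : u != 0 -> Akill u -> act (cc C) u = lev *: u ->
  E 2 2 u = a *: u -> E 4 4 u = b *: u -> 0 <= 2 * lev - a - b.
Proof.
move=> u0 hu hc ha hb.
apply: (dot_scale_ge0 (f := f) (w := E 4 (- 2) u) u0).
rewrite (Eop_adj Hf) ?nsign_even // AAop_comm // hu // Eop0 // add0r hc ha hb.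
by rewrite !scalerBl scalerA.
Qed.

Let E21 := E 2 1 v.

Lemma E21_neq0 : wt 1 != 0 -> E21 != 0.
Proof.
move=> h; apply/eqP => /(lower_odd Hact Hf (p := 1) (q := 2)) z.
have : wt 1 + wt 2 = 0 by apply: z; rewrite ?wtE ?upE.
by move/eqP; rewrite paddr_eq0 ?wt_ge0 // (negPf h).
Qed.

(** [E21] moves one unit from the half-integer 1/2 to the integer 1; this gain is the value 1 of
    l_{1,2} at 1. *)
Lemma level1 : wt 1 != 0 -> 0 <= 2 * lev - (wt 2 + 1) - wt 4.
Proof.
move=> h; apply: (level_bound (E21_neq0 h)).
- exact: Akill_Eop.
- exact: Eop_cc.
- by rewrite (Eop_diag Hact (c := wt 2)) ?wtE //= subr0.
- by rewrite (Eop_diag Hact (c := wt 4)) ?wtE //= subr0 addr0.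
Qed.

(** When xi_{1/2} >= 2, a second unit can be moved from 1/2 to the integer 2; hence the value 2 of
    l_{1,2}. *)
Lemma level2 : wt 1 != 0 -> wt 1 != 1 -> 0 <= 2 * lev - (wt 2 + 1) - (wt 4 + 1).
Proof.
move=> h h1.
have z : E 1 4 E21 = 0.
  by apply: Eop_kill => // *; apply: upE.
have D r : 0 < r -> E r r E21 = (wt r + (r == 2)%:R - (r == 1)%:R) *: E21.
  by move=> r0; apply: Eop_diag => //; apply: wtE.
(* Its squared norm is proportional to ([wt 1] - 1) + [wt 4], which is positive because [wt 1] is a
   natural number other than 0 and 1. *)
have nz : E 4 1 E21 != 0.
  apply/eqP => /(lower_odd Hact Hf (p := 1) (q := 4)) y.
  have : (wt 1 + 0 - 1) + (wt 4 + 0 - 0) = 0.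
    by apply: y => //; rewrite ?D //; apply: E21_neq0.
  rewrite addr0 subr0 addr0.
  have [//|n hn] := @wt_nat 1; have [//|m hm] := @wt_nat 4.
  move: h h1; rewrite hn hm pnatr_eq0 pnatr_eq1; case: n {hn} => [|[|n]] // _ _.
  by rewrite -natr1 addrK -natrD => /eqP; rewrite pnatr_eq0.
apply: (level_bound nz).
- by apply: Akill_Eop => //; apply: Akill_Eop.
- by do 2!apply: Eop_cc => //.
- by rewrite (Eop_diag Hact (c := wt 2 + 1 - 0)) ?D //= !subr0 addr0.
- by rewrite (Eop_diag Hact (c := wt 4 + 0 - 0)) ?D //= !subr0 addr0.
Qed.

(** Before the two moves out of 1/2, [E 4 3] moves a unit from 3/2 to 2. The total gain is 3: two
    from l_{1,2} and one from the minimum of xi_{3/2} and 1. *)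
Lemma level3 : wt 1 != 0 -> wt 3 != 0 -> 0 <= 2 * lev - (wt 2 + 1) - (wt 4 + 2).
Proof.
move=> h1 h3; pose u1 := E 4 3 v; pose u2 := E 2 1 u1.
have u1n0 : u1 != 0.
  apply/eqP => /(lower_odd Hact Hf (p := 3) (q := 4)) y.
  have : wt 3 + wt 4 = 0 by apply: y; rewrite ?wtE ?upE.
  by move/eqP; rewrite paddr_eq0 ?wt_ge0 // (negPf h3).
have D1 r : 0 < r -> E r r u1 = (wt r + (r == 4)%:R - (r == 3)%:R) *: u1.
  by move=> r0; apply: Eop_diag => //; apply: wtE.
have E12 : E 1 2 u1 = 0.
  by apply: Eop_kill => // *; apply: upE.
have u2n0 : u2 != 0.
  apply/eqP => /(lower_odd Hact Hf (p := 1) (q := 2)) y.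
  have : (wt 1 + 0 - 0) + (wt 2 + 0 - 0) = 0.
    by apply: y => //; rewrite ?D1.
  rewrite !addr0 !subr0.
  by move/eqP; rewrite paddr_eq0 ?wt_ge0 // (negPf h1).
have D2 r : 0 < r -> E r r u2 =
   ((wt r + (r == 4)%:R - (r == 3)%:R) + (r == 2)%:R - (r == 1)%:R) *: u2.
  by move=> r0; apply: Eop_diag => //; apply: D1.
have E14 : E 1 4 u1 = 0.
  by apply: Eop_kill => // *; apply: upE.
have E24 : E 2 4 u1 = 0.
  by apply: Eop_kill => // *; apply: upE.
have z : E 1 4 u2 = 0.
  by apply: Eop_kill.
have nz : E 4 1 u2 != 0.
  apply/eqP => /(lower_odd Hact Hf (p := 1) (q := 4)) y.
  have : (wt 1 + 0 - 0 + 0 - 1) + (wt 4 + 1 - 0 + 0 - 0) = 0.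
    by apply: y => //; rewrite ?D2.
  rewrite !addr0 !subr0 addrACA addNr addr0.
  by move/eqP; rewrite paddr_eq0 ?wt_ge0 // (negPf h1).
apply: (level_bound nz).
- by do 3!apply: Akill_Eop => //.
- by do 3!apply: Eop_cc => //.
- by rewrite (Eop_diag Hact (c := wt 2 + 0 - 0 + 1 - 0)) ?D2 //= !subr0 !addr0.
- rewrite (Eop_diag Hact (c := wt 4 + 1 - 0 + 0 - 0)) ?D2 //= !subr0 !addr0.
  by rewrite -addrA.
Qed.

End HighestWeightBounds.

Section LinearCombinations.
Variables (C : numClosedFieldType) (T : Type) (M : lmodType C).
Variable L : (T -> C) -> M.
Hypothesis L_linear : forall k a b, L (fun j => k * a j + b j) = k *: L a + L b.

Lemma pointwise_linear0 : L (fun=> 0) = 0.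
Proof.
have := L_linear (-1) (fun=> 0) (fun=> 0).
rewrite scaleN1r addNr (_ : (fun j : T => _) = (fun=> 0)) //.
by apply: funext => j; rewrite mulr0 addr0.
Qed.

Lemma pointwise_linear_sum (I : Type) (r : seq I) (x : I -> C) (F : I -> T -> C) :
  L (fun j => \sum_(i <- r) x i * F i j) = \sum_(i <- r) x i *: L (F i).
Proof.
elim: r => [|i r IH].
  rewrite big_nil -pointwise_linear0; congr L.
  by apply: funext => j; rewrite big_nil.
rewrite big_cons -IH -L_linear; congr L.
by apply: funext => j; rewrite big_cons.
Qed.

End LinearCombinations.

Lemma lspan_range (K : pzRingType) (V : lmodType K) n (g : 'I_n -> V) w :
  lspan (range g) w -> exists c : 'I_n -> K, w = \sum_i c i *: g i.
Proof.
apply: (lspan_le (P := fun w => exists c : 'I_n -> K, w = \sum_i c i *: g i)).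
- by exists (fun=> 0); rewrite big1 // => i _; rewrite scale0r.
- move=> a _ _ [c ->] [d ->]; exists (fun i => a * c i + d i).
  rewrite scaler_sumr -big_split; apply: eq_bigr => i _.
  by rewrite scalerDl scalerA.
- move=> _ [i _ <-]; exists (fun j => (j == i)%:R).
  by rewrite (bigD1 i) //= eqxx scale1r big1 ?addr0 // => j /negPf->; rewrite scale0r.
Qed.

(** * Finite support of the weight from quasi-finiteness *)

Section Tail.
Variable C : numClosedFieldType.
Implicit Types (a b : int -> C) (i j : int).

Lemma banded_dgm a : banded (fun i j => (i == j)%:R * a i : C^o).
Proof.
apply/asboolP; exists 0%N => i j hij.
have /negPf-> : i != j by lia.
by rewrite mul0r.
Qed.
Definition dgm a : gl C := Gl (banded_dgm a).

Lemma banded_low a :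
  banded (fun i j => ((0 < j) && (i == j + 1))%:R * a j : C^o).
Proof.
apply/asboolP; exists 1%N => i j hij.
have /negPf-> : i != j + 1 by lia.
by rewrite andbF mul0r.
Qed.
(** An infinite weighted sum of the units e_{j+1,j}; the actual degree is -1/2, encoded as -1. *)
Definition lowm a : gl C := Gl (banded_low a).

Lemma banded_up a :
  banded (fun i j => ((0 < i) && (j == i + 1))%:R * a i : C^o).
Proof.
apply/asboolP; exists 1%N => i j hij.
have /negPf-> : j != i + 1 by lia.
by rewrite andbF mul0r.
Qed.
Definition upm a : gl C := Gl (banded_up a).

Lemma dgm_linear k a b : dgm (fun j => k * a j + b j) = k *: dgm a + dgm b.
Proof. by apply: glP => i j; rewrite glDE glZE; apply: etrans (mulrDr _ _ _) _; rewrite mulrCA. Qed.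

Lemma lowm_linear k a b : lowm (fun j => k * a j + b j) = k *: lowm a + lowm b.
Proof. by apply: glP => i j; rewrite glDE glZE; apply: etrans (mulrDr _ _ _) _; rewrite mulrCA. Qed.

Lemma dgm_degree a : gldegree 0 (dgm a).
Proof. by move=> i j /=; case: (i =P j) => [->|_]; rewrite ?subr0 // mul0r eqxx. Qed.

Lemma lowm_degree a : gldegree (-1) (lowm a).
Proof.
move=> i j /=; case: andP => [[_ /eqP->]|_]; last by rewrite mul0r eqxx.
by rewrite opprK.
Qed.

Lemma upm_degree a : gldegree 1 (upm a).
Proof.
move=> i j /=; case: andP => [[_ /eqP->]|_]; last by rewrite mul0r eqxx.
by rewrite addrK.
Qed.

Lemma lowm_inA a : inA (lowm a).
Proof.
move=> i; split=> /=; first by rewrite ?ltxx mul0r.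
by case: andP => [[h /eqP h']|_]; [lia|rewrite mul0r].
Qed.

Lemma gldegree_parity k (A : gl C) : gldegree k A -> glparity (hodd k) A.
Proof. by move=> dA i j /dA ->; rewrite !hoddB; case: (hodd j); case: (hodd k). Qed.

Lemma dsym_upm b i j : 0 < j ->
  dsym (upm b) i j = ((0 < i) && (j == i + 1))%:R * b i.
Proof.
move=> j0; have [->|i0] := eqVneq i 0; first by rewrite (@dsym_inA _ _ _).2 ltxx mul0r.
have j1 : j != 0 by lia.
rewrite dsymE //= (_ : (0 < - j) = false) ?mul0r ?mulr0 ?subr0 //; lia.
Qed.

Lemma dsym_upm0 b i j : 0 < i -> j <= 0 -> dsym (upm b) i j = 0.
Proof.
move=> i0; rewrite le_eqVlt => /orP[/eqP->|j0]; first by rewrite (@dsym_inA _ _ _).1.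
have [i1 j1] : i != 0 /\ j != 0 by split; lia.
rewrite dsymE //=.
rewrite (_ : (j == i + 1) = false) ?andbF ?mul0r; last lia.
by rewrite (_ : (- i == - j + 1) = false) ?andbF ?mul0r ?mulr0 ?subr0 //; lia.
Qed.

(** The anticommutator of e_{i,i+1} and e_{i+1,i} is e_{ii} + e_{i+1,i+1}, so position i receives a
    term from i and one from i - 1. *)
Lemma glbracket_up_low a b : glbracket (dsym (upm b)) (lowm a) =
  dgm (fun i => (0 < i)%R%:R * (a i * b i) + (1 < i)%R%:R * (a (i - 1) * b (i - 1))).
Proof.
rewrite (glbracket_homog (e := true) (f := true)); first last.
- exact: (gldegree_parity (@lowm_degree a)).
- exact/dsym_parity/(gldegree_parity (@upm_degree b)).
rewrite expr1 scaleN1r opprK; apply: glP => i j; rewrite glDE !glmulE.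
rewrite (fsum1 (j := j + 1)); last first.
  by move=> k /negPf kj; rewrite /= kj andbF mul0r mulr0.
rewrite (fsum1 (j := i - 1)); last first.
  move=> k ki; rewrite /= (_ : (i == k + 1) = false) ?andbF ?mul0r //; lia.
have -> : lowm a (j + 1) j = (0 < j)%R%:R * a j by rewrite /= eqxx andbT.
have -> : lowm a i (i - 1) = (1 < i)%R%:R * a (i - 1).
  by rewrite /= subrK eqxx andbT subr_gt0.
have -> : dgm (fun i => (0 < i)%R%:R * (a i * b i) +
    (1 < i)%R%:R * (a (i - 1) * b (i - 1))) i j =
  (i == j)%:R * ((0 < i)%R%:R * (a i * b i) +
    (1 < i)%R%:R * (a (i - 1) * b (i - 1))) by [].
rewrite mulrDr; congr (_ + _).
  have [j0|j0] := ltrP 0 j; last first.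
    rewrite !mul0r mulr0; case: (i =P j) => [->|_]; last by rewrite mul0r.
    by rewrite (_ : (0 < j) = false) ?mul0r ?mulr0 //; lia.
  rewrite dsym_upm; last lia.
  rewrite (_ : (j + 1 == i + 1) = (i == j)); last lia.
  by case: (i =P j) => [->|_]; rewrite ?andbF ?j0 ?mul0r //=; ring.
have [i1|i1] := ltrP 1 i; last by rewrite !mul0r mulr0.
have [j0|j0] := lerP j 0.
  rewrite dsym_upm0 //; last lia.
  by rewrite mulr0 (_ : (i == j) = false) ?mul0r //; lia.
rewrite dsym_upm // subrK (eq_sym j) subr_gt0 i1 /=; ring.
Qed.

Lemma cocycle_up_low a b : cocycle (dsym (upm b)) (dsym (lowm a)) = 0.
Proof.
apply: cocycle_diag => r q rq.
have [->|r0] := eqVneq r 0; first by rewrite (@dsym_inA _ (upm b) _).2 mul0r.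
have [->|q0] := eqVneq q 0; first by rewrite (@dsym_inA _ (upm b) _).1 mul0r.
rewrite [X in _ * X]dsymE // [lowm a q r]/= [lowm a _ _]/=.
rewrite (_ : (0 < r) && (q == r + 1) = false) ?mul0r; last by apply/negP; lia.
rewrite (_ : (0 < - q) && (- r == - q + 1) = false) ?mul0r; last by apply/negP; lia.
by rewrite !mulr0 subr0 mulr0.
Qed.

Lemma poly_nat_tail (p : {poly C}) : p != 0 ->
  exists N : nat, forall j : nat, (N <= j)%N -> p.[j%:R] != 0.
Proof.
move=> p0; have [rs ->] := closed_field_poly_normal p.
(* The natural number equal to the root [r] if there is one. The sum of all of them bounds each, and
   the default 0 does no harm. *)
pose ix (r : C) : nat := xget 0%N [set j : nat | j%:R = r].
exists (\sum_(r <- rs) ix r).+1%N => j hj; rewrite hornerZ mulf_neq0 ?lead_coef_eq0 //.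
rewrite horner_prod big_seq prodf_seq_neq0; apply/allP => r rin; rewrite rin /=.
rewrite hornerXsubC subr_eq0; apply/eqP => jr.
have : ix r = j.
  rewrite /ix; case: xgetP => [k -> /= kr|/(_ j) //].
  by apply/eqP; rewrite -(eqr_nat C) kr jr.
rewrite (big_rem r) //= in hj; lia.
Qed.

Lemma diag_inDhat0 a : inDhat0 (dd (dgm a)).
Proof. exact/asboolP/dd_degree/dgm_degree. Qed.
Definition hdiag a : Dhat0 C := MkDhat0 (diag_inDhat0 a).

Lemma cc_inDhat0 : inDhat0 (cc C).
Proof. by apply/asboolP; split=> // i j; rewrite gl0E eqxx. Qed.
Definition cc0 : Dhat0 C := MkDhat0 cc_inDhat0.

Lemma hdiag_linear k a b : hdiag (fun j => k * a j + b j) = k *: hdiag a + hdiag b.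
Proof. by apply: val_inj => /=; rewrite dgm_linear dd_linear. Qed.

(** Skewness determines the negative half of the diagonal; the factor [(0 < i)] keeps [dsym] from
    counting entries twice. *)
Lemma Dhat0_decomp (h : Dhat0 C) :
  h = Lambda0 h *: cc0 + hdiag (fun i => (0 < i)%R%:R * (h : glhat C).1 i i).
Proof.
apply: val_inj; rewrite /= /Lambda0; apply: DhatP; last first.
  by rewrite -[RHS]/(((h : glhat C).2 : C) * 1 + 0) mulr1 addr0.
have /asboolP Dh := DhatvalP h; have /asboolP[dh _] := Dhat0valP h.
rewrite -[RHS]/(_ *: 0 + dsym _) scaler0 add0r.
apply: gl_ext0; [exact: inD_inA|exact: dsym_inA|move=> i j i0 j0].
rewrite dsymE //= eqr_opp (eq_sym j).
have [->|ij] := eqVneq i j; last first.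
  rewrite !mul0r mulr0 subr0; apply/eqP; apply: contraNT ij => /dh.
  by rewrite subr0 => ->.
rewrite !mul1r; have [jp|jn] := ltrP 0 j.
  by rewrite (_ : (0 < - j) = false) ?mul1r ?mul0r ?mulr0 ?subr0 //; lia.
rewrite (_ : (0 < - j)) ?mul1r ?mul0r ?sub0r; last lia.
exact: inD_sg.
Qed.

Lemma dgm_eu p : dgm (fun j => (j == p)%:R) = eu C p p.
Proof.
by apply: glP => i j /=; case: (i =P p) => [->|]; rewrite ?mulr0 // mulr1 eq_sym.
Qed.

Variables (M : lmodType C) (act : Dhat C -> M -> M) (xi : {scalar Dhat0 C}) (v : M).
Hypothesis Hact : is_module act.
Hypothesis Hhw : highest_weight act xi v.
Hypothesis Hqf : quasi_finite act v.

Lemma hw_unique (c d : C) : c *: v = d *: v -> c = d.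
Proof.
case: Hhw => v0 _ _ _ /eqP; rewrite -subr_eq0 -scalerBl scaler_eq0 (negPf v0) orbF.
by rewrite subr_eq0 => /eqP.
Qed.

Lemma act_up_low a b : act (dd (lowm a)) v = 0 ->
  xi (hdiag (fun i => (0 < i)%R%:R * (a i * b i)
                    + (1 < i)%R%:R * (a (i - 1) * b (i - 1)))) = 0.
Proof.
case: Hhw => v0 hv up _ h; apply: hw_unique; rewrite -hv scale0r.
have pu : Dparity true (dd (upm b)) := dd_parity (gldegree_parity (@upm_degree b)).
have pl : Dparity true (dd (lowm a)) := dd_parity (gldegree_parity (@lowm_degree a)).
have := act_bracket Hact v pu pl.
have ev : act (dd (upm b)) v = 0.
  by apply: (up 1) => //; exact: dd_degree (@upm_degree b).
rewrite h ev !act0r // scaler0 addr0.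
rewrite (Dbracket_dd (@lowm_inA a) (gldegree_parity (@upm_degree b))
  (gldegree_parity (@lowm_degree a))).
by rewrite cocycle_up_low scale0r addr0 glbracket_up_low => <-.
Qed.

(** Powers of j are used because a relation between them has polynomial coefficients, which vanish
    at finitely many j only. The relation comes from n + 1 vectors in a span of n. *)
Lemma low_dependent : exists2 p : {poly C}, p != 0 &
  act (dd (lowm (fun j => p.[(`|j|%N)%:R]))) v = 0.
Proof.
have [n [g hg]] := Hqf (-1).
pose F (i : nat) (j : int) : C := ((`|j|%N)%:R) ^+ i.
have low (i : nat) : lspan (range g) (act (dd (lowm (F i))) v).
  apply/hg/sub_lspan; rewrite -[-1](addr0 (-1)).
  apply: lowering_cons; [by []|exact: dd_degree (@lowm_degree _)|exact: lowering_nil].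
have /choice[c hc] : forall i : 'I_n.+1, exists c : 'I_n -> C,
    act (dd (lowm (F i))) v = \sum_t c t *: g t by move=> i; apply: lspan_range.
pose A : 'M[C]_(n.+1, n) := \matrix_(i, t) c i t.
have /rowV0Pn[x /sub_kermxP xA x0] : kermx A != 0.
  by rewrite -mxrank_eq0 mxrank_ker subn_eq0 -ltnNge ltnS rank_leq_col.
exists (rVpoly x).
  by apply: contraNneq x0 => z; rewrite -[x]rVpolyK z linear0.
pose L a := act (dd (lowm a)) v.
have LL k a b : L (fun j => k * a j + b j) = k *: L a + L b.
  by rewrite /L lowm_linear actddD.
rewrite -/(L _) (_ : (fun j => _) = fun j => \sum_(i < n.+1) x 0 i * F i j).
  rewrite (pointwise_linear_sum LL).
  transitivity (\sum_(i < n.+1) \sum_t (x 0 i * A i t) *: g t).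
    by apply: eq_bigr => i _; rewrite [L _]hc scaler_sumr; apply: eq_bigr => t _;
      rewrite scalerA mxE.
  rewrite exchange_big big1 //= => t _; rewrite -scaler_suml.
  by have /matrixP/(_ 0 t) := xA; rewrite !mxE => ->; rewrite scale0r.
apply: funext => j; rewrite /rVpoly horner_poly; apply: eq_bigr => i _.
by rewrite valK.
Qed.

(** Every diagonal d supported where p has no root is an anticommutator of [lowm p] with some
    [upm b]: solve p(m) b_m + p(m-1) b_{m-1} = d_m recursively. This covers infinite d, on which the
    values at matrix units say nothing. *)
Lemma xi_tail : exists N : nat, forall d : int -> C,
  (forall j, j < N%:Z -> d j = 0) -> xi (hdiag d) = 0.
Proof.
have [p p0 hp] := low_dependent; have [N hN] := poly_nat_tail p0.
exists N.+1 => d hd.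
(* [c m] is the product p(m) b_m; it vanishes for m <= N, so the division by p happens only where p
   is nonzero. *)
pose c := fix c (m : nat) : C := d m%:Z - (if m is m'.+1 then c m' else 0).
have c0 m : (m <= N)%N -> c m = 0.
  elim: m => [|m IH] hm /=; first by rewrite hd ?subr0 //; lia.
  by rewrite hd ?IH ?subr0 //; lia.
have cS m : c m.+1 = d m.+1%:Z - c m by [].
have hc m : p.[m%:R] * (c m / p.[m%:R]) = c m.
  have [/hN h|h] := leqP N m; first by rewrite mulrC divfK.
  by rewrite c0 ?mul0r ?mulr0 //; lia.
pose b j : C := c `|j|%N / p.[(`|j|%N)%:R].
suff -> : d = fun i => (0 < i)%R%:R * (p.[(`|i|%N)%:R] * b i)
    + (1 < i)%R%:R * (p.[(`|i - 1|%N)%:R] * b (i - 1)) by exact: act_up_low.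
apply: funext => i; rewrite /b !hc; have [i0|i0] := ltrP 0 i; last first.
  by rewrite (_ : (1 < i) = false) ?mul0r ?add0r ?hd //; lia.
have [m im] : exists m : nat, i = m.+1%:Z by exists (`|i|.-1)%N; lia.
have e1 : `|i|%N = m.+1 by lia.
have e2 : `|(i - 1)%R|%N = m by lia.
have e3 : (1 < i) = (0 < m)%N by lia.
rewrite e1 e2 e3 mul1r cS im; case: (posnP m) => [->|_].
  by rewrite mul0r addr0 c0 ?subr0.
by rewrite mul1r subrK.
Qed.

End Tail.

Section Necessity.
Variable C : numClosedFieldType.
Hypothesis arch : forall m : C, 0 <= m -> exists k : nat, ~ k%:R <= m.
Variables (M : lmodType C) (act : Dhat C -> M -> M) (xi : {scalar Dhat0 C}) (v : M).
Hypothesis Hact : is_module act.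
Hypothesis Hhw : highest_weight act xi v.
Hypothesis Hqf : quasi_finite act v.

Let wt (p : int) : C := xi (hdiag (fun j => (j == p)%:R)).
Let lev : C := xi (cc0 C).

(** The cut [B] stays free so that it can be compared with the bound 2r of the chain. *)
Lemma xi_expansion : exists N : nat, forall B : nat, (N <= B)%N -> forall h : Dhat0 C,
  xi h = \sum_(1 <= m < B) wt m * omegaw m h + lev * Lambda0 h.
Proof.
have [N hN] := xi_tail Hact Hhw Hqf; exists N => B NB h.
pose L (a : int -> C) : C^o := xi (hdiag a).
have LL k a b : L (fun j => k * a j + b j) = k *: L a + L b.
  by rewrite /L hdiag_linear linearP.
rewrite {1}(Dhat0_decomp h) linearP addrC -[xi (hdiag _)]/(L _); congr (_ + _); last first.
  by rewrite mulrC.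
set a := (X in L X).
pose a' j : C := \sum_(m <- index_iota 1 B) omegaw m h * (j == m%:Z)%:R.
have -> : a = fun j => 1 * a' j + (a j - a' j).
  by apply: funext => j; rewrite mul1r addrC subrK.
rewrite LL scale1r [L (fun j => a j - a' j)]hN ?addr0; last first.
  move=> j jN; rewrite /a /a'; have [j0|j0] := ltrP 0 j; last first.
    rewrite mul0r big_seq big1 ?subr0 // => m; rewrite mem_index_iota => hm.
    by rewrite (_ : (j == m%:Z) = false) ?mulr0 //; lia.
  have [n jn] : exists n : nat, j = n%:Z by exists `|j|%N; lia.
  rewrite jn mul1r (bigD1_seq n) ?mem_index_iota ?iota_uniq //=; last lia.
  rewrite eqxx mulr1 big1 ?addr0 ?subrr // => m /negPf mn.
  by rewrite eqz_nat eq_sym mn mulr0.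
rewrite /a' (pointwise_linear_sum LL); apply: eq_bigr => m _.
by rewrite mulrC.
Qed.

Lemma hw_wt p : 0 < p -> Eop act p p v = wt p *: v.
Proof.
case: Hhw => _ hv _ _ p0.
by rewrite -hv /Eop /= dgm_eu.
Qed.

Lemma hw_up p q : p < q -> Eop act p q v = 0.
Proof.
case: Hhw => _ _ up _ pq; apply: (up (q - p)); first by rewrite subr_gt0.
exact: dd_degree (@eu_degree C p q).
Qed.

Lemma wt_tail : exists N : nat, forall p, N%:Z <= p -> wt p = 0.
Proof.
have [N hN] := xi_tail Hact Hhw Hqf; exists N => p Np; apply: hN => j jN.
by rewrite (_ : (j == p) = false) //; lia.
Qed.

Lemma unitarizable_chain : unitarizable act ->
  exists (n r : nat) (x : nat -> int),
    [/\ (0 < r)%N, forall m : nat, (r.*2 < m)%N -> x m = 0, chain_cond r x,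
        level_cond n x & forall h : Dhat0 C, xi h = weight n r x h].
Proof.
move=> [f Hf]; have v0 : v != 0 by case: Hhw.
have upE p q : 0 < p -> p < q -> Eop act p q v = 0 by move=> _; exact: hw_up.
have upA p q : 0 < p -> 0 < q -> Eop act (- p) q v = 0.
  by move=> p0 q0; apply: hw_up; lia.
have levE : act (cc C) v = lev *: v by case: Hhw => _ hv _ _; rewrite -hv.
have tl := wt_tail; have [N0 hN0] := wt_tail.
have wnat := wt_nat Hact Hf arch v0 hw_wt upE tl.
have /choice[X hX] : forall m : nat, exists n : nat, (0 < m)%N -> wt m%:Z = n%:R.
  move=> m; have [->|m0] := posnP m; first by exists 0%N.
  by have [//|n hn] := wnat m%:Z; exists n.
have Xz m : (0 < m)%N -> X m = 0%N -> X m.+1 = 0%N.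
  move=> m0 h; apply/eqP; rewrite -(eqr_nat C) -hX //.
  rewrite -addn1 PoszD (wt_zero_succ Hact Hf arch v0 hw_wt upE tl) //.
  by rewrite hX // h.
have Xdec m : (0 < m)%N -> (0 < X m)%N -> (X m.+2 < X m)%N.
  move=> m0 Xm; have hp : hodd m%:Z = hodd (m%:Z + 2) by rewrite /hodd; lia.
  have [| |n] := wt_diff_nat Hact Hf arch v0 hw_wt upE _ _ hp; [lia..|].
  have e2 : m%:Z + 2 = m.+2%:Z by lia.
  rewrite e2 !hX // => /eqP; rewrite subr_eq -natrD eqr_nat => /eqP h.
  case: n h => [|n] h; last by rewrite h; lia.
  have [||z _] := wt_chain Hact Hf arch v0 hw_wt upE tl (p := m%:Z); first lia.
    by rewrite e2 !hX // h.
  by move: z; rewrite hX // => /eqP; rewrite pnatr_eq0 => /eqP z; rewrite z in Xm.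
have exK : exists k, X k.+1 == 0%N.
  by exists N0; rewrite -(eqr_nat C) -hX // hN0 //; lia.
(* [K] is the last index of nonzero weight, and 0 for the zero weight. *)
pose K := ex_minn exK; have XK0 m : (K < m)%N -> X m = 0%N.
  elim: m => // m IH; rewrite ltnS leq_eqVlt => /orP[/eqP<-|Km].
    by rewrite /K; case: ex_minnP => k /eqP.
  by apply: Xz; [lia|exact: IH].
have XKpos m : (0 < m <= K)%N -> (0 < X m)%N.
  case: m => // m hm; rewrite lt0n; apply/negP => h; move: hm; rewrite /K.
  by case: ex_minnP => k _ /(_ m h) h'; lia.
(* The last nonzero index is 2r - 1 or 2r, as xi_r may vanish while xi_{r-1/2} does not; the zero
   weight gets r = 1. *)
pose r := maxn 1 (uphalf K); pose x (m : nat) : int := if m is 0 then 0 else (X m)%:Z.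
have rK : (K <= r.*2)%N by rewrite /r; lia.
(* At two integer indices beyond the support of the weight, [level_diff_nat] sees the level
   alone. *)
have [n hn] : exists n : nat, 2 * lev = n%:R.
  have [|||||n hn] := level_diff_nat Hact Hf arch v0 hw_wt upA levE
    (p := (N0.*2.+2)%:Z) (q := (N0.*2.+4)%:Z); rewrite /hodd ?eqz_nat; try lia.
  by exists n; rewrite -hn !hN0 ?subr0 //; lia.
have lin (a b : nat) : 0 <= 2 * lev - a%:R - b%:R -> (a + b <= n)%N.
  by rewrite hn -addrA -opprD -natrD subr_ge0 ler_nat.
exists n, r, x; split.
- by rewrite /r; lia.
- by case=> // m hm; rewrite /= XK0 //; lia.
- have pos i : (1 <= i < r)%N -> (i.*2 < K)%N by rewrite /r; lia.
  split.
  + move=> i hi; have := pos i hi => iK; case: i hi iK => // i hi iK.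
    rewrite doubleS /= ltz_nat; apply: Xdec => //; apply: XKpos; lia.
  + by rewrite /x; case: (r.*2.-1).
  + move=> i hi; have := pos i hi => iK; case: i hi iK => // i hi iK.
    rewrite doubleS /= ltz_nat; apply: Xdec => //; apply: XKpos; lia.
  + by rewrite /x; case: (r.*2).
  + split=> [|[-> h1 _]] //.
    have r1 : (0 < r)%N by rewrite /r; lia.
    rewrite /x; case E: (r.*2.-1) => [|q] h; first lia.
    have Kq : (K <= q)%N.
      rewrite leqNgt; apply/negP => qK.
      by have := XKpos q.+1; case: h => ->; rewrite qK => /(_ isT).
    have K0 : K = 0%N by move: Kq E; rewrite /r; lia.
    by rewrite /r K0; split=> //=; rewrite XK0 ?K0.
- rewrite /level_cond /x /=.
  (* If xi_{1/2} = 0 the whole weight vanishes. Otherwise the cases xi_{3/2} > 0, xi_{1/2} = 1 and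
     xi_{1/2} >= 2 select the test vector. *)
  have [X1|X1] := posnP (X 1%N).
    have X2 := Xz 1%N isT X1; have X3 := Xz 2%N isT X2; have X4 := Xz 3%N isT X3.
    by rewrite X1 X2 X3 X4.
  have w1 : wt 1 != 0 by rewrite (hX 1%N) // pnatr_eq0 -lt0n.
  have X3 := Xdec 1%N isT X1.
  have [X30|X30] := posnP (X 3%N).
    rewrite X30; have [X11|X11] := eqVneq (X 1%N) 1%N.
      have := level1 Hact Hf arch v0 hw_wt upE upA levE tl w1.
      rewrite (hX 2%N) // (hX 4%N) // natr1 => /lin; rewrite X11 /=; lia.
    have w11 : wt 1 != 1 by rewrite (hX 1%N) // (eqr_nat C _ 1).
    have := level2 Hact Hf arch v0 hw_wt upE upA levE tl w1 w11.
    rewrite (hX 2%N) // (hX 4%N) // !natr1 => /lin.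
    by case: (X 1%N) X1 X11 => [|[|]] //= _ _ _; lia.
  have w3 : wt 3 != 0 by rewrite (hX 3%N) // pnatr_eq0 -lt0n.
  have := level3 Hact Hf arch v0 hw_wt upE upA levE tl w1 w3.
  rewrite (hX 2%N) // (hX 4%N) // natr1 -natrD => /lin.
  have : (1 < X 1)%N by lia.
  by case: (X 1%N) => [|[|k]] //= _; lia.
- move=> h; have [N hN] := xi_expansion; rewrite (hN (maxn N r.*2.+1)) ?leq_maxl //.
  rewrite /weight -hn (mulrC 2) mulfK ?pnatr_eq0 //; congr (_ + _).
  rewrite (@big_cat_nat _ _ _ r.*2.+1) ?leq_maxr //=.
  rewrite [X in _ + X](_ : _ = 0) ?addr0; last first.
    rewrite big_nat big1 // => m hm.
    by rewrite hX ?XK0 ?mul0r //; lia.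
  rewrite big_nat [RHS]big_nat; apply: eq_bigr => m hm; rewrite hX; last lia.
  by case: m hm.
Qed.

End Necessity.

(** * The Fock space *)

Section Fock.
Variable C : numClosedFieldType.
Variable ferm : nat -> bool.

Definition conf : Type := nat -> nat.
HB.instance Definition _ := Choice.on conf.
Implicit Types (i j k N : nat) (x y : conf).

Definition inc i x : conf := fun j => (x j + (j == i))%N.
Definition dec i x : conf := fun j => (x j - (j == i))%N.

Lemma incK i : cancel (inc i) (dec i).
Proof. by move=> x; apply: funext => j; rewrite /dec /inc addnK. Qed.

Lemma decK i x : (0 < x i)%N -> inc i (dec i x) = x.
Proof.
move=> xi; apply: funext => j; rewrite /dec /inc; case: eqP => [->|_]; last lia.
by rewrite subnK.
Qed.

Lemma inc_comm i j x : inc i (inc j x) = inc j (inc i x).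
Proof. by apply: funext => k; rewrite /inc addnAC. Qed.

Lemma inc_same i x : inc i x i = (x i).+1.
Proof. by rewrite /inc eqxx addn1. Qed.

Lemma inc_other i j x : i != j -> inc i x j = x j.
Proof. by rewrite /inc eq_sym => /negPf->; rewrite addn0. Qed.

Lemma dec_same i x : dec i x i = (x i).-1.
Proof. by rewrite /dec eqxx subn1. Qed.

Lemma dec_other i j x : i != j -> dec i x j = x j.
Proof. by rewrite /dec eq_sym => /negPf->; rewrite subn0. Qed.

(* The parity of [k] in the fermionic amplitude makes the canonical
   anticommutation relations hold on all configurations, so that occupation
   numbers need not be restricted to 0 and 1. *)
Definition amp i k : C := if ferm i then (~~ odd k)%:R else sqrtC k.+1%:R.

(** The Jordan-Wigner exponent: the fermions in the modes before [i]. *)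
Definition jwn i x : nat := if ferm i then (\sum_(j < i | ferm j) x j)%N else 0%N.

Lemma amp_conj i k : (amp i k)^* = amp i k.
Proof.
rewrite /amp; case: ifP => _; first by rewrite rmorph_nat.
by rewrite conj_Creal // ger0_real // sqrtC_ge0 ler0n.
Qed.

Lemma amp_sqr i k : amp i k ^+ 2 = if ferm i then (~~ odd k)%:R else k.+1%:R.
Proof.
rewrite /amp; case: ifP => _; last by rewrite sqrtCK.
by case: odd; rewrite /= ?expr1n ?expr0n.
Qed.

Lemma jwn_inc i j x : jwn j (inc i x) = (jwn j x + [&& ferm i, ferm j & (i < j)])%N.
Proof.
rewrite /jwn andbCA; case: (ferm j) => //=.
rewrite /inc big_split /=; congr (_ + _)%N.
case: (boolP (ferm i && (i < j)%N)) => [/andP[fi ij]|h].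
  rewrite (bigD1 (Ordinal ij)) //= eqxx big1 // => k /andP[_ ki].
  by apply/eqP; rewrite eqb0; apply: contra ki => /eqP ki; apply/eqP/val_inj.
rewrite big1 // => k fk; apply/eqP; rewrite eqb0; apply: contra h => /eqP <-.
by rewrite fk ltn_ord.
Qed.

Lemma jwn_dec i j x : (0 < x i)%N ->
  jwn j x = (jwn j (dec i x) + [&& ferm i, ferm j & (i < j)])%N.
Proof. by move=> /decK xE; rewrite -{1}xE jwn_inc. Qed.

(** Finite support is expressed through nested finite boxes, so that two vectors always share
    one. *)
Definition box N : set conf :=
  [set x | forall k, (x k <= N)%N /\ ((N <= k)%N -> x k = 0%N)].

Lemma box_finite N : finite_set (box N).
Proof.
pose g (h : {ffun 'I_N -> 'I_N.+1}) : conf :=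
  fun k => if insub k is Some o then h o : nat else 0%N.
apply: (@sub_finite_set _ _ (range g)); last exact/finite_image/finite_finset.
move=> x bx; exists [ffun o : 'I_N => inord (x o)] => //.
apply: funext => k; rewrite /g; case: insubP => [o _ <-|].
  by rewrite ffunE inordK // ltnS; case: (bx o).
by rewrite -leqNgt => Nk; case: (bx k) => _ /(_ Nk).
Qed.

Lemma box_le N N' : (N <= N')%N -> box N `<=` box N'.
Proof.
move=> NN x bx k; case: (bx k) => h1 h2; split; first exact: leq_trans h1 NN.
by move=> h; apply: h2; apply: leq_trans NN h.
Qed.

Definition focked : {pred conf -> C^o} := fun u =>
  `[< exists N, forall x, ~ box N x -> u x = 0 >].

Lemma focked_submod : submod_closed focked.
Proof.
split; first by apply/asboolP; exists 0%N.
move=> a u w /asboolP[N hu] /asboolP[K hw]; apply/asboolP; exists (maxn N K) => x bx.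
rewrite [LHS](_ : _ = a * u x + w x) // hu ?hw ?mulr0 ?addr0 // => b;
  by apply: bx; move: x b; apply: box_le; rewrite ?leq_maxl ?leq_maxr.
Qed.

HB.instance Definition _ :=
  GRing.isSubmodClosed.Build C (conf -> C^o) focked focked_submod.

Record fock := Fock { fockval :> conf -> C^o; fockvalP : focked fockval }.
HB.instance Definition _ := [isSub for fockval].
HB.instance Definition _ := [Choice of fock by <:].
HB.instance Definition _ := [SubChoice_isSubLmodule of fock by <:].

Implicit Types (u w : fock).

Lemma fockP u w : (forall x, u x = w x) -> u = w.
Proof. by move=> uw; apply/val_inj/funext. Qed.

Lemma fockDE u w x : (u + w) x = u x + w x. Proof. by []. Qed.
Lemma fockZE (a : C) u x : (a *: u) x = a * u x. Proof. by []. Qed.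
Lemma fock0E x : (0 : fock) x = 0. Proof. by []. Qed.

Lemma ann_focked i u :
  focked (fun x => (-1) ^+ jwn i x * amp i (x i) * u (inc i x)).
Proof.
have /asboolP[N hu] := fockvalP u; apply/asboolP; exists N => x bx.
rewrite hu ?mulr0 // => b; apply: bx => k; case: (b k); rewrite /inc => h1 h2; split; lia.
Qed.
(** Vectors are coefficient functions on configurations, so annihilation reads the coefficient at
    [inc i x] and creation the one at [dec i x]. *)
Definition ann i u : fock := Fock (ann_focked i u).

Lemma cre_focked i u :
  focked (fun x => if (0 < x i)%N
                   then (-1) ^+ jwn i x * amp i (x i).-1 * u (dec i x) else 0).
Proof.
have /asboolP[N hu] := fockvalP u; apply/asboolP; exists (N + i).+1 => x bx.
case: ifP => // xi; rewrite hu ?mulr0 // => b; apply: bx => k; case: (b k).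
rewrite /dec; case: (k =P i) => [->|_] h1 h2; split; lia.
Qed.
Definition cre i u : fock := Fock (cre_focked i u).

Lemma annE i u x : ann i u x = (-1) ^+ jwn i x * amp i (x i) * u (inc i x).
Proof. by []. Qed.

Lemma creE i u x : cre i u x =
  if (0 < x i)%N then (-1) ^+ jwn i x * amp i (x i).-1 * u (dec i x) else 0.
Proof. by []. Qed.

Lemma ann_linear i : linear (ann i).
Proof. by move=> a u w; apply: fockP => x; rewrite fockDE fockZE !annE fockDE fockZE; ring. Qed.
Lemma cre_linear i : linear (cre i).
Proof.
move=> a u w; apply: fockP => x; rewrite fockDE fockZE !creE; case: ifP => _.
  by rewrite fockDE fockZE; ring.
by rewrite mulr0 addr0.
Qed.

HB.instance Definition _ i := GRing.isLinear.Build C fock fock _ (ann i) (ann_linear i).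
HB.instance Definition _ i := GRing.isLinear.Build C fock fock _ (cre i) (cre_linear i).

Definition eps i j : C := (-1) ^+ (ferm i && ferm j).

Lemma ann_ann i j u : ann i (ann j u) = eps i j *: ann j (ann i u).
Proof.
have [->|ij] := eqVneq i j.
  rewrite /eps andbb; case fj: (ferm j); last by rewrite expr0 scale1r.
  suff -> : ann j (ann j u) = 0 by rewrite scaler0.
  apply: fockP => x; rewrite fock0E /= inc_same /amp fj /=.
  by case: odd; rewrite /= ?(mul0r, mulr0).
apply: fockP => x; rewrite fockZE /= !jwn_inc (inc_other _ ij) inc_other; last by rewrite eq_sym.
rewrite inc_comm /eps.
case: (ltngtP i j) ij => // ij _; case: (ferm i); case: (ferm j); rewrite /= ?addn0 ?addn1 ?exprS ?expr1; ring.
Qed.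

(** On one mode this is the relation between the squares of consecutive amplitudes: k + 2 = (k + 1)
    + 1 for bosons, and the alternation of parity for fermions. On two modes only the Jordan-Wigner
    signs matter. *)
Lemma ann_cre i j u : ann i (cre j u) = eps i j *: cre j (ann i u) + (i == j)%:R *: u.
Proof.
apply: fockP => x; rewrite fockDE !fockZE /=.
have [->|ij] := eqVneq i j.
  rewrite inc_same /= incK jwn_inc ltnn !andbF addn0 /eps andbb.
  case x0 : (x j) => [|k] /=.
    rewrite mulr0 add0r mul1r.
    transitivity (((-1) ^+ jwn j x) ^+ 2 * (amp j 0 ^+ 2) * u x); first by ring.
    by rewrite sqrr_sign amp_sqr /=; case: ferm; rewrite !mul1r.
  rewrite dec_same x0 /= decK ?x0 // [in RHS](@jwn_dec j j) ?x0 // ltnn !andbF addn0.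
  transitivity (((-1) ^+ jwn j x) ^+ 2 * (amp j k.+1 ^+ 2) * u x); first by ring.
  transitivity (((-1) ^+ ferm j * (((-1) ^+ jwn j x) ^+ 2 * (amp j k ^+ 2)) + 1) * u x); last first.
    rewrite [in LHS](@jwn_dec j j x) ?x0 // ltnn !andbF addn0; ring.
  rewrite sqrr_sign !amp_sqr; congr (_ * _); case: (ferm j) => /=.
    by case: odd; rewrite /= expr1; ring.
  by rewrite expr0 -(natr1 k.+1); ring.
rewrite (inc_other _ ij) mul0r addr0; case: ifP => xj; last by rewrite !mulr0.
have -> : dec j (inc i x) = inc i (dec j x).
  by rewrite -[in LHS](decK xj) inc_comm incK.
rewrite jwn_inc (jwn_dec i xj) dec_other; last by rewrite eq_sym.
rewrite /eps.
case: (ltngtP i j) ij => // ij _; case: (ferm i); case: (ferm j); rewrite /= ?addn0 ?addn1 ?exprS ?expr1; ring.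
Qed.

Definition fdot u w : C := \sum_(x \in [set: conf]) u x * (w x)^*.

Lemma fdot_box u w N : (forall x, ~ box N x -> u x = 0) ->
  fdot u w = \sum_(x \in box N) u x * (w x)^*.
Proof.
by move=> hu; apply/esym/fsbig_widen => // x [_ /hu]; rewrite /= => ->; rewrite mul0r.
Qed.

Lemma fdot_linear w : linear_for *%R (fdot^~ w).
Proof.
move=> a u u'; have /asboolP[N hu] := fockvalP u; have /asboolP[K hu'] := fockvalP u'.
have h1 x : ~ box (maxn N K) x -> u x = 0.
  by move=> b; apply: hu => b'; apply: b; move: x b'; apply: box_le; rewrite leq_maxl.
have h2 x : ~ box (maxn N K) x -> u' x = 0.
  by move=> b; apply: hu' => b'; apply: b; move: x b'; apply: box_le; rewrite leq_maxr.
rewrite (fdot_box _ h1) (fdot_box _ h2) (@fdot_box _ _ (maxn N K)); last first.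
  by move=> x b; rewrite fockDE fockZE h1 // h2 // mulr0 addr0.
rewrite mulr_fsumr -fsbig_split; last exact: box_finite.
by apply: eq_fsbigr => x _; rewrite fockDE fockZE mulrDl mulrA.
Qed.

Lemma fdot_herm u w : fdot u w = (-1) ^+ false * (fdot w u)^*.
Proof.
rewrite expr0 mul1r; have /asboolP[N hu] := fockvalP u; have /asboolP[K hw] := fockvalP w.
have h1 x : ~ box (maxn N K) x -> u x = 0.
  by move=> b; apply: hu => b'; apply: b; move: x b'; apply: box_le; rewrite leq_maxl.
have h2 x : ~ box (maxn N K) x -> w x = 0.
  by move=> b; apply: hw => b'; apply: b; move: x b'; apply: box_le; rewrite leq_maxr.
rewrite (fdot_box _ h1) (fdot_box _ h2) !fsbig_finite ?rmorph_sum; try exact: box_finite.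
by apply: eq_bigr => x _; rewrite rmorphM /= conjCK mulrC.
Qed.

Lemma fdot_pos u : u != 0 -> 0 < fdot u u.
Proof.
move=> u0; have [x ux] : exists x, u x != 0.
  by apply: contrapT => h; move/eqP: u0; apply; apply: fockP => x; rewrite fock0E;
    apply/eqP/negPn/negP => ux; apply: h; exists x.
have /asboolP[N hu] := fockvalP u.
have bx : box N x by apply: contrapT => /hu/eqP; rewrite (negPf ux).
rewrite (fdot_box _ hu) fsbig_finite; last exact: box_finite.
rewrite (bigD1_seq x) /=; [|by rewrite in_fset_set ?inE //; exact: box_finite|exact: finmap.fset_uniq].
apply: ltr_pwDl; first by rewrite -normCK exprn_gt0 // normr_gt0.
by apply: sumr_ge0 => y _; rewrite -normCK exprn_ge0.
Qed.

Lemma fdot_linearr u : linear_for (Num.conj \; *%R) (fdot u).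
Proof.
move=> a w w'; rewrite fdot_herm fdot_linear [fdot u w]fdot_herm [fdot u w']fdot_herm.
by rewrite !expr0 !mul1r rmorphD rmorphM.
Qed.

HB.instance Definition _ := bilinear_isBilinear.Build C fock fock C *%R
  (Num.conj \; *%R) fdot (fdot_linear, fdot_linearr).
HB.instance Definition _ := isHermitianSesquilinear.Build C fock false Num.conj fdot fdot_herm.
HB.instance Definition _ := isDotProduct.Build C fock fdot fdot_pos.

Lemma fdot_cre i u w : fdot (cre i u) w = fdot u (ann i w).
Proof.
transitivity (\sum_(x \in [set inc i x | x in [set: conf]]) cre i u x * (w x)^*).
  apply/esym/fsbig_widen => // x [_ nx] /=; case: ifP => [xi|]; last by rewrite mul0r.
  by exfalso; apply: nx; exists (dec i x) => //; rewrite decK.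
rewrite fsbig_image; last by move=> x y _ _; apply: (can_inj (incK i)).
apply: eq_fsbigr => x _; rewrite /= inc_same /= incK jwn_inc ltnn !andbF addn0.
by rewrite !rmorphM /= amp_conj rmorphXn rmorphN1 /=; ring.
Qed.

Lemma fdot_ann i u w : fdot (ann i u) w = fdot u (cre i w).
Proof. by rewrite fdot_herm -fdot_cre -fdot_herm. Qed.

(** Adjoint to [ann_ann]: the difference of the two sides is orthogonal to every vector, hence to
    itself. *)
Lemma cre_cre i j u : cre i (cre j u) = eps i j *: cre j (cre i u).
Proof.
apply/eqP; rewrite -subr_eq0; apply/negPn/negP => h.
have := fdot_pos h; set z := (X in fdot _ X).
suff -> : fdot (cre i (cre j u) - eps i j *: cre j (cre i u)) z = 0 by rewrite ltxx.
rewrite addrC -scaleNr fdot_linear !fdot_cre [ann i (ann j z)]ann_ann.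
rewrite [fdot u (_ *: _)]linearZr_LR /= /eps rmorphXn rmorphN1 /= mulrA mulNr -expr2.
by rewrite sqrr_sign mulN1r addNr.
Qed.

Lemma ann_level u : exists N : nat, forall k, (N <= k)%N -> ann k u = 0.
Proof.
have /asboolP[N hu] := fockvalP u; exists N => k Nk; apply: fockP => x.
rewrite fock0E /= hu ?mulr0 // => b; case: (b k) => _ /(_ Nk).
by rewrite inc_same.
Qed.

Lemma vac_focked : focked (fun x => (x == (fun=> 0%N))%:R : C).
Proof.
apply/asboolP; exists 0%N => x bx; rewrite (_ : (x == _) = false) //.
by apply/negP => /eqP xE; apply: bx => k; rewrite xE.
Qed.
Definition vac : fock := Fock vac_focked.

Lemma vac_neq0 : vac != 0.
Proof.
apply/eqP => /(congr1 (fun u : fock => u (fun=> 0%N))) /eqP.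
by rewrite fock0E /= eqxx oner_eq0.
Qed.

Lemma ann_vac k : ann k vac = 0.
Proof.
apply: fockP => x; rewrite fock0E /= (_ : (inc k x == _) = false) ?mulr0 //.
by apply/negP => /eqP/(congr1 (fun x : conf => x k)); rewrite inc_same.
Qed.

End Fock.

(** * The quadratic action on the Fock space *)

Section Fields.
Variables (C : numClosedFieldType) (n : nat).
Implicit Types (a b : 'I_n) (p q r s : int) (m : nat).

(* mode [m * n + a] is the [a]-th copy of the half-integer [m / 2], which is
   fermionic exactly when [m] is even *)
Definition mferm (k : nat) : bool := ~~ odd (k %/ n).
Definition fockL : lmodType C := fock C.
Local Notation F := fockL.
Definition mode a m : nat := (m * n + a)%N.
Implicit Types (u w : F).

Lemma mode_ferm a m : mferm (mode a m) = ~~ odd m.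
Proof.
by rewrite /mferm /mode divnMDl ?divn_small ?addn0 // (leq_ltn_trans _ (ltn_ord a)).
Qed.

Lemma mode_eq a b m m' : (mode a m == mode b m') = (a == b) && (m == m').
Proof.
apply/eqP/andP => [|[/eqP-> /eqP->] //]; rewrite /mode => h.
have n0 : (0 < n)%N by apply: leq_ltn_trans (ltn_ord a).
have := congr1 (divn^~ n) h; have := congr1 (modn^~ n) h.
rewrite /= !modnMDl !modn_small // !divnMDl // !divn_small // !addn0 => hab ->.
by split=> //; apply/eqP/val_inj.
Qed.

(** Reversing the copy on annihilators makes phi^{a'}_{-p} the adjoint of phi^a_p, and every term of
    [quad p (- p)] then has a contraction. *)
Definition phi a p : F -> F :=
  if 0 < p then @cre C mferm (mode a `|p|%N) else @ann C mferm (mode (rev_ord a) `|p|%N).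

Lemma phi_linear a p : linear (phi a p).
Proof. by rewrite /phi; case: ifP => _; [apply: cre_linear|apply: ann_linear]. Qed.
HB.instance Definition _ a p := GRing.isLinear.Build C F F _ (phi a p) (phi_linear a p).

Definition peps p q : C := (-1) ^+ (~~ hodd p && ~~ hodd q).
(** The supercommutator of paired fields of indices p and -p: 1 for fermions, minus the sign of p
    for bosons. *)
Definition gam p : C := (-1) ^+ hodd p * vsgn C p.

Lemma phi_phi a b p q u : p != 0 -> q != 0 ->
  phi a p (phi b q u) = peps p q *: phi b q (phi a p u)
    + (((p == - q) && (a == rev_ord b))%:R * gam p) *: u.
Proof.
move=> p0 q0; rewrite /phi /gam /peps.
have epsE c d m m' : eps C mferm (mode c m) (mode d m') = (-1) ^+ (~~ odd m && ~~ odd m').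
  by rewrite /eps !mode_ferm.
have [pp|pn] := ltrP 0 p; have [qp|qn] := ltrP 0 q.
- rewrite cre_cre epsE (_ : (p == - q) = false) ?mul0r ?scale0r ?addr0 //; lia.
- rewrite [in RHS]ann_cre scalerDr scalerA epsE.
  rewrite /hodd [_ && ~~ odd `|p|%N]andbC -expr2 sqrr_sign scale1r -addrA scalerA -scalerDl.
  rewrite [X in _ = _ + X](_ : _ = 0) ?addr0 //.
  rewrite mode_eq (eq_sym _ a).
  rewrite [X in X *: _](_ : _ = 0) ?scale0r //.
  rewrite (_ : (`|q| == `|p|)%N = (p == - q)); last lia.
  rewrite [_ && (p == _)]andbC; case: (p =P - q) => [pq|_]; last by rewrite mulr0 mul0r addr0.
  case: (a =P _) => [_|_]; last by rewrite mulr0 mul0r addr0.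
  rewrite (_ : odd `|q|%N = odd `|p|%N) /vsgn /hodd; last lia.
  by case: (odd `|p|); rewrite ?(gtr0_sgz pp) ?expr0 ?expr1 /= ?expr0 ?expr1; ring.
- rewrite ann_cre epsE; congr (_ + _ *: _).
  rewrite mode_eq; rewrite -(inj_eq rev_ord_inj) rev_ordK.
  rewrite (_ : (`|p| == `|q|)%N = (p == - q)); last lia.
  have p1 : p < 0 by rewrite lt_neqAle p0.
  rewrite andbC; case: (p =P - q) => [pq|_]; last by rewrite mul0r.
  case: (a =P _) => [_|_]; last by rewrite mul0r.
  by rewrite /vsgn /hodd; case: (odd `|p|); rewrite ?(ltr0_sgz p1) /= ?expr0 ?expr1; ring.
- rewrite ann_ann epsE (_ : (p == - q) = false) ?mul0r ?scale0r ?addr0 //; lia.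
Qed.

Lemma phi_adj a p u w : p != 0 -> fdot (phi a p u) w = fdot u (phi (rev_ord a) (- p) w).
Proof.
move=> p0; rewrite /phi oppr_gt0 abszN; have [pp|pn] := ltrP 0 p.
  by rewrite (_ : (p < 0) = false) ?rev_ordK ?fdot_cre //; lia.
by rewrite (_ : p < 0) ?fdot_ann //; lia.
Qed.

Definition quad p q u : F := \sum_a phi a p (phi (rev_ord a) q u).

Local Notation Q := quad.

Lemma quad_linear p q : linear (Q p q).
Proof.
move=> k u w; rewrite /quad scaler_sumr -big_split; apply: eq_bigr => a _.
by rewrite !linearP.
Qed.
HB.instance Definition _ p q := GRing.isLinear.Build C F F _ (quad p q) (quad_linear p q).

Lemma quad_swap p q u : p != 0 -> q != 0 ->
  Q p q u = peps p q *: Q q p u + ((p == - q)%:R * gam p * n%:R) *: u.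
Proof.
move=> p0 q0; rewrite {1}/quad.
under eq_bigr => a _ do rewrite phi_phi // rev_ordK eqxx andbT.
rewrite big_split /= sumr_const card_ord; congr (_ + _); last first.
  by rewrite -scaler_nat scalerA mulrC.
rewrite -scaler_sumr; congr (_ *: _).
rewrite /quad (reindex_inj rev_ord_inj) /=; apply: eq_bigr => a _.
by rewrite rev_ordK.
Qed.

Lemma quad_adj p q u w : p != 0 -> q != 0 -> fdot (Q p q u) w = fdot u (Q (- q) (- p) w).
Proof.
move=> p0 q0; rewrite /quad linear_sumlz linear_sumr; apply: eq_bigr => a _.
transitivity (fdot (phi a p (phi (rev_ord a) q u)) w); first by [].
by rewrite (phi_adj _ _ _ p0) (phi_adj _ _ _ q0) rev_ordK.
Qed.

Lemma quad_phi b p q r u : p != 0 -> q != 0 -> r != 0 ->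
  Q p q (phi b r u) = (peps p r * peps q r) *: phi b r (Q p q u)
    + ((q == - r)%:R * gam q) *: phi b p u
    + ((p == - r)%:R * gam p * peps q r) *: phi b q u.
Proof.
move=> p0 q0 r0; rewrite /quad linear_sum scaler_sumr.
have step a : phi a p (phi (rev_ord a) q (phi b r u)) =
  (peps p r * peps q r) *: phi b r (phi a p (phi (rev_ord a) q u))
  + (((q == - r) && (a == b))%:R * gam q) *: phi a p u
  + (((p == - r) && (a == rev_ord b))%:R * gam p * peps q r) *: phi (rev_ord a) q u.
  rewrite (phi_phi (rev_ord a) b) // linearP /= [phi a p (_ *: _)]linearZ /=.
  rewrite (phi_phi a b) // scalerDr !scalerA (inj_eq rev_ord_inj).
  by rewrite (mulrC (peps q r)) (mulrC (peps q r) (_ * _)) addrAC.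
under eq_bigr => a _ do rewrite step.
rewrite !big_split /=; congr (_ + _ + _).
  rewrite (bigD1 b) //= eqxx andbT big1 ?addr0 // => a /negPf ab.
  by rewrite ab andbF mul0r scale0r.
rewrite (bigD1 (rev_ord b)) //= eqxx andbT rev_ordK big1 ?addr0 // => a /negPf ab.
by rewrite ab andbF !mul0r scale0r.
Qed.

End Fields.

Definition ir (N : nat) : seq int :=
  [seq p <- [seq (k%:Z - N%:Z) | k <- iota 0 N.*2.+1] | p != 0].

Lemma mem_ir N p : (p \in ir N) = (p != 0) && (`|p| <= N)%N.
Proof.
rewrite mem_filter; congr (_ && _); apply/mapP/idP => [[k]|h].
  by rewrite mem_iota => hk ->; lia.
by exists `|(p + N%:Z)%R|%N; rewrite ?mem_iota; lia.
Qed.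

Lemma ir_uniq N : uniq (ir N).
Proof.
apply: filter_uniq; rewrite map_inj_uniq ?iota_uniq // => k l; lia.
Qed.

Lemma sum_irN (V : zmodType) N (G : int -> V) :
  \sum_(p <- ir N) G p = \sum_(p <- ir N) G (- p).
Proof.
rewrite -(big_map (fun p : int => - p) xpredT G); apply/perm_big/uniq_perm.
- exact: ir_uniq.
- rewrite map_inj_uniq ?ir_uniq //; exact: oppr_inj.
move=> p; apply/idP/mapP => [h|[q h ->]]; last by move: h; rewrite !mem_ir; lia.
by exists (- p); [move: h; rewrite !mem_ir; lia|rewrite opprK].
Qed.

Lemma sum_ir_delta (C : numClosedFieldType) (V : lmodType C) N r (G : int -> V) :
  r \in ir N -> \sum_(p <- ir N) (p == r)%:R *: G p = G r.
Proof.
move=> hr; rewrite (bigD1_seq r) ?ir_uniq //= eqxx scale1r big1 ?addr0 //.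
by move=> p /negPf->; rewrite scale0r.
Qed.

Lemma sum_ir_sub (V : zmodType) N N' (G : int -> V) : (N <= N')%N ->
  (forall p, p != 0 -> (N < `|p|)%N -> G p = 0) ->
  \sum_(p <- ir N') G p = \sum_(p <- ir N) G p.
Proof.
move=> NN hG; rewrite (bigID (fun p => `|p| <= N)%N) /=.
rewrite [X in _ + X](_ : _ = 0) ?addr0; last first.
  rewrite big_seq_cond big1 // => p; rewrite mem_ir => /andP[/andP[p0 _] h].
  by apply: hG => //; lia.
rewrite -big_filter; apply/perm_big/uniq_perm; [exact/filter_uniq/ir_uniq|exact: ir_uniq|].
by move=> p; rewrite mem_filter !mem_ir; lia.
Qed.

(** * The quadratic action at a cut-off *)

Section QuadraticOperators.
Variables (C : numClosedFieldType) (n : nat).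
Local Notation F := (fockL C).
Local Notation Q := (@quad C n).
Local Notation phi := (@phi C n).
Implicit Types (a b : 'I_n) (p q r s : int) (u w : F) (A B : int -> int -> C).

(** Under the form, e_{-q} is dual to e_q up to [vsgn q]. The factor 1/2 is there because a skew
    matrix produces each operator twice, from (p, q) and from (-q, -p). *)
Definition rho1 N A u : F :=
  2^-1 *: \sum_(p <- ir N) \sum_(q <- ir N) (A p q * vsgn C q) *: Q p (- q) u.

Definition sgskew A := forall p q, p != 0 -> q != 0 ->
  A p q = - (sg C p q * A (- q) (- p)).
Definition parityof (e : bool) A := forall p q, A p q != 0 -> hodd p (+) hodd q = e.

Lemma rho1_linear N A : linear (rho1 N A).
Proof.
move=> k u w; rewrite /rho1 !scaler_sumr -big_split; apply: eq_bigr => p _ /=.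
rewrite !scaler_sumr -big_split; apply: eq_bigr => q _ /=.
rewrite linearP /= ![_ *: (_ + _)]scalerDr [_ *: (k *: Q _ _ _)]scalerA.
apply: f_equal2 => //; rewrite [LHS]scalerA !scalerA.
by apply: f_equal2 => //; ring.
Qed.
HB.instance Definition _ N A := GRing.isLinear.Build C F F _ (rho1 N A) (rho1_linear N A).

Lemma rho1_linearl N k A B u :
  rho1 N (fun p q => k * A p q + B p q) u = k *: rho1 N A u + rho1 N B u.
Proof.
rewrite /rho1 !scaler_sumr -big_split; apply: eq_bigr => p _ /=.
rewrite !scaler_sumr -big_split; apply: eq_bigr => q _ /=.
by rewrite !scalerA -scalerDl; congr (_ *: _); ring.
Qed.

(** The fields of one copy transform like the natural module V. Contractions with the first and the
    second factor give equal sums because [A] is skew, and the two halves add up to 1. *)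
Lemma rho1_phi N e A b r u : parityof e A -> sgskew A -> r \in ir N ->
  rho1 N A (phi b r u) = (-1) ^+ (e && ~~ hodd r) *: phi b r (rho1 N A u)
    + \sum_(p <- ir N) A p r *: phi b p u.
Proof.
move=> pA sA hr; have r0 : r != 0 by move: hr; rewrite mem_ir => /andP[].
rewrite /rho1.
transitivity (2^-1 *: \sum_(p <- ir N) \sum_(q <- ir N)
  ((-1) ^+ (e && ~~ hodd r) *: phi b r ((A p q * vsgn C q) *: Q p (- q) u)
   + (q == r)%:R *: (A p r *: phi b p u)
   + (p == - r)%:R *: (A (- q) r *: phi b (- q) u))).
  congr (_ *: _); rewrite big_seq [RHS]big_seq; apply: eq_bigr => p.
  rewrite mem_ir => /andP[p0 _]; rewrite big_seq [RHS]big_seq; apply: eq_bigr => q.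
  rewrite mem_ir => /andP[q0 _]; rewrite quad_phi ?oppr_eq0 // eqr_opp.
  rewrite ![_ *: (_ + _)]scalerDr; apply: f_equal2; first apply: f_equal2.
  - rewrite [phi b r (_ *: _)]linearZ /=.
    rewrite [LHS]scalerA [RHS]scalerA; congr (_ *: _).
    have [->|/pA he] := eqVneq (A p q) 0; first by rewrite !(mul0r, mulr0).
    rewrite /peps hoddN -he; case: (hodd p); case: (hodd q); case: (hodd r);
      rewrite /= ?(expr0, expr1); ring.
  - rewrite [LHS]scalerA [RHS]scalerA.
    case: (q =P r) => [->|_]; last by rewrite !(mul0r, mulr0) !scale0r.
    congr (_ *: _); rewrite /gam vsgnN // !hoddN !mul1r.
    transitivity (A p r * ((-1) ^+ hodd r) ^+ 2 * (vsgn C r * vsgn C r)); first by ring.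
    by rewrite sqrr_sign vsgn2 // !mulr1.
  rewrite [LHS]scalerA [RHS]scalerA.
  case: (p =P - r) => [->|_]; last by rewrite !(mul0r, mulr0) !scale0r.
  congr (_ *: _); rewrite sA ?oppr_eq0 // opprK !mul1r /gam /sg /peps vsgnN // !hoddN.
  transitivity (- ((-1) ^+ ((hodd r (+) hodd q) && hodd q) * (-1) ^+ (~~ hodd q && ~~ hodd r)
     * ((-1) ^+ hodd r)) * (vsgn C r * vsgn C r * ((-1) ^+ hodd r)^+2) * (vsgn C q * vsgn C q) * A (- q) r); first by ring.
  rewrite !vsgn2 // sqrr_sign !mulr1.
  by case: (hodd q); case: (hodd r); rewrite /= ?(expr0, expr1); ring.
under eq_bigr => p _ do rewrite !big_split /=.
rewrite !big_split /= !scalerDr -addrA; congr (_ + _).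
  rewrite [phi b r (2^-1 *: _)]linearZ /= [RHS]scalerA [_ * 2^-1]mulrC -scalerA.
  congr (_ *: _); rewrite linear_sum /=.
  by rewrite scaler_sumr; apply: eq_bigr => p _; rewrite linear_sum scaler_sumr.
have -> : \sum_(p <- ir N) \sum_(q <- ir N) (q == r)%:R *: (A p r *: phi b p u) =
    \sum_(p <- ir N) A p r *: phi b p u.
  by apply: eq_bigr => p _; rewrite (sum_ir_delta (fun=> _) hr).
have hr' : - r \in ir N by move: hr; rewrite !mem_ir; lia.
rewrite exchange_big /= [X in _ + _ *: X](_ : _ = \sum_(p <- ir N) A p r *: phi b p u).
  by rewrite -scalerDl (_ : 2^-1 + 2^-1 = 1) ?scale1r //; field.
rewrite [RHS]sum_irN; apply: eq_bigr => q _.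
by rewrite (sum_ir_delta (fun=> _) hr').
Qed.

(** Commute the first operator past both fields of each quadratic term of the second. All sums run
    over the cut-off, so no central term appears. *)
Lemma rho1_bracket N e f A B u : parityof e A -> sgskew A -> parityof f B ->
  rho1 N A (rho1 N B u) = (-1) ^+ (e && f) *: rho1 N B (rho1 N A u)
    + rho1 N (fun p s => \sum_(r <- ir N) (A p r * B r s - (-1) ^+ (e && f) * (B p r * A r s))) u.
Proof.
move=> pA sA pB.
transitivity (2^-1 *: \sum_(r <- ir N) \sum_(s <- ir N)
   ((-1) ^+ (e && f) *: ((B r s * vsgn C s) *: Q r (- s) (rho1 N A u))
    + (\sum_(p <- ir N) ((- (-1) ^+ (e && f) * B r s * A s p) * vsgn C p) *: Q r (- p) u
       + \sum_(p <- ir N) ((A p r * B r s) * vsgn C s) *: Q p (- s) u))).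
  rewrite {2}/rho1 linearZ linear_sum; congr (_ *: _).
  rewrite big_seq [RHS]big_seq; apply: eq_bigr => r hr.
  have r0 : r != 0 by move: hr; rewrite mem_ir => /andP[].
  rewrite linear_sum big_seq [RHS]big_seq; apply: eq_bigr => s hs.
  have s0 : s != 0 by move: hs; rewrite mem_ir => /andP[].
  have hs' : - s \in ir N by move: hs; rewrite !mem_ir; lia.
  rewrite linearZ /= /quad linear_sum /=.
  under eq_bigr => a _ do rewrite (rho1_phi _ _ pA sA hr) (rho1_phi _ _ pA sA hs') linearP linear_sum /=.
  rewrite big_split /= scalerDr addrA; congr (_ + _).
    rewrite [LHS]scaler_sumr; under [LHS]eq_bigr => a _ do rewrite !scalerDr.
    rewrite big_split /=; congr (_ + _).
      rewrite !scaler_sumr; apply: eq_bigr => a _; rewrite !scalerA; congr (_ *: _).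
      have [->|/pB <-] := eqVneq (B r s) 0; first by rewrite !(mul0r, mulr0).
      by rewrite hoddN; case: e pA; case: (hodd r); case: (hodd s); rewrite /= ?(expr0, expr1) => _; ring.
    under [LHS]eq_bigr => a _ do rewrite !scaler_sumr.
    rewrite exchange_big /= sum_irN big_seq [RHS]big_seq; apply: eq_bigr => p.
    rewrite mem_ir => /andP[p0 _].
    rewrite [RHS]scaler_sumr; apply: eq_bigr => a _.
    rewrite [phi _ r (_ *: _)]linearZ /= !scalerA; congr (_ *: _).
    have [->|nB] := eqVneq (B r s) 0; first by rewrite !(mul0r, mulr0).
    rewrite sA ?oppr_eq0 // !opprK.
    have [->|nA] := eqVneq (A s p) 0; first by rewrite !(mul0r, mulr0, oppr0).
    rewrite -(pA _ _ nA) -(pB _ _ nB) /sg !vsgnN // !hoddN.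
    transitivity (- ((-1) ^+ ((hodd s (+) hodd p) && ~~ hodd r) * (-1) ^+ ((hodd p (+) hodd s) && hodd s)
      * (-1) ^+ hodd s * (-1) ^+ hodd p) * (vsgn C s * vsgn C s) * (B r s * A s p * vsgn C p)); first by ring.
    rewrite vsgn2 // mulr1.
    by case: (hodd s); case: (hodd r); case: (hodd p); rewrite /= ?(expr0, expr1); ring.
  rewrite [LHS]scaler_sumr; under [LHS]eq_bigr => a _ do rewrite scaler_sumr.
  rewrite exchange_big /=; apply: eq_bigr => p _.
  rewrite [RHS]scaler_sumr; apply: eq_bigr => a _; rewrite scalerA; congr (_ *: _); ring.
under eq_bigr => r _ do rewrite !big_split /=.
rewrite !big_split /= scalerDr; congr (_ + _).
  rewrite [rho1 N B _]/rho1 [RHS]scalerA [_ * 2^-1]mulrC -scalerA; congr (_ *: _).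
  by rewrite scaler_sumr; apply: eq_bigr => r _; rewrite scaler_sumr.
rewrite /rho1; congr (_ *: _).
have -> : \sum_(r <- ir N) \sum_(s <- ir N) \sum_(p <- ir N)
    ((- (-1) ^+ (e && f) * B r s * A s p) * vsgn C p) *: Q r (- p) u =
  \sum_(p <- ir N) \sum_(s <- ir N) \sum_(r <- ir N)
    ((- (-1) ^+ (e && f) * B p r * A r s) * vsgn C s) *: Q p (- s) u.
  by apply: eq_bigr => p _; rewrite exchange_big.
have -> : \sum_(r <- ir N) \sum_(s <- ir N) \sum_(p <- ir N)
    ((A p r * B r s) * vsgn C s) *: Q p (- s) u =
  \sum_(p <- ir N) \sum_(s <- ir N) \sum_(r <- ir N)
    ((A p r * B r s) * vsgn C s) *: Q p (- s) u.
  under eq_bigr => r _ do rewrite exchange_big.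
  by rewrite exchange_big /=; apply: eq_bigr => p _; rewrite exchange_big.
rewrite -big_split; apply: eq_bigr => p _ /=; rewrite -big_split; apply: eq_bigr => s _ /=.
rewrite -big_split /= mulr_suml scaler_suml; apply: eq_bigr => r _ /=.
by rewrite -scalerDl; congr (_ *: _); ring.
Qed.

Lemma rho1_adj N A B u w :
  (forall p q, p != 0 -> q != 0 -> B q p * vsgn C p = (A p q)^* * vsgn C q) ->
  fdot (rho1 N A u) w = fdot u (rho1 N B w).
Proof.
move=> hB; rewrite /rho1 linearZl_LR linearZr_LR /= (_ : (2^-1)^* = 2^-1); last first.
  by rewrite fmorphV rmorph_nat.
congr (_ * _); rewrite linear_sumlz [in RHS]exchange_big linear_sumr.
rewrite big_seq [RHS]big_seq; apply: eq_bigr => p; rewrite mem_ir => /andP[p0 _].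
rewrite linear_sumlz linear_sumr big_seq [RHS]big_seq; apply: eq_bigr => q.
rewrite mem_ir => /andP[q0 _].
transitivity (fdot ((A p q * vsgn C q) *: Q p (- q) u) w); first by [].
rewrite linearZl_LR /= quad_adj ?oppr_eq0 // opprK hB // linearZr_LR /= rmorphM /= conjCK.
by congr (_ * _ * _); rewrite /vsgn; case: hodd; rewrite ?rmorph1 ?rmorph_int.
Qed.

End QuadraticOperators.

(** * Normal ordering and removal of the cut-off *)

Section FockModule.
Variables (C : numClosedFieldType) (n : nat).
Local Notation F := (fockL C).
Local Notation Q := (@quad C n).
Local Notation phi := (@phi C n).
Local Notation ann := (@ann C (mferm n)).
Local Notation rho1 := (@rho1 C n).
Implicit Types (a b : 'I_n) (p q r s : int) (u w : F) (N K W : nat).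
Implicit Types (A B : int -> int -> C).

(* the normally ordered form of [vsgn q *: quad p (- q)] *)
Definition nquad p q u : F :=
  if 0 < q then vsgn C q *: Q p (- q) u else (vsgn C q * peps C p q) *: Q (- q) p u.

Local Notation T := nquad.

Lemma quad_nquad p q u : p != 0 -> q != 0 -> vsgn C q *: Q p (- q) u =
  T p q u + (((p == q) && (p < 0))%:R * (-1) ^+ hodd p * n%:R) *: u.
Proof.
move=> p0 q0; rewrite /nquad; have [qp|qn] := ltrP 0 q.
  rewrite (_ : (p == q) && (p < 0) = false) ?mul0r ?scale0r ?addr0 //.
  by apply/negP => /andP[/eqP-> ?]; lia.
have q1 : - q != 0 by rewrite oppr_eq0.
rewrite (@quad_swap C n p (- q) u p0 q1) opprK scalerDr; apply: f_equal2.
  by rewrite [LHS]scalerA /peps hoddN.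
rewrite [LHS]scalerA; congr (_ *: _).
case: (p =P q) => [->|_]; last by rewrite !(mul0r, mulr0).
rewrite (_ : q < 0); last lia.
rewrite /gam /= !mul1r.
transitivity ((-1) ^+ hodd q * n%:R * (vsgn C q * vsgn C q)); first by ring.
by rewrite vsgn2 // mulr1.
Qed.

Definition level K u := forall m, (K <= m)%N -> forall a, ann (mode a m) u = 0.

Lemma level_exists u : exists K, level K u.
Proof.
have [N hN] := ann_level (mferm n) u; exists N => m Nm a; apply: hN.
rewrite /mode (leq_trans Nm) //.
have n0 : (0 < n)%N by apply: leq_ltn_trans (ltn_ord a).
by rewrite (leq_trans _ (leq_addr _ _)) // leq_pmulr.
Qed.

Lemma phi_level K u a p : level K u -> p < 0 -> (K <= `|p|)%N -> phi a p u = 0.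
Proof. by move=> hu p0 Kp; rewrite /phi (_ : (0 < p) = false) ?hu //; lia. Qed.

Lemma quad_level K u p q : level K u -> q < 0 -> (K <= `|q|)%N -> Q p q u = 0.
Proof.
by move=> hu q0 Kq; apply: big1 => a _; rewrite (phi_level _ hu) // linear0.
Qed.

(** The annihilator of large index acts on [u] first, or can be brought there: for p < 0 < q both
    fields annihilate and have no contraction. *)
Lemma nquad_level K u p q : level K u -> p != 0 -> q != 0 ->
  (K%:Z <= q) || (p <= - K%:Z) -> T p q u = 0.
Proof.
move=> hu p0 q0 h; rewrite /nquad; have [qp|qn] := ltrP 0 q.
  have [Kq|qK] := lerP K%:Z q.
    by rewrite (quad_level _ hu) ?scaler0 //; lia.
  rewrite quad_swap ?oppr_eq0 // (quad_level _ hu); [|lia..].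
  rewrite opprK (_ : (p == q) = false) ?mul0r ?scale0r ?scaler0 ?addr0 ?scaler0 //; lia.
by rewrite (quad_level _ hu) ?scaler0 //; lia.
Qed.

(** n/2 times Str(JA), cut off at N. For an infinite diagonal it need not converge, so it is
    subtracted before N grows. *)
Definition cN N A : C := n%:R / 2 *
  \sum_(p <- ir N) (p < 0)%R%:R * (-1) ^+ hodd p * A p p.

Definition rhoN N A u : F := rho1 N A u - cN N A *: u.

Definition rhoT N A u : F :=
  2^-1 *: \sum_(p <- ir N) \sum_(q <- ir N) A p q *: T p q u.

Lemma rho1_T N A u : rho1 N A u = rhoT N A u + cN N A *: u.
Proof.
rewrite /rho1 /rhoT /cN.
transitivity (2^-1 *: \sum_(p <- ir N) \sum_(q <- ir N)
   (A p q *: T p q u + (q == p)%:R *: (((p < 0)%R%:R * (-1) ^+ hodd p * A p p * n%:R) *: u))).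
  congr (_ *: _); rewrite big_seq [RHS]big_seq; apply: eq_bigr => p.
  rewrite mem_ir => /andP[p0 _]; rewrite big_seq [RHS]big_seq; apply: eq_bigr => q.
  rewrite mem_ir => /andP[q0 _]; rewrite -scalerA quad_nquad // scalerDr; congr (_ + _).
  rewrite !scalerA; congr (_ *: _); rewrite eq_sym.
  case: (q =P p) => [->|_]; last by rewrite !(mul0r, mulr0).
  by rewrite /= mul1r; ring.
under eq_bigr => p _ do rewrite big_split /=.
rewrite big_split /= scalerDr; congr (_ + _).
rewrite big_seq; under eq_bigr => p hp do rewrite (sum_ir_delta (fun=> _) hp).
rewrite -big_seq -scaler_suml scalerA; congr (_ *: _).
rewrite -mulr_suml; ring.
Qed.

Lemma rhoN_T N A u : rhoN N A u = rhoT N A u.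
Proof. by rewrite /rhoN rho1_T addrK. Qed.

Definition bandw W A := forall p q, (W < `|p - q|)%N -> A p q = 0.

(** An entry with an index beyond K + W is off the band, or has both indices beyond K with equal
    sign, and then its operator kills [u]. *)
Lemma rhoT_stable K W N A u : level K u -> bandw W A -> (K + W <= N)%N ->
  rhoT N A u = rhoT (K + W) A u.
Proof.
move=> hu hA KN; rewrite /rhoT; congr (_ *: _).
have z p q : p != 0 -> q != 0 -> (K + W < `|p|)%N || (K + W < `|q|)%N ->
    A p q *: T p q u = 0.
  move=> p0 q0 h; have [h1|h1] := ltnP W `|p - q|%N; first by rewrite hA ?scale0r.
  by rewrite (nquad_level hu) ?scaler0 //; lia.
rewrite (sum_ir_sub (N := K + W)) //; last first.
  move=> p p0 hp; rewrite big_seq big1 // => q; rewrite mem_ir => /andP[q0 _].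
  by rewrite z ?hp.
rewrite big_seq [RHS]big_seq; apply: eq_bigr => p; rewrite mem_ir => /andP[p0 _].
by apply: sum_ir_sub => // q q0 hq; rewrite z ?hq ?orbT.
Qed.

(** Taken as the eventual value in N, so that neither a band width nor a level enters the
    definition. *)
Definition rho A u : F :=
  xget 0 [set w | exists N0, forall N, (N0 <= N)%N -> rhoN N A u = w].

Lemma rho_ev W A u : bandw W A ->
  exists N0, forall N, (N0 <= N)%N -> rhoN N A u = rho A u.
Proof.
move=> hA; have [K hK] := level_exists u.
have h : [set w | exists N0, forall N, (N0 <= N)%N -> rhoN N A u = w] (rhoT (K + W) A u).
  by exists (K + W)%N => N hN; rewrite rhoN_T; apply: rhoT_stable.
by rewrite /rho; case: xgetP => [w _ //|/(_ _ h)].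
Qed.

Lemma rhoE K W A u N : level K u -> bandw W A -> (K + W <= N)%N -> rho A u = rhoT N A u.
Proof.
move=> hu hA KN; have [N0 hN0] := rho_ev u hA.
rewrite -(hN0 (maxn N0 (K + W))) ?leq_maxl // rhoN_T.
by rewrite (rhoT_stable hu hA KN) (rhoT_stable hu hA (leq_maxr _ _)).
Qed.

Lemma rhoN_linear N A : linear (rhoN N A).
Proof.
move=> k u w; rewrite /rhoN linearP /= scalerDr scalerBr.
by rewrite [cN N A *: (k *: u)]scalerA mulrC -scalerA opprD addrACA.
Qed.

Lemma cN_linear N k A B :
  cN N (fun p q => k * A p q + B p q) = k * cN N A + cN N B.
Proof.
rewrite /cN mulrCA -mulrDr; congr (_ * _); rewrite mulr_sumr -big_split.
by apply: eq_bigr => p _ /=; ring.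
Qed.

Lemma rhoN_linearl N k A B u :
  rhoN N (fun p q => k * A p q + B p q) u = k *: rhoN N A u + rhoN N B u.
Proof.
by rewrite /rhoN rho1_linearl cN_linear scalerDl scalerBr -[(k * _) *: u]scalerA opprD addrACA.
Qed.

Lemma gl_band (X : gl C) : exists W, bandw W X.
Proof. by have /asboolP[W h] := glvalP X; exists W. Qed.

Lemma rho_linear (X : gl C) : linear (rho X).
Proof.
move=> k u w; have [W hW] := gl_band X.
have [N1 h1] := rho_ev u hW; have [N2 h2] := rho_ev w hW.
have [N3 h3] := rho_ev (k *: u + w) hW; set N := maxn N1 (maxn N2 N3).
rewrite -(h1 N) -?(h2 N) -?(h3 N) ?rhoN_linear // /N; lia.
Qed.

Lemma rho_linearl k (X Y : gl C) u : rho (k *: X + Y : gl C) u = k *: rho X u + rho Y u.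
Proof.
have [W1 hW1] := gl_band X; have [W2 hW2] := gl_band Y.
have [W3 hW3] := gl_band (k *: X + Y).
have [N1 h1] := rho_ev u hW1; have [N2 h2] := rho_ev u hW2.
have [N3 h3] := rho_ev u hW3; set N := maxn N1 (maxn N2 N3).
rewrite -(h1 N) -?(h2 N) -?(h3 N) -?rhoN_linearl // /N; lia.
Qed.

End FockModule.

(** * The central term at a cut-off *)

Section FockBracket.
Variables (C : numClosedFieldType) (n : nat).
Local Notation F := (fockL C).
Local Notation rho1 := (@rho1 C n).
Local Notation rhoN := (@rhoN C n).
Local Notation rhoT := (@rhoT C n).
Local Notation rho := (@rho C n).
Local Notation cN := (@cN C n).
Implicit Types (p q r s : int) (u w : F) (N K W : nat) (A B X Y : gl C).

Lemma fsum_ir N (G : int -> C) : (forall k, k \notin ir N -> G k = 0) ->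
  \sum_(k \in [set: int]) G k = \sum_(k <- ir N) G k.
Proof.
move=> hG; rewrite (@fsum_restr _ [set` ir N]); last by move=> k /negP; apply: hG.
by rewrite -fsbig_seq // ir_uniq.
Qed.

Lemma glmul_ir A B W N p q : bandw W A -> inA A -> (`|p| + W <= N)%N ->
  glmul A B p q = \sum_(r <- ir N) A p r * B r q.
Proof.
move=> hW hA hN; apply: fsum_ir => r; rewrite mem_ir negb_and negbK => /orP[/eqP->|h].
  by rewrite (hA _).1 mul0r.
by rewrite hW ?mul0r //; lia.
Qed.

(** The cocycle is the coboundary of the cut-off Str(JA), exactly as soon as N >= W: only entries
    joining indices of opposite sign contribute, and the band keeps these within W of zero. *)
Lemma cocycle_ir e f A B W N : inA A -> bandw W A -> glparity e A -> glparity f B ->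
  (W <= N)%N ->
  cocycle A B = \sum_(p <- ir N) (p < 0)%R%:R * (-1) ^+ hodd p *
    \sum_(r <- ir N) (A p r * B r p - (-1) ^+ (e && f) * (B p r * A r p)).
Proof.
move=> hA hW pA pB hN; rewrite cocycleE (@fsum_ir N); last first.
  move=> r hr; rewrite fsbig1 ?mulr0 // => q _.
  have [->|q0] := eqVneq q 0; first by rewrite (hA _).1 mulr0 mul0r.
  have [->|r0] := eqVneq r 0; first by rewrite (hA _).2 mulr0 mul0r.
  rewrite mem_ir r0 /= in hr.
  have [rq|rq] := eqVneq (r <= 0) (q <= 0); first by rewrite rq subrr !mul0r.
  by rewrite hW ?mulr0 ?mul0r //; lia.
transitivity (\sum_(r <- ir N) \sum_(q <- ir N)
   ((r < 0)%R%:R * (-1) ^+ hodd r * (A r q * B q r)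
    - (q < 0)%R%:R * (-1) ^+ hodd q * ((-1) ^+ (e && f) * (A r q * B q r)))).
  rewrite big_seq [RHS]big_seq; apply: eq_bigr => r; rewrite mem_ir => /andP[r0 rN].
  rewrite (@fsum_ir N).
    rewrite mulr_sumr big_seq [RHS]big_seq; apply: eq_bigr => q.
    rewrite mem_ir => /andP[q0 qN].
    rewrite (_ : (r <= 0) = (r < 0)); last by rewrite le_eqVlt (negPf r0).
    rewrite (_ : (q <= 0) = (q < 0)); last by rewrite le_eqVlt (negPf q0).
    have [z|/pA] := eqVneq (A r q) 0; first by rewrite z !(mul0r, mulr0, subr0).
    have [z|/pB] := eqVneq (B q r) 0; first by rewrite z !(mul0r, mulr0, subr0).
    rewrite !hoddB => <- <-.
    by case: (hodd r); case: (hodd q); rewrite /= ?(expr0, expr1); ring.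
  move=> q; rewrite mem_ir negb_and negbK => /orP[/eqP->|h].
    by rewrite (hA _).1 mulr0 mul0r.
  have [rq|rq] := eqVneq (r <= 0) (q <= 0); first by rewrite rq subrr !mul0r.
  by rewrite hW ?mulr0 ?mul0r //; lia.
under eq_bigr => r _ do rewrite sumrB.
rewrite sumrB [X in _ - X]exchange_big /= -sumrB; apply: eq_bigr => p _.
rewrite sumrB mulrBr !mulr_sumr; congr (_ - _).
by apply: eq_bigr => r _; rewrite [B p r * _]mulrC.
Qed.

Lemma inD_parityof e A : glparity e A -> parityof e A.
Proof. by move=> pA p q /pA <-; rewrite hoddB. Qed.

Lemma cN_odd N A : glparity true A -> cN N A = 0.
Proof.
move=> pA; rewrite /cN big1 ?mulr0 // => p _; have [->|/pA] := eqVneq (A p p) 0.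
  by rewrite mulr0.
by rewrite subrr.
Qed.

Lemma scalar_commutator (V : zmodType) (P R a b x : V) :
  P - a - (b - x) - (R - b - (a - x)) = P - R.
Proof.
have -> : P - a - (b - x) = P + (x - a - b) by rewrite opprB -!addrA [- a + _]addrCA.
have -> : R - b - (a - x) = R + (x - a - b) by rewrite opprB -addrA [- b + _]addrC.
by rewrite opprD addrACA subrr addr0.
Qed.

(** Scalars drop out of an ordinary commutator. For two odd matrices there are none to begin with,
    the diagonals being zero. *)
Lemma rhoN_bracket e f A B N u : inD A -> glparity e A -> glparity f B ->
  rhoN N A (rhoN N B u) - (-1) ^+ (e && f) *: rhoN N B (rhoN N A u) =
  rho1 N (fun p s => \sum_(r <- ir N) (A p r * B r s - (-1) ^+ (e && f) * (B p r * A r s))) u.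
Proof.
move=> DA pA pB; have sA : sgskew A by move=> p q p0 q0; apply: inD_sg.
have := rho1_bracket n N u (inD_parityof pA) sA (inD_parityof pB).
set D := rho1 N _ u => h.
have linA x y c : rho1 N x (y - c *: u) = rho1 N x y - c *: rho1 N x u.
  by rewrite linearB /= [rho1 N x (_ *: _)]linearZ.
rewrite /rhoN !linA h.
case: e f pA pB {h} => [] [] pA pB /=; rewrite ?expr1 ?expr0 ?scaleN1r ?scale1r ?opprK.
- rewrite !cN_odd // !scale0r !subr0 addrC.
  by rewrite addrA subrr add0r.
all: rewrite ![_ *: (_ - _)]scalerBr [cN N A *: (cN N B *: u)]scalerA.
all: rewrite [cN N B *: (cN N A *: u)]scalerA (mulrC (cN N B)) scalar_commutator.
all: by rewrite addrC addKr.
Qed.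

End FockBracket.

Section FockRepresentation.
Variables (C : numClosedFieldType) (n : nat).
Local Notation F := (fockL C).
Local Notation rho1 := (@rho1 C n).
Local Notation rhoN := (@rhoN C n).
Local Notation rhoT := (@rhoT C n).
Local Notation rho := (@rho C n).
Local Notation cN := (@cN C n).
Implicit Types (p q r s : int) (u w : F) (N K W : nat) (A B X Y : gl C).

Lemma bandw_le W W' A : (W <= W')%N -> bandw W A -> bandw W' A.
Proof. by move=> h hA p q hpq; apply: hA; lia. Qed.

Lemma glbracket_ir e f A B W N p q : inA A -> inA B -> bandw W A -> bandw W B ->
  glparity e A -> glparity f B -> (`|p| + W <= N)%N ->
  \sum_(r <- ir N) (A p r * B r q - (-1) ^+ (e && f) * (B p r * A r q)) =
  glbracket A B p q.
Proof.
move=> hA hB WA WB pA pB hN; rewrite (glbracket_homog pA pB) glDE glNE glZE.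
by rewrite (glmul_ir B q WA hA hN) (glmul_ir A q WB hB hN) sumrB mulr_sumr.
Qed.

Lemma rho_bracket e f A B u : inD A -> inD B -> glparity e A -> glparity f B ->
  rho A (rho B u) - (-1) ^+ (e && f) *: rho B (rho A u) =
  rho (glbracket A B) u + (n%:R / 2 * cocycle A B) *: u.
Proof.
move=> DA DB pA pB; have [hA hB] := (inD_inA DA, inD_inA DB).
have [WA bA] := gl_band A; have [WB bB] := gl_band B; have [WD bD] := gl_band (glbracket A B).
set W := maxn (maxn WA WB) WD.
have {}bA : bandw W A by apply: bandw_le bA; rewrite /W; lia.
have {}bB : bandw W B by apply: bandw_le bB; rewrite /W; lia.
have {}bD : bandw W (glbracket A B) by apply: bandw_le bD; rewrite /W; lia.
have [K hK] := level_exists n u.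
have [N1 h1] := rho_ev n u bA; have [N2 h2] := rho_ev n u bB.
have [N3 h3] := rho_ev n (rho B u) bA; have [N4 h4] := rho_ev n (rho A u) bB.
(* [N1] to [N4] bring the four operators to their eventual values. The cut-off commutator is wrong
   only in rows beyond N - W and has band 2W, so K + 3W leaves both indices of a wrong entry beyond
   K. *)
pose N := (N1 + N2 + N3 + N4 + K + 3 * W)%N.
rewrite -(h3 N) -?(h4 N) -?(h1 N) -?(h2 N); try by rewrite /N; lia.
rewrite (rhoN_bracket n N u DA pA pB) rho1_T.
set D := fun p s => _; congr (_ + _ *: _); last first.
  by rewrite /cN (cocycle_ir (N := N) hA bA pA pB) // /N; lia.
rewrite (rhoE (N := N) hK bD); last by rewrite /N; lia.
have bDD : bandw (2 * W) D.
  move=> p q hpq; rewrite /D big1 // => r _.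
  have [h|h] := ltnP W `|p - r|%N; first by rewrite [A p r]bA // [B p r]bB // !mul0r mulr0 subrr.
  by rewrite [A r q]bA ?[B r q]bB ?mulr0 ?subrr //; lia.
rewrite /rhoT; congr (_ *: _); rewrite big_seq [RHS]big_seq.
apply: eq_bigr => p; rewrite mem_ir => /andP[p0 pN].
rewrite big_seq [RHS]big_seq; apply: eq_bigr => q; rewrite mem_ir => /andP[q0 qN].
have [pN'|pN'] := leqP (`|p| + W) N.
  by rewrite /D (glbracket_ir q hA hB bA bB pA pB pN').
have [h|h] := ltnP (2 * W) `|p - q|%N.
  by rewrite bDD // bD //; lia.
rewrite (nquad_level hK) ?scaler0 //.
move: pN'; rewrite /N; lia.
Qed.

Lemma rho_adj A u w : inD A -> fdot (rho A u) w = fdot u (rho (gl_omega A) w).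
Proof.
move=> DA; have [WA bA] := gl_band A; have [WB bB] := gl_band (gl_omega A).
have [N1 h1] := rho_ev n u bA; have [N2 h2] := rho_ev n w bB.
pose N := (N1 + N2)%N.
rewrite -(h1 N) -?(h2 N); try by rewrite /N; lia.
have cs k : (vsgn C k)^* = vsgn C k.
  by rewrite /vsgn; case: hodd; rewrite ?rmorph1 ?rmorph_int.
(* The sign in [gl_omega] is that of the form on V, which makes [gl_omega] the formal adjoint of the
   quadratic expression. *)
have ns k : k != 0 -> (-1) ^+ nsign k = vsgn C k.
  rewrite /nsign /vsgn; case: hodd => //= k0.
  by case: (ltgtP k 0) k0 => // hk _; rewrite ?(ltr0_sgz hk) ?(gtr0_sgz hk) ?expr0 ?expr1.
have om p q : p != 0 -> q != 0 ->
    gl_omega A q p * vsgn C p = (A p q)^* * vsgn C q.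
  move=> p0 q0; rewrite /= exprD !ns //.
  transitivity (vsgn C q * (A p q)^* * (vsgn C p * vsgn C p)); first by ring.
  by rewrite vsgn2 // mulr1 mulrC.
have hc : (cN N A)^* = cN N (gl_omega A).
  rewrite /cN !rmorphM fmorphV !rmorph_nat rmorph_sum /=; congr (_ * _).
  rewrite big_seq [RHS]big_seq; apply: eq_bigr => p; rewrite mem_ir => /andP[p0 _].
  rewrite !rmorphM rmorph_nat rmorphXn rmorphN1 /=; congr (_ * _).
  by rewrite exprD -expr2 sqrr_sign mul1r.
rewrite /rhoN.
transitivity (fdot (rho1 N A u) w - cN N A * fdot u w).
  by rewrite -[_ - _]/(_ + - _) addrC -scaleNr fdot_linear mulNr addrC.
rewrite (rho1_adj n N u w om) -[in RHS]hc.
rewrite -[in RHS]scaleNr addrC [in RHS]addrC fdot_linearr /= rmorphN /= conjCK mulNr.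
by [].
Qed.

Definition actF (x : Dhat C) (u : F) : F :=
  rho (x : glhat C).1 u + (n%:R / 2 * (x : glhat C).2) *: u.

Lemma actF_module : is_module actF.
Proof.
split=> [u k x y|x k u w|e f x y u [pA cA] [pB cB]].
- rewrite /actF -[(k *: x + y : glhat C).1]/(k *: (x : glhat C).1 + (y : glhat C).1).
  rewrite rho_linearl -[(k *: x + y : glhat C).2]/(k * (x : glhat C).2 + (y : glhat C).2 : C).
  rewrite [k *: (_ + _)]scalerDr addrACA; congr (_ + _).
  by rewrite [k *: (_ *: u)]scalerA -scalerDl; congr (_ *: _); ring.
- rewrite /actF rho_linear; set c := _ * _.
  rewrite [k *: (_ + _)]scalerDr [c *: (_ + _)]scalerDr addrACA.
  by rewrite [c *: (k *: u)]scalerA mulrC -scalerA.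
have /asboolP DA := DhatvalP x; have /asboolP DB := DhatvalP y.
have hb := rho_bracket u DA DB pA pB.
rewrite /actF -[(Dbracket x y : glhat C).1]/(glbracket _ _).
rewrite -[(Dbracket x y : glhat C).2]/(cocycle _ _ : C) -hb.
have linR A v k : rho A (v + k *: u) = rho A v + k *: rho A u.
  by rewrite addrC rho_linear addrC.
rewrite !linR.
set a := _ * (x : glhat C).2; set b := _ * (y : glhat C).2.
have ha : e -> a = 0 by move=> he; rewrite /a cA ?mulr0.
have hb' : f -> b = 0 by move=> hf; rewrite /b cB ?mulr0.
case: e f ha hb' {pA cA pB cB hb} => [] [] ha hb' /=; rewrite ?expr1 ?expr0 ?scaleN1r ?scale1r ?opprK.
- by rewrite ha // hb' // !scale0r !addr0.
all: have := scalar_commutator (rho (x : glhat C).1 (rho (y : glhat C).1 u))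
  (rho (y : glhat C).1 (rho (x : glhat C).1 u)) (- (b *: rho (x : glhat C).1 u))
  (- (a *: rho (y : glhat C).1 u)) ((a * b) *: u).
all: rewrite !opprK !opprD !opprK; set P := rho _ (rho _ u); set R := rho _ (rho _ u).
all: set ru := rho (x : glhat C).1 u; set rv := rho (y : glhat C).1 u => <-.
all: rewrite [a *: (rv + _)]scalerDr [b *: (ru + _)]scalerDr opprD.
all: by rewrite [a *: (b *: u)]scalerA [b *: (a *: u)]scalerA (mulrC b).
Qed.

Lemma actF_adj (x : Dhat C) u w : fdot (actF x u) w = fdot u (actF (Domega x) w).
Proof.
have /asboolP DA := DhatvalP x.
rewrite /actF addrC fdot_linear [in RHS]addrC fdot_linearr /= rho_adj //.
congr (_ * _ + _); rewrite !rmorphM fmorphV !rmorph_nat /=.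
by congr (_ * _); rewrite conjCK.
Qed.

End FockRepresentation.

(** * Transfer of unitarity *)

Section Pullback.
Variables (C : numClosedFieldType) (M H : lmodType C).
Variables (g : {dot H for Num.conj}) (Psi : {linear M -> H}).
Hypothesis Psi_inj : forall m, Psi m = 0 -> m = 0.

Definition pullback (x y : M) : C := g (Psi x) (Psi y).

Lemma pullback_bilinear : bilinear_for *%R (Num.conj \; *%R) pullback.
Proof.
split=> [y a x x'|x a y y']; rewrite /pullback linearP.
  exact: linearPl.
exact: linearPr.
Qed.

Lemma pullback_herm x y : pullback x y = (-1) ^+ false * (pullback y x)^*.
Proof. exact: hermitian_subproof. Qed.

Lemma pullback_pos x : x != 0 -> 0 < pullback x x.
Proof.
by move=> x0; apply: neq0_dnorm_gt0; apply: contra x0 => /eqP/Psi_inj/eqP.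
Qed.

HB.instance Definition _ := bilinear_isBilinear.Build C M M C *%R
  (Num.conj \; *%R) pullback pullback_bilinear.
HB.instance Definition _ := isHermitianSesquilinear.Build C M false Num.conj pullback pullback_herm.
HB.instance Definition _ := isDotProduct.Build C M pullback pullback_pos.

Lemma pullback_dot : exists f : {dot M for Num.conj}, forall x y, f x y = g (Psi x) (Psi y).
Proof. by exists (pullback : {dot M for Num.conj}). Qed.

End Pullback.

Section HomogeneousParts.
Variable C : numClosedFieldType.
Implicit Types (A B X Y : gl C) (x y : Dhat C) (p q r s i j k : int).

Lemma banded_deg k A : banded (fun i j => if i == j - k then A i j else 0).
Proof.
have /asboolP[N hA] := glvalP A; apply/asboolP; exists N => i j /hA ->.
by case: ifP.
Qed.
Definition degpart k A : gl C := Gl (banded_deg k A).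

Lemma degpart_degree k A : gldegree k (degpart k A).
Proof. by move=> i j /=; case: (i =P j - k) => // _; rewrite eqxx. Qed.

Lemma degpart_inD k A : inD A -> inD (degpart k A).
Proof.
move=> DA; apply: (@inD_intro _ (hodd k)).
- move=> i /=; rewrite (inD_inA DA i).1 (inD_inA DA i).2.
  by split; case: ifP.
- exact/gldegree_parity/degpart_degree.
move=> i j i0 j0 /=; rewrite (_ : (- j == - i - k) = (i == j - k)); last by apply/eqP/eqP; lia.
by case: ifP => _; rewrite ?mulr0 ?oppr0 // (inD_sg DA).
Qed.

Definition hpart k x : glhat C := (degpart k (x : glhat C).1, if k == 0 then (x : glhat C).2 else 0).

Lemma hpart_inDhat k x : inDhat (hpart k x).
Proof. by have /asboolP DA := DhatvalP x; apply/asboolP/degpart_inD. Qed.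
Definition Dpart k x : Dhat C := MkDhat (hpart_inDhat k x).

Lemma Dpart_degree k x : Ddegree k (Dpart k x).
Proof. by split=> [|/eqP/negPf /= ->]; [exact: degpart_degree|]. Qed.

Lemma Dhat_sum1 (I : Type) (r : seq I) (G : I -> Dhat C) i j :
  (\sum_(k <- r) G k : glhat C).1 i j = \sum_(k <- r) (G k : glhat C).1 i j.
Proof.
elim: r => [|k r IH]; first by rewrite !big_nil.
by rewrite !big_cons -IH.
Qed.

Lemma Dhat_sum2 (I : Type) (r : seq I) (G : I -> Dhat C) :
  (\sum_(k <- r) G k : glhat C).2 = \sum_(k <- r) ((G k : glhat C).2 : C).
Proof.
elim: r => [|k r IH]; first by rewrite !big_nil.
by rewrite !big_cons -IH.
Qed.

(** A banded matrix has finitely many nonzero diagonals; this reduces statements about the action to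
    homogeneous elements. *)
Lemma Dpart_sum x : exists N, x = Dpart 0 x + \sum_(k <- ir N) Dpart k x.
Proof.
have /asboolP[N hA] := glvalP (x : glhat C).1; exists N; apply: DhatP.
  apply: glP => i j.
  rewrite -[RHS]/((Dpart 0 x : glhat C).1 i j + (\sum_(k <- ir N) Dpart k x : glhat C).1 i j).
  rewrite Dhat_sum1 /= subr0; have [ij|ij] := eqVneq i j.
    rewrite big_seq big1 ?addr0 // => k; rewrite mem_ir => /andP[k0 _].
    by rewrite (_ : (i == j - k) = false) //; lia.
  rewrite add0r; have [h|h] := leqP `|i - j|%N N.
    rewrite (bigD1_seq (j - i)) ?ir_uniq //=; last by rewrite mem_ir; lia.
    rewrite (_ : (i == j - (j - i))); last lia.
    by rewrite big1 ?addr0 // => k hk; rewrite (_ : (i == j - k) = false) //; lia.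
  by rewrite hA // big1 // => k _; rewrite if_same.
rewrite -[RHS]/((x : glhat C).2 + (\sum_(k <- ir N) Dpart k x : glhat C).2 : C).
rewrite Dhat_sum2 big_seq big1 ?addr0 // => k; rewrite mem_ir => /andP[/negPf k0 _].
by rewrite /= k0.
Qed.

Lemma glmul_degree k l A B : gldegree k A -> gldegree l B -> gldegree (k + l) (glmul A B).
Proof.
move=> dA dB i j nz; apply/eqP; apply: contraNT nz => h.
apply/eqP/fsbig1 => r _; apply/eqP; apply: contraNT h.
by rewrite mulf_eq0 negb_or => /andP[/dA -> /dB ->]; apply/eqP; lia.
Qed.

Lemma Dbracket_degree k l x y : Ddegree k x -> Ddegree l y -> Ddegree (k + l) (Dbracket x y).
Proof.
move=> dx dy; have [px _] := Ddegree_parity dx; have [py _] := Ddegree_parity dy.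
have [{}dx _] := dx; have [{}dy _] := dy; split=> [i j|kl] /=.
  rewrite (glbracket_homog px py) glDE glNE glZE => nz.
  have [z|/(glmul_degree dx dy) //] := eqVneq (glmul (x : glhat C).1 (y : glhat C).1 i j) 0.
  rewrite (addrC k); apply: (glmul_degree dy dx); apply: contraNneq nz => ->.
  by rewrite z mulr0 subr0.
apply: cocycle_diag => r q _; apply/eqP/negPn/negP; rewrite mulf_eq0 negb_or.
by move=> /andP[/dx h1 /dy h2]; apply: kl; lia.
Qed.

Lemma Domega_degree k x : Ddegree k x -> Ddegree (- k) (Domega x).
Proof.
move=> [dx cx]; split=> [i j /= nz|k0 /=]; last by rewrite cx ?conjC0 // => z; apply: k0; rewrite z.
have /dx : (x : glhat C).1 j i != 0 by apply: contraNneq nz => ->; rewrite conjC0 mulr0.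
lia.
Qed.

Lemma DomegaK x : Domega (Domega x) = x.
Proof.
apply: DhatP; last exact: conjCK.
apply: glP => i j /=; rewrite rmorphM rmorphXn rmorphN1 /= conjCK mulrA addnC.
by rewrite -expr2 sqrr_sign mul1r.
Qed.

End HomogeneousParts.

(** * The module generated by a highest weight vector, and its grading *)

Section LoweringSpan.
Variables (C : numClosedFieldType) (M : lmodType C) (act : Dhat C -> M -> M).
Variables (xi : {scalar Dhat0 C}) (v : M).
Hypothesis Hact : is_module act.
Hypothesis hv : forall h : Dhat0 C, act h v = xi h *: v.
Hypothesis up : forall k x, 0 < k -> Ddegree k x -> act x v = 0.
Implicit Types (x y : Dhat C) (z : M) (k d : int).

Definition lowspan : set M := lspan [set z | exists d, lowering act v d z].
Definition lowspan_neg : set M := lspan [set z | exists2 d, d < 0 & lowering act v d z].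

Lemma lowspan0 : lowspan 0. Proof. exact: (lspan_submod _).1. Qed.
Lemma lowspanP a z z' : lowspan z -> lowspan z' -> lowspan (a *: z + z').
Proof. exact: (lspan_submod _).2. Qed.
Lemma lowspanD z z' : lowspan z -> lowspan z' -> lowspan (z + z').
Proof. by move=> h h'; rewrite -[z]scale1r; apply: lowspanP. Qed.
Lemma lowspanZ a z : lowspan z -> lowspan (a *: z).
Proof. by move=> h; rewrite -[_ *: _]addr0; apply: lowspanP => //; apply: lowspan0. Qed.

Lemma lowspan_v : lowspan v.
Proof. by apply: sub_lspan; exists 0; apply: lowering_nil. Qed.

Lemma lowspan_low k y z : k < 0 -> Ddegree k y -> lowspan z -> lowspan (act y z).
Proof.
move=> k0 dy; move: z; apply: (lspan_le (P := fun z => lowspan (act y z))).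
- by rewrite act0r //; apply: lowspan0.
- by move=> a u w hu hw; rewrite actDr //; apply: lowspanP.
by move=> z [d hd]; apply: sub_lspan; exists (k + d); apply: lowering_cons.
Qed.

(** Move [x] to the right through the word. Each passage leaves a homogeneous bracket in front of a
    shorter word, and at [v] the element kills, acts by a scalar, or lowers. *)
Lemma lowspan_homog k x d z : Ddegree k x -> lowering act v d z -> lowspan (act x z).
Proof.
move=> dx hz; elim: hz k x dx => [|l e y z' l0 dy hz' IH] k x dx.
  have [k0|k0|k0] := ltrgt0P k.
  - by rewrite (up k0) //; apply: lowspan0.
  - by apply: lowspan_low k0 dx lowspan_v.
  rewrite k0 in dx; have hx : inDhat0 x by apply/asboolP.
  by rewrite (hv (MkDhat0 hx)); apply/lowspanZ/lowspan_v.
rewrite (act_bracket Hact _ (Ddegree_parity dx) (Ddegree_parity dy)).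
apply: lowspanD; first exact: IH (Dbracket_degree dx dy).
by apply: lowspanZ; apply: lowspan_low l0 dy (IH _ _ dx).
Qed.

Lemma lowspan_act x z : lowspan z -> lowspan (act x z).
Proof.
move: z; apply: (lspan_le (P := fun z => lowspan (act x z))).
- by rewrite act0r //; apply: lowspan0.
- by move=> a u w hu hw; rewrite actDr //; apply: lowspanP.
move=> z [d hd]; have [N ->] := Dpart_sum x; rewrite actAl //.
apply: lowspanD; first exact: lowspan_homog (Dpart_degree 0 x) hd.
elim: (ir N) => [|k r IH]; first by rewrite big_nil act0l //; apply: lowspan0.
by rewrite big_cons actAl //; apply: lowspanD => //; apply: lowspan_homog (Dpart_degree k x) hd.
Qed.

Lemma lowering_le0 d z : lowering act v d z -> d < 0 \/ d = 0 /\ z = v.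
Proof.
case=> [|k e x w k0 _ hw]; [by right|left].
suff he : e <= 0 by lia.
by elim: hw => // l e' y w' l0 _ _ IH; lia.
Qed.

Lemma lowspan_split z : lowspan z -> exists c z', lowspan_neg z' /\ z = c *: v + z'.
Proof.
move: z; apply: (lspan_le (P := fun z => exists c z', lowspan_neg z' /\ z = c *: v + z')).
- by exists 0, 0; rewrite scale0r addr0; split=> //; apply: (lspan_submod _).1.
- move=> a _ _ [c [z [hz ->]]] [c' [z' [hz' ->]]]; exists (a * c + c'), (a *: z + z').
  split; first exact: (lspan_submod _).2.
  by rewrite scalerDr scalerA addrACA -scalerDl.
move=> z [d /[dup] hd /lowering_le0[d0|[_ ->]]].
  by exists 0, z; rewrite scale0r add0r; split=> //; apply: sub_lspan; exists d.
by exists 1, 0; rewrite scale1r addr0; split=> //; apply: (lspan_submod _).1.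
Qed.

(* the ad-eigenvalue of this element on degree [k] is [- k] *)
Definition euler : Dhat0 C := hdiag (fun j => (0 < j)%R%:R * j%:~R).

Lemma eulerE i j : (euler : glhat C).1 i j = (i == j)%:R * i%:~R.
Proof.
have [->|i0] := eqVneq i 0; first by rewrite [LHS](@dsym_inA _ _ _).2 mulr0.
have [->|j0] := eqVneq j 0; first by rewrite [LHS](@dsym_inA _ _ _).1 (negPf i0) mul0r.
rewrite [LHS]dsymE //= eqr_opp (eq_sym j).
case: (i =P j) => [->|_]; last by rewrite !mul0r mulr0 subr0.
rewrite !mul1r; have [jp|jn] := ltrP 0 j.
  by rewrite (_ : (0 < - j) = false) ?mul0r ?mulr0 ?mul1r ?subr0 //; lia.
rewrite (_ : 0 < - j) ?mul0r ?mul1r ?sub0r; last lia.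
rewrite /sg addbb expr0 mul1r vsgn2 // mul1r mulrNz opprK //.
Qed.

Lemma euler_bracket k x : Ddegree k x -> Dbracket euler x = (- k%:~R) *: x.
Proof.
move=> [dx cx]; have [px _] := Ddegree_parity (conj dx cx).
have [dE _] : Ddegree 0 euler by apply/asboolP; case: euler.
apply: DhatP; last first.
  rewrite -[RHS]/(- k%:~R * ((x : glhat C).2 : C)) /= cocycle_diag => [|r q rq].
    have [->|k0] := eqVneq k 0; first by rewrite oppr0 mul0r.
    by rewrite cx ?mulr0 //; apply/eqP.
  have /negPf rq' : r != q by apply: contraNneq rq => ->.
  by rewrite -[dsym _ r q]/((euler : glhat C).1 r q) eulerE rq' !mul0r.
rewrite -[RHS]/(_ *: (x : glhat C).1) [LHS](glbracket_homog (gldegree_parity dE) px).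
apply: glP => i j; rewrite glDE glNE !glZE expr0 mul1r !glmulE.
rewrite (fsum1 (j := i)); last by move=> l /negPf li; rewrite eulerE eq_sym li !mul0r.
rewrite (fsum1 (j := j)); last by move=> l /negPf li; rewrite eulerE li !mul0r mulr0.
rewrite !eulerE !eqxx !mul1r; have [->|/dx ->] := eqVneq ((x : glhat C).1 i j) 0.
  by rewrite !(mulr0, mul0r) subrr.
by rewrite rmorphB /=; ring.
Qed.

Lemma euler_lowering d z : lowering act v d z ->
  act euler z = (xi euler - d%:~R) *: z.
Proof.
elim=> [|k e x w k0 dx _ IH]; first by rewrite subr0 hv.
have pe : Dparity false euler by have /asboolP := Dhat0valP euler; apply: Ddegree_parity.
rewrite (act_bracket Hact _ pe (Ddegree_parity dx)) expr0 scale1r (euler_bracket dx).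
rewrite IH actZl // actZr // -scalerDl rmorphD /=; congr (_ *: _); ring.
Qed.

Hypothesis v0 : v != 0.

(** If [v] were a sum of words of degrees d_i < 0, the product over i of the operators [euler] minus
    its eigenvalue in degree d_i would kill the sum, yet it multiplies [v] by the nonzero product of
    the d_i. *)
Lemma v_notin_lowspan_neg : ~ lowspan_neg v.
Proof.
move=> [n [c [z [hz vE]]]].
have /choice[d hd] : forall i, exists d, d < 0 /\ lowering act v d (z i).
  by move=> i; have [d d0 h] := hz i; exists d.
pose step (e : int) u := act euler u - (xi euler - e%:~R) *: u.
pose op (r : seq 'I_n) u := foldr (fun i u => step (d i) u) u r.
have opE r e u : act euler u = (xi euler - e%:~R) *: u ->
    op r u = (\prod_(i <- r) ((d i)%:~R - e%:~R)) *: u.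
  move=> hu; elim: r => [|i r IH]; first by rewrite big_nil scale1r.
  rewrite big_cons [op _ _]/(step (d i) (op r u)) IH /step actZr // hu.
  by rewrite !scalerA -scalerBl; congr (_ *: _); ring.
have oplin r a u u' : op r (a *: u + u') = a *: op r u + op r u'.
  elim: r => //= i r ->; rewrite /step actDr // scalerBr scalerDr opprD addrACA.
  by rewrite !scalerA [a * _]mulrC.
have op0 r : op r 0 = 0.
  by have := oplin r (-1) 0 0; rewrite scaler0 addr0 scaleN1r addNr.
have h1 := @opE (index_enum 'I_n) 0 v (euler_lowering (lowering_nil _ _)).
have h2 : op (index_enum 'I_n) v = 0.
  rewrite {1}vE; elim/big_rec: _ => [|i u _ IH]; first exact: op0.
  rewrite oplin IH addr0 (opE _ _ _ (euler_lowering (hd i).2)).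
  by rewrite (bigD1 i) //= subrr mul0r scale0r scaler0.
move: h1; rewrite h2 => /esym/eqP; rewrite scaler_eq0 (negPf v0) orbF.
rewrite prodf_seq_eq0 => /hasP[i _]; rewrite subr0 intr_eq0.
by have [di _] := hd i; rewrite lt_eqF.
Qed.

End LoweringSpan.

Section Transfer.
Variables (C : numClosedFieldType) (M H : lmodType C).
Variables (act : Dhat C -> M -> M) (actH : Dhat C -> H -> H).
Variables (xi : {scalar Dhat0 C}) (v : M) (w : H) (g : {dot H for Num.conj}).
Hypotheses (Hact : is_module act) (HactH : is_module actH).
Hypothesis Hirr : irreducible act.
Hypothesis Hhw : highest_weight act xi v.
Hypothesis Hg : forall x u u', g (actH x u) u' = g u (actH (Domega x) u').
Hypothesis w0 : w != 0.
Hypothesis hw : forall h : Dhat0 C, actH h w = xi h *: w.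
Hypothesis upw : forall k x, 0 < k -> Ddegree k x -> actH x w = 0.

Let MH : lmodType C := (M * H)%type.
Let act2 (x : Dhat C) (z : MH) : MH := (act x z.1, actH x z.2).
Let z0 : MH := (v, w).

Let act2_module : is_module act2.
Proof.
case: Hact HactH => [a1 a2 a3] [b1 b2 b3]; split.
- by move=> [m h] k x y; rewrite /act2 /= a1 b1.
- by move=> x k [m h] [m' h']; rewrite /act2 /= a2 b2.
by move=> e f x y [m h] px py; rewrite /act2 /= (a3 e f) ?(b3 e f).
Qed.

Let v0 : v != 0. Proof. by case: Hhw. Qed.
Let hv (h : Dhat0 C) : act h v = xi h *: v. Proof. by case: Hhw. Qed.
Let upv k x : 0 < k -> Ddegree k x -> act x v = 0. Proof. by case: Hhw => _ _ h _; apply: h. Qed.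

Let hz0 (h : Dhat0 C) : act2 h z0 = xi h *: z0.
Proof. by rewrite /act2 /= hv hw. Qed.
Let upz k x : 0 < k -> Ddegree k x -> act2 x z0 = 0.
Proof. by move=> k0 dx; rewrite /act2 /= (upv k0 dx) (upw k0 dx). Qed.

(** This submodule turns out to be the graph of an injective intertwiner from M to H. *)
Let N : set MH := lowspan act2 z0.
Let Nact x z : N z -> N (act2 x z).
Proof. exact: lowspan_act act2_module hz0 upz _ _. Qed.

Let lowering_proj d z : lowering act2 z0 d z ->
  lowering act v d z.1 /\ lowering actH w d z.2.
Proof.
elim=> [|k e x u k0 dx _ [h1 h2]]; first by split; apply: lowering_nil.
by split; apply: lowering_cons.
Qed.

Let neg_proj z : lowspan_neg act2 z0 z ->
  lowspan_neg act v z.1 /\ lowspan_neg actH w z.2.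
Proof.
move: z; apply: (lspan_le (P := fun z : MH => lowspan_neg act v z.1 /\ lowspan_neg actH w z.2)).
- by split; apply: (lspan_submod _).1.
- by move=> a [u1 u2] [s1 s2] [h1 h2] [h3 h4]; split; apply: (lspan_submod _).2.
by move=> z [d d0 /lowering_proj[h1 h2]]; split; apply: sub_lspan; exists d.
Qed.

Let lowspan_proj2 z : N z -> lowspan actH w z.2.
Proof.
move: z; apply: (lspan_le (P := fun z : MH => lowspan actH w z.2)).
- exact: (lspan_submod _).1.
- by move=> a [u1 u2] [s1 s2] h1 h2; apply: (lspan_submod _).2.
by move=> z [d /lowering_proj[h1 h2]]; apply: sub_lspan; exists d.
Qed.

Let g0l u : g 0 u = 0. Proof. exact: linear0l. Qed.
Let gsum a u u' t : g (a *: u + u') t = a * g u t + g u' t.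
Proof. exact: linearPl. Qed.
Let gsumr a u u' t : g t (a *: u + u') = a^* * g t u + g t u'.
Proof. exact: linearPr. Qed.

(** Move the outermost lowering factor to the other side: its image under omega raises, hence kills
    [w]. *)
Let neg_orth h : lowspan_neg actH w h -> g h w = 0.
Proof.
move: h; apply: (lspan_le (P := fun h => g h w = 0)).
- exact: g0l.
- by move=> a u u' hu hu'; rewrite gsum hu hu' mulr0 addr0.
move=> h [d d0 hd]; case: hd d0 => [|k e x u k0 dx _ _]; first by rewrite ltxx.
by rewrite Hg (upw _ (Domega_degree dx)) ?linear0r // oppr_gt0.
Qed.

Let ortho_w h : N (0, h) -> g h w = 0.
Proof.
move=> /lowspan_split[c [z' [/neg_proj[h1 h2]]]] /= [e1 e2].
have c0 : c = 0.
  apply: contrapT => /eqP c0; apply: (v_notin_lowspan_neg Hact hv v0).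
  have vE : (- c^-1) *: z'.1 + 0 = v.
    have -> : z'.1 = - (c *: v) by apply/eqP; rewrite -addr_eq0 addrC -e1.
    by rewrite addr0 scaleNr scalerN opprK scalerA mulVf ?scale1r.
  have : lowspan_neg act v ((- c^-1) *: z'.1 + 0).
    by apply: (lspan_submod _).2; [exact: h1|exact: (lspan_submod _).1].
  by rewrite vE.
by rewrite e2 c0 scale0r add0r neg_orth.
Qed.

(** Moving lowering factors across the form shows that h is orthogonal to everything generated by
    [w], and h is itself generated by [w]. *)
Let kernel2 h : N (0, h) -> h = 0.
Proof.
move=> Nh; apply/eqP/negPn/negP => /(@neq0_dnorm_gt0 _ _ _ g).
suff -> : g h h = 0 by rewrite ltxx.
have low d u : lowering actH w d u -> forall h', N (0, h') -> g h' u = 0.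
  elim=> [|k e x s k0 dx _ IH] h' Nh'; first exact: ortho_w.
  rewrite -[x]DomegaK -Hg; apply: IH.
  by have := Nact (Domega x) Nh'; rewrite /act2 /= act0r.
suff orth : forall t, lowspan actH w t -> g h t = 0 by exact: orth (lowspan_proj2 Nh).
apply: (lspan_le (P := fun t => g h t = 0)).
- exact: linear0r.
- by move=> a u u' hu hu'; rewrite gsumr hu hu' mulr0 addr0.
by move=> t [d hd]; apply: low hd _ Nh.
Qed.

(** These m form a submodule of the irreducible M. It is proper, since (v, 0) in N would put [v]
    into the span of negative degrees. *)
Let kernel1 m : N (m, 0) -> m = 0.
Proof.
case: Hirr => _ /(_ [set m | N (m, 0)]) [] //=.
- exact: lowspan0.
- by move=> a u u' hu hu'; have := lowspanP a hu hu'; rewrite -[X in lowspan _ _ X]/(_, _) /= scaler0 addr0.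
- by move=> x u /(Nact x); rewrite /act2 /= act0r.
- by move=> e Nm; have : [set m | N (m, 0)] m by []; rewrite e.
move=> e _; exfalso; have : [set m | N (m, 0)] v by rewrite e.
move=> /= /lowspan_split[c [z' [/neg_proj[h1 h2]]]] /= [e1 e2].
have : g 0 w = 0 by apply: g0l.
rewrite {1}e2 gsum (neg_orth h2) addr0 => /eqP; rewrite mulf_eq0.
rewrite (gt_eqF (neq0_dnorm_gt0 _ w0)) orbF => /eqP c0.
by apply: (v_notin_lowspan_neg Hact hv v0); rewrite {2}e1 c0 scale0r add0r.
Qed.

Lemma unitary_transfer : unitarizable act.
Proof.
have total m : exists h, N (m, h).
  have : [set: M] m by []; case: Hhw => _ _ _ <-; move: m.
  apply: (lspan_le (P := fun m => exists h, N (m, h))).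
  - by exists 0; apply: lowspan0.
  - by move=> a u u' [s hs] [s' hs']; exists (a *: s + s'); apply: (lowspanP a hs hs').
  move=> m [d hm]; suff [h hh] : exists h, lowering act2 z0 d (m, h).
    by exists h; apply: sub_lspan; exists d.
  elim: hm => [|k e x u k0 dx _ [h hh]]; first by exists w; apply: lowering_nil.
  by exists (actH x h); apply: (lowering_cons k0 dx hh).
have /choice[Psi hPsi] := total.
have uniq m h h' : N (m, h) -> N (m, h') -> h = h'.
  move=> n1 n2; apply/eqP; rewrite -subr_eq0; apply/eqP/kernel2.
  have := lowspanP (-1) n2 n1; rewrite -[X in lowspan _ _ X]/(_, _) /=.
  by rewrite !scaleN1r addNr addrC.
have lin : linear Psi.
  by move=> a u u'; apply: uniq (hPsi _) (lowspanP a (hPsi u) (hPsi u')).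
pose PsiL : {linear M -> H} := HB.pack Psi (GRing.isLinear.Build C M H _ Psi lin).
have inj m : PsiL m = 0 -> m = 0.
  by move=> /= h; apply: kernel1; rewrite -h; apply: hPsi.
have [f hf] := pullback_dot g inj.
exists f => x m m'; rewrite !hf /=.
have eqv y u : Psi (act y u) = actH y (Psi u).
  by apply: uniq (hPsi _) _; apply: (Nact y (hPsi u)).
by rewrite !eqv Hg.
Qed.

End Transfer.

(** * Highest weight vectors in the Fock space *)

Section FockVectors.
Variables (C : numClosedFieldType) (n : nat).
Local Notation F := (fockL C).
Local Notation ferm := (mferm n).
Local Notation cre := (@cre C ferm).
Local Notation ann := (@ann C ferm).
Local Notation Q := (@quad C n).
Local Notation T := (@nquad C n).
Local Notation E := (Eop (@actF C n)).
Implicit Types (p q r : int) (u w : F) (s : seq nat) (a : 'I_n).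

Lemma nquad_pos p q u : 0 < q -> T p q u = Q p (- q) u.
Proof.
move=> q0; rewrite /nquad q0 /vsgn gtr0_sgz //.
by case: hodd; rewrite scale1r.
Qed.

Lemma nquad_dual p q u : p != 0 -> 0 < q ->
  T (- q) (- p) u = (vsgn C (- p) * peps C p q) *: Q p (- q) u.
Proof.
move=> p0 q0; rewrite /nquad oppr_gt0 opprK; have [pn|pp] := ltrP p 0.
  rewrite quad_swap; [|lia..]; rewrite (_ : (- q == - p) = false); last lia.
  by rewrite !mul0r scale0r addr0 scalerA /peps hoddN andbC.
by rewrite /peps !hoddN andbC.
Qed.

Lemma rho_eu p q u : p != 0 -> q != 0 -> rho n (eu C p q) u = 2^-1 *: T p q u.
Proof.
move=> p0 q0; have [W hW] := gl_band (eu C p q); have [K hK] := level_exists n u.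
rewrite (rhoE (N := (K + W + `|p| + `|q|)%N) hK hW) ?leq_addr //; last lia.
rewrite /rhoT; congr (_ *: _).
rewrite (bigD1_seq p) ?ir_uniq /=; [|by rewrite mem_ir; lia|by []].
rewrite [X in _ + X]big1 ?addr0 => [|r /negPf rp]; last first.
  by rewrite big1 // => t _; rewrite rp scale0r.
rewrite (bigD1_seq q) ?ir_uniq /=; [|by rewrite mem_ir; lia|by []].
rewrite !eqxx scale1r big1 ?addr0 // => r /negPf rq.
by rewrite rq scale0r.
Qed.

(** Both entries of the antisymmetrized unit give the same quadratic operator, which absorbs the
    1/2. *)
Lemma Eop_quad p q u : p != 0 -> 0 < q -> E p q u = Q p (- q) u.
Proof.
move=> p0 q0; have q1 : q != 0 by rewrite gt_eqF.
have -> : E p q u = rho n (dsym (eu C p q)) u + (n%:R / 2 * 0) *: u by [].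
rewrite mulr0 scale0r addr0 dsym_eu // rho_linearl.
rewrite !rho_eu ?oppr_eq0 // nquad_dual // nquad_pos // !scalerA -scalerDl.
rewrite [X in X *: _](_ : _ = 1) ?scale1r //.
rewrite /sg /peps !vsgnN // !hoddN.
have vq : vsgn C q = 1 by rewrite /vsgn gtr0_sgz //; case: hodd.
transitivity (2^-1 * (1 - (-1) ^+ ((hodd q (+) hodd p) && hodd p) * (-1) ^+ hodd q *
   ((-1) ^+ hodd p) ^+ 2 * (vsgn C p * vsgn C p) * (-1) ^+ (~~ hodd p && ~~ hodd q))).
  by rewrite vq; ring.
rewrite sqrr_sign vsgn2 // !mulr1.
by case: (hodd p); case: (hodd q); rewrite /= ?(expr0, expr1); field.
Qed.

Lemma Eop_cre_ann p q u : 0 < p -> 0 < q ->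
  E p q u = \sum_(a < n) cre (mode a `|p|%N) (ann (mode a `|q|%N) u).
Proof.
move=> p0 q0; have qf : (q < 0) = false by lia.
rewrite Eop_quad ?gt_eqF // /quad; apply: eq_bigr => a _.
by rewrite /phi p0 oppr_gt0 qf rev_ordK abszN.
Qed.

Lemma quad_ann_ann p q u : 0 < p -> 0 < q ->
  Q (- p) (- q) u = \sum_(a < n) ann (mode (rev_ord a) `|p|%N) (ann (mode a `|q|%N) u).
Proof.
move=> p0 q0; have pf : (p < 0) = false by lia.
have qf : (q < 0) = false by lia.
by rewrite /quad; apply: eq_bigr => a _; rewrite /phi !oppr_gt0 pf qf !abszN rev_ordK.
Qed.

Definition creL s : F := foldr (fun k u => cre k u) (vac C) s.

Lemma ann_creL k s : k \notin s -> ann k (creL s) = 0.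
Proof.
elim: s => [|l s IH]; first by rewrite ann_vac.
rewrite inE negb_or => /andP[/negPf kl ks]; rewrite [creL _]/= ann_cre kl IH //.
by rewrite linear0 scaler0 scale0r addr0.
Qed.

Lemma cre_sqr k u : ferm k -> cre k (cre k u) = 0.
Proof.
move=> fk; have := cre_cre ferm k k u; rewrite /eps fk expr1 scaleN1r => /eqP.
rewrite -subr_eq0 opprK -mulr2n -scaler_nat scaler_eq0 pnatr_eq0 /=.
by move/eqP.
Qed.

Lemma cre_creL k s : ferm k -> k \in s -> cre k (creL s) = 0.
Proof.
move=> fk; elim: s => // l s IH; rewrite inE [creL _]/=.
case: (eqVneq k l) => [<- _|_ /= ks]; first exact: cre_sqr.
by rewrite cre_cre IH // linear0 scaler0.
Qed.

Lemma cre_ann_creL k s : ferm k ->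
  cre k (ann k (creL s)) = (k \in s)%:R *: creL s.
Proof.
move=> fk; case: (boolP (k \in s)) => [ks|/ann_creL->]; last first.
  by rewrite linear0 scale0r.
have := ann_cre ferm k k (creL s); rewrite cre_creL // linear0 eqxx /eps fk expr1 /= scaleN1r.
by move/eqP; rewrite eq_sym addrC subr_eq0 => /eqP ->.
Qed.

Lemma creL_neq0 s : uniq s -> creL s != 0.
Proof.
elim: s => [|k s IH]; first by move=> _; apply: vac_neq0.
move=> /andP[ks /IH s0]; apply/eqP => z.
have : fdot (cre k (creL s)) (cre k (creL s)) = 0.
  by rewrite [cre k _]z; exact: linear0l.
rewrite fdot_cre ann_cre ann_creL // linear0 scaler0 add0r eqxx scale1r => /eqP.
by rewrite gt_eqF // fdot_pos.
Qed.

(* [E q q] is a sum of nonnegative operators [cre * ann], so weight zero makes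
   every annihilator of index [q] vanish *)
Lemma Eop_zero_weight p q u : 0 < p -> 0 < q -> E q q u = 0 -> E p q u = 0.
Proof.
move=> p0 q0 z; rewrite Eop_cre_ann //; apply: big1 => a _.
suff -> : ann (mode a `|q|%N) u = 0 by rewrite linear0.
apply/eqP/negPn/negP => /fdot_pos h.
have : fdot (E q q u) u = 0 by rewrite z; exact: linear0l.
rewrite Eop_cre_ann // linear_sumlz /= (eq_bigr (fun b => fdot (ann (mode b `|q|%N) u) (ann (mode b `|q|%N) u))).
  rewrite (bigD1 a) //= => /eqP; rewrite gt_eqF //; apply: ltr_pwDl => //.
  by apply: sumr_ge0 => b _; have [->|h'] := eqVneq (ann (mode b `|q|%N) u) 0;
    [rewrite [fdot _ _]linear0l|apply/ltW/fdot_pos].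
by move=> b _; rewrite -fdot_cre.
Qed.

End FockVectors.

(** * The highest weight vector attached to a partition *)

Section JointVectors.
Variables (C : numClosedFieldType) (n : nat) (lam col : nat -> nat).
Hypothesis lamcol : forall i j, (j < lam i)%N = (i < col j)%N.
Hypothesis lam_anti : forall i i', (i <= i')%N -> (lam i' <= lam i)%N.
Hypothesis col_anti : forall j j', (j <= j')%N -> (col j' <= col j)%N.
Hypothesis col01 : (col 0%N + col 1%N <= n)%N.
Local Notation F := (fockL C).
Local Notation ferm := (mferm n).
Local Notation cre := (@cre C ferm).
Local Notation ann := (@ann C ferm).
Local Notation Q := (@quad C n).
Local Notation T := (@nquad C n).
Local Notation E := (Eop (@actF C n)).
Implicit Types (p q : int) (i j l m : nat) (u w : F) (a : 'I_n).
Let HF := actF_module C n.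

(** With rows and columns counted from 0, row i belongs to the boson i + 1/2 and column j to the
    fermion j + 1. *)
Definition bos i : int := (i.*2.+1)%:Z.
Definition fer j : int := (j.*2.+2)%:Z.

Lemma hodd_bos i : hodd (bos i) = true. Proof. by rewrite /hodd /bos; lia. Qed.
Lemma hodd_fer j : hodd (fer j) = false. Proof. by rewrite /hodd /fer; lia. Qed.
Lemma bos_fer i j : (bos i == fer j) = false. Proof. by rewrite /bos /fer; lia. Qed.
Lemma fer_bos i j : (fer j == bos i) = false. Proof. by rewrite /bos /fer; lia. Qed.
Lemma bos_eq i j : (bos i == bos j) = (i == j). Proof. by rewrite /bos; lia. Qed.
Lemma fer_eq i j : (fer i == fer j) = (i == j). Proof. by rewrite /fer; lia. Qed.
Lemma bos_gt0 i : 0 < bos i. Proof. by []. Qed.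
Lemma fer_gt0 i : 0 < fer i. Proof. by []. Qed.
Hint Resolve bos_gt0 fer_gt0 : core.

Definition lamodes : seq nat :=
  [seq mode z.1 z.2.*2.+2 | z : 'I_n * nat <-
    [seq z : 'I_n * nat <- [seq (a, j) | a <- enum 'I_n, j <- iota 0 (lam 0)]
    | (z.1 < col z.2)%N]].

Lemma lamodes_uniq : uniq lamodes.
Proof.
rewrite map_inj_in_uniq => [|[a j] [b l] _ _ /=].
  by apply/filter_uniq/allpairs_uniq; rewrite ?enum_uniq ?iota_uniq // => -[? ?] [? ?] _ _ [-> ->].
move/eqP; rewrite mode_eq => /andP[/eqP-> h]; congr (_, _); lia.
Qed.

Lemma mem_lamodes a m :
  (mode a m \in lamodes) = [&& (0 < m)%N, ~~ odd m & (a < col m.-2./2)%N].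
Proof.
apply/mapP/and3P => [[[b j]]|[m0 mo ac]].
  rewrite mem_filter => /andP[/= h _] /eqP; rewrite mode_eq => /andP[/eqP-> /eqP->].
  by split=> //=; [lia|rewrite doubleK].
exists (a, m.-2./2); last by apply/eqP; rewrite mode_eq eqxx /=; lia.
rewrite mem_filter /= ac; apply/allpairsP; exists (a, m.-2./2) => /=.
split=> //; rewrite ?mem_enum // mem_iota /=.
by rewrite lamcol (leq_trans _ ac).
Qed.

Lemma mem_lamodes_fer a j : (mode a j.*2.+2 \in lamodes) = (a < col j)%N.
Proof. by rewrite mem_lamodes /= doubleK odd_double. Qed.

Definition vlam : F := creL C n lamodes.

Lemma vlam_neq0 : vlam != 0. Proof. exact/creL_neq0/lamodes_uniq. Qed.

Lemma col_le_n j : (col j <= n)%N.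
Proof. by apply: leq_trans (col_anti (leq0n j)) _; lia. Qed.

Lemma vlam_bos p i : 0 < p -> E p (bos i) vlam = 0.
Proof.
move=> p0; rewrite Eop_cre_ann //; apply: big1 => a _.
by rewrite ann_creL ?linear0 // mem_lamodes /= odd_double.
Qed.

Lemma vlam_fer_diag j : E (fer j) (fer j) vlam = (col j)%:R *: vlam.
Proof.
rewrite Eop_cre_ann //.
rewrite (eq_bigr (fun a : 'I_n => (a < col j)%N%:R *: vlam)) => [|a _]; last first.
  by rewrite cre_ann_creL ?mem_lamodes_fer // mode_ferm /= odd_double.
rewrite -scaler_suml -natr_sum; congr (_%:R *: _).
rewrite -big_mkcond /= -(big_ord_widen n (fun=> 1%N) (col_le_n j)).
by rewrite sum1_card card_ord.
Qed.

Lemma vlam_fer j l : (j < l)%N -> E (fer j) (fer l) vlam = 0.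
Proof.
move=> jl; rewrite Eop_cre_ann //; apply: big1 => a _.
have [h|h] := ltnP a (col l); last first.
  by rewrite ann_creL ?linear0 // mem_lamodes_fer -leqNgt.
have h1 := leq_trans h (col_anti (ltnW jl)).
have ne : (mode a (l.*2.+2) == mode a (j.*2.+2)) = false.
  by rewrite mode_eq eqxx /=; lia.
have := ann_cre ferm (mode a (l.*2.+2)) (mode a (j.*2.+2)) vlam.
rewrite cre_creL ?mem_lamodes_fer ?mode_ferm /= ?odd_double // linear0 ne scale0r addr0.
by move/esym/eqP; rewrite scaler_eq0 /eps signr_eq0 /= => /eqP.
Qed.

(** A surviving term needs a < [col l] and n - 1 - a < [col j], so [col j + col l] exceeds n. The
    bound on the first two columns leaves only j = l = 0, where the operator itself vanishes by
    antisymmetry. *)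
Lemma vlam_Akill : Akill (@actF C n) vlam.
Proof.
move=> p q p0 q0; rewrite Eop_quad ?oppr_eq0 ?gt_eqF // quad_ann_ann //.
have comm a : ann (mode (rev_ord a) `|p|%N) (ann (mode a `|q|%N) vlam) = 0 \/
   ((mode (rev_ord a) `|p|%N \in lamodes) && (mode a `|q|%N \in lamodes)).
  case: (boolP (mode a `|q|%N \in lamodes)) => [h|/ann_creL->]; last by left; rewrite linear0.
  case: (boolP (mode (rev_ord a) `|p|%N \in lamodes)) => [h'|/ann_creL z]; first by right.
  by left; rewrite ann_ann z linear0 scaler0.
have [pq|pq] := boolP ((p == 2) && (q == 2)).
  have [/eqP-> /eqP->] := andP pq; rewrite -quad_ann_ann //.
  have /eqP := @quad_swap C n (-2) (-2) vlam isT isT.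
  rewrite (_ : (-2 == 2 :> int) = false) // !mul0r scale0r addr0 /peps /= expr1 scaleN1r.
  by rewrite -subr_eq0 opprK -mulr2n -scaler_nat scaler_eq0 pnatr_eq0 /= => /eqP.
apply: big1 => a _; case: (comm a) => // /andP[].
rewrite !mem_lamodes => /and3P[pp po h1] /and3P[qp qo h2]; exfalso.
move: h1; rewrite /= => h1.
have hn := ltn_ord a.
have c0 j := col_anti (leq0n j); have c1 j := col_anti (isT : (1 <= j.+1)%N).
move: (h1) (h2) (c0 `|p|%N.-2./2) (c0 `|q|%N.-2./2) (c1 `|p|%N.-2./2.-1) (c1 `|q|%N.-2./2.-1).
case Ej: (`|p|%N.-2./2) => [|j]; case El: (`|q|%N.-2./2) => [|l] /=; lia.
Qed.

(** Moves the box [b] from the fermion of its column to the boson of its row. *)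
Definition Eb (b : nat * nat) : F -> F := E (bos b.1) (fer b.2).
Definition hook_vec (L : seq (nat * nat)) : F := foldr Eb vlam L.

Local Notation W := hook_vec.

Lemma hook_vec_cons b L : W (b :: L) = E (bos b.1) (fer b.2) (W L). Proof. by []. Qed.

(* [L] lists, outermost operator first, the boxes [(i, l)], [i <= l], that
   precede a given one in lexicographic order with columns reversed *)
Fixpoint good (L : seq (nat * nat)) : Prop :=
  if L is (i, j) :: L' then
    [/\ (i <= j)%N, (j < lam i)%N,
     (forall i' l, ((i', l) \in L') =
        [&& (i' <= l)%N, (l < lam i')%N & (i' < i)%N || ((i' == i) && (j < l)%N)]) &
     good L']
  else True.

(** The operators of boxes anticommute and square to zero. *)
Lemma Eb_mem b L : b \in L -> Eb b (W L) = 0.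
Proof.
have anti c u : Eb b (Eb c u) = - Eb c (Eb b u).
  rewrite /Eb Eop_comm // /esgn !hodd_bos !hodd_fer /= expr1 scaleN1r.
  by rewrite !fer_bos mulr0 !scale0r subr0 addr0.
have sq u : Eb b (Eb b u) = 0.
  have /eqP := anti b u; rewrite -subr_eq0 opprK -mulr2n -scaler_nat scaler_eq0.
  by rewrite pnatr_eq0 /= => /eqP.
elim: L => // c L IH; rewrite inE hook_vec_cons -/(Eb c _).
have [<- _|_ /= bL] := eqVneq b c; first exact: sq.
by rewrite anti IH // /Eb Eop0 // oppr0.
Qed.

(** Passing the operator of a box (i, j) leaves that of (i, l), further right in the same row;
    [good] ensures that it has already been applied. *)
Lemma hook_vec_fer_up j l L : good L -> (j < l)%N ->
  (forall i, (i, j) \in L -> (l < lam i)%N) -> E (fer j) (fer l) (W L) = 0.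
Proof.
elim: L => [|[i jj] L IH]; first by move=> _ jl _; apply: vlam_fer.
move=> [ij jlam mem gL] jl hl; rewrite hook_vec_cons /=.
apply: Eop_kill => //.
- by apply: IH => // i' h; apply: hl; rewrite inE h orbT.
- by move=> /eqP; rewrite fer_bos.
move=> /eqP; rewrite fer_eq => /eqP jjj; apply: (@Eb_mem (i, l)).
rewrite jjj in ij mem; rewrite mem eqxx jl orbT andbT (leq_trans ij (ltnW jl)) /=.
by apply: hl; rewrite jjj inE eqxx.
Qed.

Lemma hook_vec_bos_absent p i L : 0 < p -> (forall l, (i, l) \notin L) -> E p (bos i) (W L) = 0.
Proof.
move=> p0; elim: L p p0 => [|[i' l] L IH] p p0 hi; first exact: vlam_bos.
have hL k : (i, k) \notin L by have := hi k; rewrite inE negb_or => /andP[].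
rewrite hook_vec_cons /=; apply: Eop_kill => //; first exact: IH.
  move=> /eqP; rewrite bos_eq => /eqP ii.
  by have := hi l; rewrite inE ii eqxx.
by move=> _; apply: IH.
Qed.

(** Passing a box of row i leaves a raising operator between fermions; passing a box of column j
    leaves a move out of the boson i, which is still empty at that stage. *)
Lemma hook_vec_fer_bos j i L : good L -> (forall l, (i, l) \in L -> (j < l)%N) ->
  (forall i', (i', j) \in L -> (i' < i)%N) -> E (fer j) (bos i) (W L) = 0.
Proof.
elim: L => [|[i1 jj] L IH]; first by move=> _ _ _; apply: vlam_bos.
move=> [ij jlam mem gL] h1 h2; rewrite hook_vec_cons /=.
apply: Eop_kill => //.
- apply: IH => // [l hl|i' hi']; first by apply: h1; rewrite inE hl orbT.
  by apply: h2; rewrite inE hi' orbT.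
- move=> /eqP; rewrite bos_eq => /eqP ii.
  have jjj : (j < jj)%N by apply: h1; rewrite inE ii eqxx.
  apply: hook_vec_fer_up => // i' hi'; apply: leq_trans jlam _; apply: lam_anti.
  by move: hi'; rewrite mem => /and3P[_ _] /orP[/ltnW //|/andP[/eqP-> _]].
move=> /eqP; rewrite fer_eq => /eqP jjj.
have ii : (i1 < i)%N by apply: h2; rewrite jjj inE eqxx.
apply: hook_vec_bos_absent => // l; rewrite mem negb_and negb_and; apply/orP; right; apply/orP; right.
by rewrite negb_or negb_and -leqNgt (ltnW ii) /= gtn_eqF.
Qed.

Lemma hook_vec_diag_bos i L : E (bos i) (bos i) (W L) = (count (fun b => b.1 == i) L)%:R *: W L.
Proof.
elim: L => [|[i' j] L IH]; first by rewrite vlam_bos ?scale0r.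
rewrite hook_vec_cons (Eop_diag HF _ _ _ IH) //= bos_eq bos_fer subr0 (eq_sym i).
by rewrite -natrD addnC.
Qed.

Lemma hook_vec_diag_fer j L : E (fer j) (fer j) (W L) =
  ((col j)%:R - (count (fun b => b.2 == j) L)%:R) *: W L.
Proof.
elim: L => [|[i j'] L IH]; first by rewrite subr0 vlam_fer_diag.
rewrite hook_vec_cons (Eop_diag HF _ _ _ IH) //= fer_eq fer_bos addr0 (eq_sym j).
by rewrite natrD opprD [in RHS]addrCA addrC.
Qed.

Lemma hook_vec_Akill L : Akill (@actF C n) (W L).
Proof. by elim: L => [|b L IH]; [exact: vlam_Akill|apply: Akill_Eop]. Qed.

Lemma good_uniq L : good L -> uniq L.
Proof.
elim: L => // [[i j] L] IH [_ _ mem gL] /=; rewrite IH // andbT mem.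
by rewrite !ltnn andbF !andbF.
Qed.

(** A new box (i, j) multiplies the squared norm by what is left in column j plus what is already in
    row i. At most i boxes have left column j, and i < [col j], so the factor is positive. *)
Lemma hook_vec_neq0 L : good L -> W L != 0.
Proof.
elim: L => [|[i j] L IH]; first by move=> _; apply: vlam_neq0.
move=> /[dup] gL' [ij jlam mem gL]; have WL := IH gL; rewrite hook_vec_cons /=.
apply/eqP => /(lower_odd HF (@actF_adj C n) (fer_gt0 j) (bos_gt0 i)) h.
have : (col j)%:R - (count (fun b => b.2 == j) L)%:R + (count (fun b => b.1 == i) L)%:R = 0 :> C.
  apply: h => //; [by rewrite hodd_fer hodd_bos| |exact: hook_vec_diag_fer|exact: hook_vec_diag_bos].
  apply: hook_vec_fer_bos => // [l|i'].
    by rewrite mem ltnn eqxx => /and3P[].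
  by rewrite mem ltnn andbF orbF => /and3P[].
have cnt : (count (fun b => b.2 == j) L <= i)%N.
  rewrite -size_filter -(size_map fst) -[leqRHS](size_iota 0); apply: uniq_leq_size.
    rewrite map_inj_in_uniq ?filter_uniq ?good_uniq // => [[a b] [c d]].
    by rewrite !mem_filter /= => /andP[/eqP-> _] /andP[/eqP-> _] ->.
  move=> k /mapP[[a b]]; rewrite mem_filter /= => /andP[/eqP-> hb] ->.
  by rewrite mem_iota /=; move: hb; rewrite mem ltnn andbF orbF => /and3P[].
rewrite lamcol in jlam; rewrite -natrB; last by apply: leq_trans cnt (ltnW jlam).
by rewrite -natrD => /eqP; rewrite pnatr_eq0; lia.
Qed.

Lemma good_exists i : exists L, good L /\ forall i' l,
  ((i', l) \in L) = [&& (i' <= l)%N, (l < lam i')%N & (i' < i)%N].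
Proof.
elim: i => [|i [L [gL mL]]].
  by exists [::]; split=> // i' l; rewrite in_nil ltn0 !andbF.
suff [L' [gL' mL']] : exists L', good L' /\ forall i' l, ((i', l) \in L') =
    [&& (i' <= l)%N, (l < lam i')%N & (i' < i)%N || ((i' == i) && (lam i - (lam i - i) <= l)%N)].
  exists L'; split=> // i' l; rewrite mL' ltnS.
  case: (ltngtP i' i) => [h|h|->] //=.
  by case: (leqP i l) => //= il; case: (ltnP l (lam i)) => //= ll; lia.
(* Row i is filled from its right end; [m] counts the boxes already added. *)
suff main m : (m <= lam i - i)%N -> exists L', good L' /\ forall i' l, ((i', l) \in L') =
    [&& (i' <= l)%N, (l < lam i')%N & (i' < i)%N || ((i' == i) && (lam i - m <= l)%N)].
  exact: main (leqnn _).
elim: m => [_|m IH hm].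
  exists L; split=> // i' l; rewrite mL subn0.
  case: (eqVneq i' i) => [->|_] /=; last by rewrite orbF.
  by case: (leqP i l) => //= _; case: (ltnP l (lam i)) => //= h; lia.
have [L' [gL' mL']] := IH (ltnW hm).
exists ((i, lam i - m.+1) :: L')%N; split.
  split=> //; [lia|lia|move=> i' l; rewrite mL'].
  by congr [&& _, _ & _ || (_ && _)]; lia.
move=> i' l; rewrite inE mL' xpair_eqE.
case: (eqVneq i' i) => [->|ne] //=.
rewrite ltnn /=; lia.
Qed.

(** All boxes on or above the diagonal are moved. What each boson gains and each fermion keeps are
    the Frobenius-type coordinates; truncated subtraction makes them 0 past the rank. *)
Lemma joint_vector : exists w : F, [/\ w != 0,
  forall p, 0 < p -> E p (p + 1) w = 0, Akill (@actF C n) w,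
  forall i, E (bos i) (bos i) w = (lam i - i)%N%:R *: w &
  forall j, E (fer j) (fer j) w = (col j - j.+1)%N%:R *: w].
Proof.
have [L [gL mL]] := good_exists (maxn (lam 0) (col 0)).
have big i l : (i <= l)%N -> (l < lam i)%N -> (i < maxn (lam 0) (col 0))%N.
  by move=> il ll; have := lam_anti (leq0n i); lia.
have {}mL i' l : ((i', l) \in L) = (i' <= l)%N && (l < lam i')%N.
  rewrite mL; case: (leqP i' l) => //= il; case: (ltnP l (lam i')) => //= ll.
  exact: big il ll.
have uL := good_uniq gL.
have cb i : count (fun b => b.1 == i) L = (lam i - i)%N.
  rewrite -size_filter -[RHS](size_iota i) -(size_map (fun l => (i, l))); apply/perm_size/uniq_perm.
  - exact: filter_uniq.
  - by rewrite map_inj_uniq ?iota_uniq // => x y [].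
  move=> [a b]; rewrite mem_filter mL /=; apply/idP/mapP => [/and3P[/eqP-> h1 h2]|[k hk [-> ->]]].
    by exists b => //; rewrite mem_iota; lia.
  by move: hk; rewrite mem_iota eqxx; lia.
have cf j : count (fun b => b.2 == j) L = minn j.+1 (col j).
  rewrite -size_filter -[RHS](size_iota 0) -(size_map (fun i => (i, j))); apply/perm_size/uniq_perm.
  - exact: filter_uniq.
  - by rewrite map_inj_uniq ?iota_uniq // => x y [].
  move=> [a b]; rewrite mem_filter mL /= lamcol; apply/idP/mapP => [/and3P[/eqP-> h1 h2]|[k hk [-> ->]]].
    by exists a => //; rewrite mem_iota; lia.
  by move: hk; rewrite mem_iota eqxx; lia.
have df j : E (fer j) (fer j) (W L) = (col j - j.+1)%N%:R *: W L.
  rewrite hook_vec_diag_fer cf -natrB ?geq_minr //; congr (_%:R *: _); lia.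
exists (W L); split=> //.
- exact: hook_vec_neq0.
- move=> p p0; have [[i ->]|[j ->]] : (exists i, p = bos i) \/ (exists j, p = fer j).
    have [m pm] : exists m : nat, p = m.+1%:Z by exists (`|p|.-1)%N; lia.
    case: (boolP (odd m)) => om; [right|left]; exists m./2; rewrite pm /fer /bos; lia.
  + have -> : bos i + 1 = fer i by rewrite /bos /fer; lia.
    (* If the diagonal box (i, i) is present, its operator has already been applied; otherwise the
       fermion of column i has weight zero and nothing can be taken from it. *)
    have [h|h] := ltnP i (lam i); first by apply: (@Eb_mem (i, i)); rewrite mL leqnn h.
    apply: Eop_zero_weight => //; rewrite df.
    have : ~~ (i < col i)%N by rewrite -lamcol -leqNgt.
    by move=> h'; rewrite (_ : (col i - i.+1)%N = 0%N) ?scale0r //; lia.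
  have -> : fer j + 1 = bos j.+1 by rewrite /bos /fer; lia.
  by apply: hook_vec_fer_bos => // [l|i']; rewrite mL => /andP[].
- exact: hook_vec_Akill.
- by move=> i; rewrite hook_vec_diag_bos cb.
Qed.

End JointVectors.

(** * Partitions and weights *)

Section PartitionLemmas.
Variables (n : nat) (l : n.-tuple nat).
Hypothesis Hl : is_partition l.

Lemma part_anti i i' : (i <= i')%N -> (part l i'.+1 <= part l i.+1)%N.
Proof.
move=> ii; rewrite /part /=; have [h|h] := ltnP i' (size l); last by rewrite nth_default.
apply: (sorted_leq_nth (leT := geq)) => //.
- by move=> a b c /=; exact: (fun h1 h2 => leq_trans h2 h1).
- by move=> a /=.
- by rewrite inE (leq_ltn_trans ii h).
Qed.

Lemma part_conjpart i j : (j < part l i.+1)%N = (i < conjpart l j.+1)%N.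
Proof.
rewrite /part /conjpart /=; move: Hl; rewrite /is_partition.
elim: (tval l) i => [|a s IH] i //=; first by rewrite nth_nil.
move=> hs; have hs' := path_sorted hs.
have [ja|ja] := ltnP j a; first by case: i => [|i] /=; rewrite ?ja // add1n ltnS IH.
rewrite add0n; have z : count (fun b => j < b)%N s = 0%N.
  apply/eqP; rewrite -leqn0 leqNgt -has_count; apply/hasPn => b bs; rewrite -leqNgt.
  move: hs; rewrite path_sortedE; last by move=> x y z /= h1 h2; exact: leq_trans h2 h1.
  by move=> /andP[/allP/(_ b bs) /= ba _]; apply: leq_trans ba ja.
case: i => [|i] /=; first by rewrite ltnNge ja z.
by rewrite IH // z.
Qed.

Lemma conjpart_anti j j' : (j <= j')%N -> (conjpart l j'.+1 <= conjpart l j.+1)%N.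
Proof. by move=> jj; apply: sub_count => a /=; apply: leq_ltn_trans. Qed.

Lemma rank_partP i : (i < part l i.+1)%N = (i < rank_part l)%N.
Proof.
apply/idP/idP => h.
  have ln : (i.+1 < n.+1)%N.
    rewrite ltnS; have := h; rewrite /part /=; have [//|nl] := ltnP i n.
    by rewrite nth_default ?size_tuple.
  have := @leq_bigmax_cond _ (fun i : 'I_n.+1 => ((0 < i) && (i <= part l i))%N) val (Ordinal ln).
  by apply; rewrite /= h.
have [k hk rk] : exists2 k : 'I_n.+1, ((0 < k) && (k <= part l k))%N & rank_part l = k.
  have [|k hk rk] := @eq_bigmax_cond _ (fun i : 'I_n.+1 => ((0 < i) && (i <= part l i))%N) val.
    apply/card_gt0P; apply: contrapT => nk.
    move: h; rewrite /rank_part big1 // => k hk; exfalso; apply: nk; exists k; exact: hk.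
  by exists k.
rewrite rk in h; case: (nat_of_ord k) hk h => // m /andP[_ mk] h.
have im : (i <= m)%N by [].
exact: leq_trans (leq_trans h mk) (part_anti im).
Qed.

End PartitionLemmas.

Lemma sum_ir_even (V : zmodType) N (G : int -> V) : (forall p, G (- p) = G p) ->
  \sum_(p <- ir N) G p = (\sum_(1 <= m < N.+1) G m%:Z) *+ 2.
Proof.
move=> hG; rewrite mulr2n.
have -> : \sum_(1 <= m < N.+1) G m%:Z = \sum_(p <- [seq m%:Z | m <- iota 1 N]) G p.
  by rewrite big_map /index_iota subn1.
have {2}-> : \sum_(p <- [seq m%:Z | m <- iota 1 N]) G p =
    \sum_(p <- [seq - m%:Z | m <- iota 1 N]) G p.
  by rewrite !big_map; apply: eq_bigr => m _; rewrite hG.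
rewrite -big_cat; apply/perm_big/uniq_perm; first exact: ir_uniq.
  rewrite cat_uniq !map_inj_uniq ?iota_uniq /= ?andbT; try by move=> a b; lia.
  apply/hasPn => p /mapP[m hm ->]; apply/mapP => -[k hk]; move: hm hk.
  by rewrite !mem_iota; lia.
move=> p; rewrite mem_ir mem_cat; apply/idP/orP => [h|[]/mapP[m]]; last first.
- by rewrite mem_iota => hm ->; lia.
- by rewrite mem_iota => hm ->; lia.
have [p0|p0] := ltrP 0 p; [left|right]; apply/mapP; exists `|p|%N; rewrite ?mem_iota; lia.
Qed.

(** * The weight of the Fock vector *)

Section Sufficiency.
Variables (C : numClosedFieldType) (n : nat) (l : n.-tuple nat).
Hypothesis Hl : is_partition l.
Hypothesis Hc : (conjpart l 1 + conjpart l 2 <= n)%N.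
Local Notation F := (fockL C).
Local Notation T := (@nquad C n).
Local Notation E := (Eop (@actF C n)).
Implicit Types (p q k : int) (w : F).
Let HF := actF_module C n.

(** The coordinates xi_{m/2} with truncated subtraction, which vanish by themselves for m > 2r. *)
Definition hw_weight (m : nat) : nat :=
  if odd m then (part l m./2.+1 - m./2)%N else (conjpart l m./2 - m./2)%N.

Lemma fock_highest : exists w : F, [/\ w != 0,
  forall k x, 0 < k -> Ddegree k x -> actF n x w = 0 &
  forall h : Dhat0 C, actF n h w = LambdaD l h *: w].
Proof.
have [w [w0 simple kill db df]] := @joint_vector C n (fun i => part l i.+1)
  (fun j => conjpart l j.+1) (part_conjpart Hl) (part_anti Hl) (@conjpart_anti n l) Hc.
(* Simple raising operators generate: E_{p,q+1} is the bracket of E_{p,q} and E_{q,q+1}. *)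
have up (m : nat) p : 0 < p -> E p (p + m.+1%:Z) w = 0.
  move=> p0; elim: m => [|m IH]; first exact: simple.
  have := Eop_comm HF (p := p) (q := p + m.+1%:Z) (r := p + m.+1%:Z) (s := p + m.+2%:Z) w.
  rewrite IH Eop0 // (_ : p + m.+2%:Z = p + m.+1%:Z + 1); last lia.
  rewrite simple; last lia.
  rewrite Eop0 // scaler0 add0r eqxx scale1r (_ : (_ == p) = false); last lia.
  by rewrite mulr0 scale0r subr0 => h; rewrite -h //; lia.
have {}up p q : 0 < p -> p < q -> E p q w = 0.
  by move=> p0 pq; have := up `|q - p|.-1 p p0; rewrite (_ : p + _ = q) //; lia.
(* Two positive indices give a raising operator, a negative and a positive one a pair annihilator;
   two negative ones reduce to positive ones by reflection. *)
have Tup p q : p != 0 -> q != 0 -> p < q -> T p q w = 0.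
  move=> p0 q0 pq; have [qp|qn] := ltrP 0 q.
    rewrite nquad_pos // -Eop_quad //; have [pp|pn] := ltrP 0 p; first exact: up.
    by rewrite -[p]opprK; apply: kill => //; lia.
  rewrite -[p]opprK -[q]opprK nquad_dual ?oppr_eq0 //; last lia.
  by rewrite -Eop_quad ?up ?scaler0 ?oppr_eq0 //; lia.
have dm (m : nat) : (0 < m)%N -> E m%:Z m%:Z w = (hw_weight m)%:R *: w.
  move=> m0; rewrite /hw_weight; case: ifP => om.
    by have := db m./2; rewrite /bos (_ : m./2.*2.+1 = m) //; lia.
  by have := df m./2.-1; rewrite /fer (_ : m./2.-1.*2.+2 = m) ?prednK //; lia.
exists w; split=> //.
  move=> k x k0 [dx cx]; rewrite /actF cx; last lia.
  rewrite mulr0 scale0r addr0; have [W hW] := gl_band (x : glhat C).1.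
  have [K hK] := level_exists n w; rewrite (rhoE hK hW (leqnn _)) /rhoT.
  rewrite big_seq big1 ?scaler0 // => p; rewrite mem_ir => /andP[p0 _].
  rewrite big_seq big1 // => q; rewrite mem_ir => /andP[q0 _].
  have [->|/dx pq] := eqVneq ((x : glhat C).1 p q) 0; first by rewrite scale0r.
  by rewrite Tup ?scaler0 //; lia.
move=> h; have /asboolP Dh := DhatvalP h; have /asboolP[dh _] := Dhat0valP h.
have [W hW] := gl_band (h : glhat C).1; have [K hK] := level_exists n w.
pose N := (K + W + (xi_r l).*2)%N.
have hE : rho n (h : glhat C).1 w = (\sum_(1 <= m < N.+1) (hw_weight m)%:R * omegaw m h) *: w.
  rewrite (rhoE (N := N) hK hW) ?leq_addr // /rhoT.
  transitivity (2^-1 *: \sum_(p <- ir N) (h : glhat C).1 p p *: T p p w).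
    congr (_ *: _); rewrite big_seq [RHS]big_seq; apply: eq_bigr => p pN.
    rewrite (bigD1_seq p) ?ir_uniq //= big1 ?addr0 // => q /negPf qp.
    have [->|/dh pq] := eqVneq ((h : glhat C).1 p q) 0; first by rewrite scale0r.
    by move: qp; rewrite pq subr0 eqxx.
  rewrite sum_ir_even => [|p].
    rewrite -[X in 2^-1 *: X]scaler_nat scalerA mulVf ?pnatr_eq0 // scale1r scaler_suml.
    rewrite big_nat [RHS]big_nat; apply: eq_bigr => m hm.
    have m0 : 0 < m%:Z by lia.
    rewrite nquad_pos // -Eop_quad ?gt_eqF // dm; last lia.
    by rewrite scalerA mulrC.
  (* By skewness the negative half of the diagonal repeats the positive half, which cancels the 1/2
     in [rhoT]. *)
  have key q : 0 < q -> (h : glhat C).1 (- q) (- q) *: T (- q) (- q) w =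
      (h : glhat C).1 q q *: T q q w.
    move=> q0; have q1 : q != 0 by rewrite gt_eqF.
    rewrite nquad_dual // nquad_pos // scalerA; congr (_ *: _).
    rewrite [(h : glhat C).1 q q](inD_sg Dh) // /sg /peps !vsgnN //.
    transitivity (- ((h : glhat C).1 (- q) (- q) * (vsgn C q * vsgn C q))); last first.
      by rewrite addbb /= expr0; ring.
    have vq : vsgn C q = 1 by rewrite /vsgn gtr0_sgz //; case: hodd.
    by rewrite vq; case: (hodd q); rewrite /= ?(expr0, expr1); ring.
  have [->|p0] := eqVneq p 0; first by rewrite oppr0.
  have [pp|pn] := ltrP 0 p; first exact: key.
  by have := key (- p); rewrite opprK => <- //; lia.
rewrite /actF hE -scalerDl; congr (_ *: _); rewrite /LambdaD /weight; congr (_ + _).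
have r1 i : (i < part l i.+1)%N -> (i < xi_r l)%N.
  rewrite /xi_r rank_partP //; case: ifP => // z h'.
  move: h'; rewrite -rank_partP // /part /=; have [h'|h'] := ltnP i (size l).
    by move/all_nthP: z => /(_ 0%N i h') /eqP->.
  by rewrite nth_default.
have r2 i : zero_part l = false -> (i < xi_r l)%N -> (i < part l i.+1)%N.
  by move=> z; rewrite /xi_r z rank_partP.
rewrite (@big_cat_nat _ _ _ (xi_r l).*2.+1) //=; last by rewrite /N; lia.
rewrite [X in _ + X](_ : _ = 0) ?addr0; last first.
  rewrite big_nat big1 // => m /andP[hm _]; rewrite (_ : hw_weight m = 0%N) ?mul0r //.
  rewrite /hw_weight; case: ifP => om; apply/eqP; rewrite subn_eq0 leqNgt; apply/negP.
    by move/r1; lia.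
  have [m' m'E] : exists m', m./2 = m'.+1 by exists m./2.-1; lia.
  rewrite m'E => /ltnW; rewrite -part_conjpart // => /r1; lia.
rewrite big_nat [RHS]big_nat; apply: eq_bigr => m hm; congr (_ * _).
rewrite /hw_weight /xi_part; case: (boolP (zero_part l)) => z.
  have pz i : part l i.+1 = 0%N.
    rewrite /part /=; have [h'|h'] := ltnP i (size l); last by rewrite nth_default.
    by move/all_nthP: z => /(_ 0%N i h') /eqP.
  case: ifP => om; first by rewrite pz sub0n.
  have [m' m'E] : exists m', m./2 = m'.+1 by exists m./2.-1; lia.
  rewrite m'E (_ : conjpart l m'.+1 = 0%N) ?sub0n //.
  by apply/eqP; rewrite -leqn0 leqNgt -part_conjpart // pz.
have {}r2 := fun i => r2 i (negbTE z).
case: ifP => om.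
  have -> : (m.+1)./2 = m./2.+1 by lia.
  have /r2 h' : (m./2 < xi_r l)%N by lia.
  by rewrite pmulrn -subzn // ltnW.
have [m' m'E] : exists m', m./2 = m'.+1 by exists m./2.-1; lia.
have /r2 : (m' < xi_r l)%N by lia.
by rewrite part_conjpart // m'E => h'; rewrite pmulrn -subzn.
Qed.

End Sufficiency.

(** * From weights to partitions *)

Section ChainPartition.
Variables (n r : nat) (x : nat -> int).
Hypothesis r0 : (0 < r)%N.
Hypothesis xr : forall m : nat, (r.*2 < m)%N -> x m = 0.
Hypothesis Hchain : chain_cond r x.
Hypothesis Hlevel : level_cond n x.

Let b (i : nat) : nat := `|x i.*2.+1|%N.
Let f (j : nat) : nat := `|x j.*2.+2|%N.

Lemma chain_values : [/\ forall i, (i < r)%N -> x i.*2.+1 = (b i)%:Z,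
  forall j, (j < r)%N -> x j.*2.+2 = (f j)%:Z,
  forall i, (i.+1 < r)%N -> (b i.+1 < b i)%N &
  forall j, (j.+1 < r)%N -> (f j.+1 < f j)%N].
Proof.
case: Hchain => h1 h2 h3 h4 _.
have d1 i : (i.+1 < r)%N -> x i.+1.*2.+1 < x i.*2.+1 by move=> ir; have := h1 i.+1 ir.
have d2 i : (i.+1 < r)%N -> x i.+1.*2.+2 < x i.*2.+2 by move=> ir; have := h3 i.+1 ir.
have p1 k : (k < r)%N -> 0 <= x (r.-1 - k).*2.+1.
  elim: k => [|k IH] kr.
    by rewrite subn0 (_ : r.-1.*2.+1 = r.*2.-1) //; lia.
  have := IH (ltnW kr); rewrite (_ : r.-1 - k = (r.-1 - k.+1).+1)%N; last lia.
  move=> h; apply: le_trans h (ltW (d1 _ _)); lia.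
have p2 k : (k < r)%N -> 0 <= x (r.-1 - k).*2.+2.
  elim: k => [|k IH] kr.
    by rewrite subn0 (_ : r.-1.*2.+2 = r.*2) //; lia.
  have := IH (ltnW kr); rewrite (_ : r.-1 - k = (r.-1 - k.+1).+1)%N; last lia.
  move=> h; apply: le_trans h (ltW (d2 _ _)); lia.
have q1 i : (i < r)%N -> x i.*2.+1 = (b i)%:Z.
  by move=> ir; have := p1 (r.-1 - i)%N; rewrite (_ : r.-1 - (r.-1 - i) = i)%N /b; lia.
have q2 i : (i < r)%N -> x i.*2.+2 = (f i)%:Z.
  by move=> ir; have := p2 (r.-1 - i)%N; rewrite (_ : r.-1 - (r.-1 - i) = i)%N /f; lia.
split=> // i ir.
  by have := d1 i ir; rewrite !q1 //; lia.
by have := d2 i ir; rewrite !q2 //; lia.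
Qed.

Lemma antitone_lt (g : nat -> nat) i i' : (forall i, (i.+1 < r)%N -> (g i.+1 < g i)%N) ->
  (i <= i')%N -> (i' < r)%N -> (g i' + i' <= g i + i)%N.
Proof.
move=> hg ii; have [d ->] : exists d, i' = (i + d)%N by exists (i' - i)%N; lia.
elim: d {ii} => [|d IH] h; first by rewrite addn0.
have := IH; rewrite addnS in h *; move=> /(_ (ltnW h)).
have := hg (i + d)%N h; lia.
Qed.

Lemma count_initial (P : pred nat) k j : (forall j j', (j <= j')%N -> P j' -> P j) ->
  (j < count P (iota 0 k))%N = (j < k)%N && P j.
Proof.
move=> hP; elim: k => [|k IH]; first by rewrite ltn0.
rewrite -[in iota _ _](addn1 k) iotaD count_cat /= add0n addn0.
case: (boolP (P k)) => Pk /=.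
  have all_P : count P (iota 0 k) = k.
    rewrite -[RHS](size_iota 0); apply/eqP; rewrite -all_count; apply/allP => m.
    by rewrite mem_iota => hm; apply: hP Pk; lia.
  by rewrite all_P addn1; have [jk|//] := ltnP j k.+1; rewrite (hP j k).
rewrite addn0 IH ltnS [in RHS]leq_eqVlt.
by case: eqP => [->|_] //=; rewrite (negPf Pk) ltnn.
Qed.

Lemma chain_partition : exists l : n.-tuple nat,
  [/\ is_partition l, (conjpart l 1 + conjpart l 2 <= n)%N &
   forall (C : numClosedFieldType) (h : Dhat0 C), weight n r x h = LambdaD l h].
Proof.
have [bE fE bdec fdec] := chain_values.
(* By the last clause of the chain condition this is the zero weight, hence the zero partition.
   Otherwise xi_{r-1/2} > 0, which makes each of the first r rows and columns at least r long. *)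
have [z|nz] := eqVneq (x r.*2.-1) 0.
  have [r1 x1 x2] : [/\ r = 1%N, x 1%N = 0 & x 2%N = 0] by case: Hchain => _ _ _ _ [/(_ z)].
  exists (nseq_tuple n 0%N).
  have c0 j : conjpart (nseq_tuple n 0%N) j.+1 = 0%N.
    by rewrite /conjpart /= count_nseq /=.
  have zp : zero_part (nseq_tuple n 0%N) by rewrite /zero_part /= all_nseq orbT.
  split=> [||C h]; first 1 last.
  - by rewrite !c0.
  - rewrite /LambdaD /weight /xi_r zp r1; congr (_ + _).
    rewrite !big_nat; apply: eq_bigr => m hm; congr (_%:~R * _).
    by rewrite /xi_part zp; case: m hm => [|[|[|m]]].
  rewrite /is_partition /=; elim: (n) => // -[|k] //= ->; by rewrite andbT.
have rr : (r.-1 < r)%N by lia.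
have blast : (0 < b r.-1)%N.
  by have := bE _ rr; rewrite (_ : r.-1.*2.+1 = r.*2.-1); lia.
have blow i : (i < r)%N -> (r <= b i + i)%N.
  move=> ir; have ir' : (i <= r.-1)%N by lia.
  by have := antitone_lt bdec ir' rr; lia.
have bpos i : (i < r)%N -> (0 < b i)%N by move=> ir; have := blow i ir; lia.
have flow j : (j < r)%N -> (r <= f j + j.+1)%N.
  move=> jr; have jr' : (j <= r.-1)%N by lia.
  by have := antitone_lt fdec jr' rr; lia.
(* Inverts the Frobenius-type coordinates: the first r rows and columns are prescribed, and every
   later row counts the prescribed columns that reach it. *)
pose lam i := if (i < r)%N then (b i + i)%N
  else count (fun j => (j < r)%N && (i < f j + j.+1)%N) (iota 0 r).
pose col j := if (j < r)%N then (f j + j.+1)%N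
  else count (fun i => (i < r)%N && (j < b i + i)%N) (iota 0 r).
have ini1 i j j' : (j <= j')%N -> (j' < r)%N && (i < f j' + j'.+1)%N ->
    (j < r)%N && (i < f j + j.+1)%N.
  by move=> jj /andP[jr h]; have := antitone_lt fdec jj jr; lia.
have ini2 j i i' : (i <= i')%N -> (i' < r)%N && (j < b i' + i')%N ->
    (i < r)%N && (j < b i + i)%N.
  by move=> jj /andP[jr h]; have := antitone_lt bdec jj jr; lia.
have lamcol i j : (j < lam i)%N = (i < col j)%N.
  rewrite /lam /col; case: (ltnP i r) => ir; case: (ltnP j r) => jr.
  - by have := blow i ir; have := flow j jr; lia.
  - by rewrite (count_initial _ _ (ini2 j)) ir.
  - by rewrite (count_initial _ _ (ini1 i)) jr.
  rewrite (count_initial _ _ (ini2 j)) (count_initial _ _ (ini1 i)).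
  by rewrite !(ltnNge _ r) ir jr.
have lam_anti i i' : (i <= i')%N -> (lam i' <= lam i)%N.
  move=> ii; rewrite leqNgt; apply/negP; rewrite lamcol => h.
  have : (i' < col (lam i))%N.
    move: h; rewrite -!lamcol; lia.
  rewrite ltnNge => /negP; apply; apply: leq_trans ii.
  by rewrite leqNgt -lamcol ltnn.
(* For r > 1 the first two columns are xi_1 + 1 and xi_2 + 2, and l_{1,2} and the minimum add up to
   3. For r = 1 the second column has length 1 or 0 according to whether xi_{1/2} >= 2, so the two
   columns add up to xi_1 + l_{1,2}(xi_{1/2}). *)
have c01 : (col 0%N + col 1%N <= n)%N.
  move: Hlevel; rewrite /level_cond /col r0.
  have f0 := fE 0%N r0; have b0 := bE 0%N r0; have bp := bpos 0%N r0.
  rewrite [x 2%N]f0 [x 1%N]b0 abszE /=.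
  have [r1|r1] := ltnP 1 r.
    have f1 := fE 1%N r1; have b1 := bE 1%N r1; have bp1 := bpos 1%N r1.
    have := bdec 0%N r1; rewrite [x 4%N]f1 [x 3%N]b1.
    by case: (b 0%N) bp => [|[|k]] //=; lia.
  have r1' : r = 1%N by lia.
  rewrite (xr (m := 4)) ?(xr (m := 3)) ?r1' //=.
  rewrite addn0; case: (b 0%N) bp => [|[|k]] //=; lia.
have lam0 i : (n <= i)%N -> lam i = 0%N.
  move=> ni; apply/eqP; rewrite -leqn0 leqNgt lamcol; lia.
pose l : n.-tuple nat := [tuple lam i | i < n].
have lE i : part l i.+1 = lam i.
  rewrite -[part l i.+1]/(nth 0%N l i); have [h|h] := ltnP i n; last first.
    by rewrite (lam0 _ h) nth_default ?size_tuple.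
  by rewrite -[i in LHS]/(val (Ordinal h)) -tnth_nth tnth_mktuple.
have pl : is_partition l.
  rewrite /is_partition; apply/(sortedP 0%N) => i; rewrite size_tuple => h.
  by have := lE i; have := lE i.+1; rewrite /part /= => -> ->; apply: lam_anti.
have cE j : conjpart l j.+1 = col j.
  apply/eqP; rewrite eqn_leq; apply/andP; split; rewrite leqNgt; apply/negP => h.
    by move: (h); rewrite -part_conjpart // lE lamcol ltnn.
  by move: (h); rewrite -lamcol -lE part_conjpart // ltnn.
have rE : rank_part l = r.
  have rk i : (i < rank_part l)%N = (i < r)%N.
    rewrite -rank_partP // lE lamcol /col; case: (ltnP i r) => ir; first lia.
    by rewrite (count_initial _ _ (ini2 i)) ltnNge ir.
  by apply/eqP; rewrite eqn_leq; apply/andP; split; rewrite leqNgt; apply/negP => h;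
    have := rk (minn r (rank_part l)); lia.
have zp : zero_part l = false.
  apply/negP => /allP /= h; have : (0 < part l 1)%N.
    by rewrite lE lamcol /col r0; lia.
  rewrite -[part l 1]/(nth 0%N l 0); have [n0|n0] := posnP n.
    by rewrite nth_default // size_tuple n0.
  have h0 : (0 < size l)%N by rewrite size_tuple.
  by have /eqP -> := h _ (mem_nth 0%N h0).
exists l; split=> // [|C h]; first by rewrite !cE.
rewrite /LambdaD /weight /xi_r zp rE; congr (_ + _).
rewrite big_nat [RHS]big_nat; apply: eq_bigr => m hm; congr (_%:~R * _).
rewrite /xi_part zp; case: (boolP (odd m)) => om.
  have -> : (m.+1)./2 = m./2.+1 by lia.
  rewrite lE /lam (_ : (m./2 < r)%N); last lia.
  have := bE m./2; rewrite (_ : m./2.*2.+1 = m); last lia.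
  by move=> ->; lia.
have [m' m'E] : exists m', m./2 = m'.+1 by exists m./2.-1; lia.
rewrite m'E cE /col (_ : (m' < r)%N); last lia.
have := fE m'; rewrite (_ : m'.*2.+2 = m); last lia.
by move=> ->; lia.
Qed.

End ChainPartition.

(** The order of R[i] compares real parts of numbers with equal imaginary parts, so the archimedean
    property of R applies to the real part of m. *)
Lemma complex_archimedean (R : realType) (m : R[i]) : 0 <= m -> exists k : nat, ~ k%:R <= m.
Proof.
case: m => a b; rewrite lecE /= => /andP[_ a0]; exists (Num.bound a).
rewrite -[_%:R]/(1 *+ _) -(rmorph_nat (real_complex R)) lecE /= => /andP[_].
by rewrite leNgt archi_boundP.
Qed.

Theorem theorem5p10 (R : realType) (M : lmodType R[i])
    (act : Dhat R[i] -> M -> M) (xi : {scalar Dhat0 R[i]}) (v : M) :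
  is_module act ->
  irreducible act ->
  highest_weight act xi v ->
  quasi_finite act v ->
  (unitarizable act <->
     exists (n : nat) (l : n.-tuple nat),
       [/\ is_partition l,
           (conjpart l 1 + conjpart l 2 <= n)%N &
           forall h : Dhat0 R[i], xi h = LambdaD l h]) /\
  (unitarizable act <->
     exists (n r : nat) (x : nat -> int),
       [/\ (0 < r)%N,
           forall m : nat, (r.*2 < m)%N -> x m = 0,
           chain_cond r x,
           level_cond n x &
           forall h : Dhat0 R[i], xi h = weight n r x h]).
Proof.
move=> Hact Hirr Hhw Hqf.
have chain := unitarizable_chain (@complex_archimedean R) Hact Hhw Hqf.
have partition n r x : [/\ (0 < r)%N, forall m : nat, (r.*2 < m)%N -> x m = 0,
    chain_cond r x, level_cond n x & forall h : Dhat0 R[i], xi h = weight n r x h] ->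
  exists (n : nat) (l : n.-tuple nat), [/\ is_partition l,
    (conjpart l 1 + conjpart l 2 <= n)%N & forall h : Dhat0 R[i], xi h = LambdaD l h].
  move=> [r0 xr hc hl xiE]; have [l [pl cl wl]] := chain_partition r0 xr hc hl.
  by exists n, l; split=> // h; rewrite xiE wl.
have unitary n (l : n.-tuple nat) : [/\ is_partition l,
    (conjpart l 1 + conjpart l 2 <= n)%N & forall h : Dhat0 R[i], xi h = LambdaD l h] ->
    unitarizable act.
  move=> [pl cl xiE]; have [w [w0 upw hw]] := fock_highest R[i] pl cl.
  apply: (unitary_transfer (g := @fdot R[i]) Hact (actF_module R[i] n) Hirr Hhw
    (@actF_adj R[i] n) w0) => // h.
  by rewrite hw xiE.
split; split.
- by move=> /chain[n [r [x /partition]]].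
- by move=> [n [l /unitary]].
- exact: chain.
- by move=> [n [r [x /partition[n' [l /unitary]]]]].
Qed.
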